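(* For $\mathcal{M}_k(q)=\sum_{\chi\neq\chi_0}\left|L\left(\tfrac12,\chi\right)\right|^{2k}$, we have $$\mathcal{M}_k(q)\ \gg_k\ \phi(q)\,(\log q)^{k^2}$$ for all rational $k\in(0,1)$ and prime $q$.
   Context: The sum defining $\mathcal{M}_k(q)$ runs over all non-principal Dirichlet characters $\chi$ modulo $q$; $\chi_0$ is the principal character modulo $q$, $L(s,\chi)$ is the Dirichlet $L$-function of $\chi$, and $\phi$ is Euler's totient function. The notation $\gg_k$ means that the lower bound holds up to a positive implied constant which may depend on $k$.
   Formalization: The bound is stated for all primes q > 2: for q = 2 there is no non-principal character, so the sum is empty and equals 0 while φ(2)(log 2)^{k²} > 0, and the claim fails there. *)

(* Defs.v *)
From HB Require Import structures.
From mathcomp Require Import all_boot all_order all_algebra.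
From mathcomp Require Import cyclic complex.
From mathcomp Require Import all_classical all_reals all_analysis.

Set Implicit Arguments.
Unset Strict Implicit.
Unset Printing Implicit Defensive.

Import Order.TTheory GRing.Theory Num.Theory.
Import numFieldNormedType.Exports.

Local Open Scope classical_set_scope.
Local Open Scope ring_scope.
Local Open Scope complex_scope.

Definition dirichlet_character (R : realType) (q : nat) (chi : int -> R[i]) : Prop :=
  [/\ forall n, chi (n + q%:Z) = chi n,
      forall m n, chi (m * n) = chi m * chi n &
      forall n, (chi n != 0) = coprimez n q%:Z].

Definition principal_character (R : realType) (q : nat) : int -> R[i] :=
  fun n => (coprimez n q%:Z)%:R.

Definition nonprincipal_characters (R : realType) (q : nat) : set (int -> R[i]) :=
  [set chi | dirichlet_character q chi /\ chi <> principal_character R q].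

(* n ^ (- s), for n > 0 *)
Definition natpow_opp (R : realType) (n : nat) (s : R[i]) : R[i] :=
  (n%:R `^ (- complex.Re s))%:C *
  (cos (complex.Im s * ln n%:R) -i* sin (complex.Im s * ln n%:R)).

(* The limit of the partial sums of the Dirichlet series. For chi non-principal
   the series converges (conditionally) on the whole half-plane Re s > 0, where
   its sum is L(s, chi). Where the series diverges, the value is meaningless. *)
Definition dirichlet_L (R : realType) (s : R[i]) (chi : int -> R[i]) : R[i] :=
  limn (fun N : nat => \sum_(1 <= n < N.+1) chi n%:Z * natpow_opp n s : (R[i])^o).

(* The sum \sum_(_ \in _) ranges over a set, and would be 0 for an infinite
   support; finite_nonprincipal_characters below rules this out. *)
Definition L_moment (R : realType) (k : R) (q : nat) : R :=
  \sum_(chi \in @nonprincipal_characters R q)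
    (ComplexField.Normc.normc (dirichlet_L (2^-1)%:C chi)) `^ (2 * k).

Lemma finite_dirichlet_characters (R : realType) (q : nat) : (0 < q)%N ->
  finite_set [set chi : int -> R[i] | dirichlet_character q chi].
Proof.
move=> q0; pose p : {poly R[i]} := 'X * ('X^(totient q) - 1).
have p0 : p != 0.
  rewrite mulf_neq0 ?polyX_eq0 // -size_poly_eq0 size_XnsubC //.
  by rewrite totient_gt0.
have [r pE] := closed_field_poly_normal p.
have rP z : root p z -> z \in r.
  by rewrite pE rootZ ?lead_coef_eq0// root_prod_XsubC.
pose g (f : {ffun 'I_q -> seq_sub r}) : int -> R[i] :=
  fun n => oapp (fun i => ssval (f i)) 0 (insub `|(n %% q%:Z)%Z|%N).
have modlt (n : int) : (`|(n %% q%:Z)%Z| < q)%N.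
  by rewrite -ltz_nat gez0_abs ?modz_ge0 ?ltz_pmod// eqz_nat; case: (q) q0.
apply: (sub_finite_set (B := g @` setT)); last exact/finite_image/finite_finset.
move=> chi [per mul nz].
have chi1 : chi 1 = 1.
  have c1 : chi 1 != 0 by rewrite nz coprimezE coprime1n.
  by apply: (mulfI c1); rewrite mulr1 -mul.
have chiX (m n : nat) : chi (m ^ n)%N%:Z = chi m%:Z ^+ n.
  elim: n => [|n IH]; first by rewrite expn0 expr0.
  by rewrite expnS PoszM mul IH exprS.
have perM (n : int) (m : nat) : chi (n + m%:Z * q%:Z) = chi n.
  elim: m => [|m IH]; first by rewrite mul0r addr0.
  by rewrite -addn1 PoszD mulrDl mul1r addrA per.
have chimod (n : int) : chi n = chi (n %% q%:Z)%Z.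
  rewrite {1}(divz_eq n q%:Z) addrC; case: (n %/ q%:Z)%Z => m; first exact: perM.
  rewrite NegzE -(perM _ m.+1); congr chi.
  by rewrite mulNr addrNK.
have chir n : chi n \in r.
  apply: rP; rewrite rootM rootX; case: eqP => //= /eqP cn0.
  rewrite chimod; set a := (n %% q%:Z)%Z.
  have aE : a = `|a|%N%:Z by rewrite gez0_abs// modz_ge0// eqz_nat; case: (q) q0.
  have cop : coprime `|a| q by rewrite -[coprime _ _]/(coprimez a q%:Z) -nz -chimod.
  by rewrite rootE !hornerE aE -chiX chimod modz_nat Euler_exp_totient// -modz_nat -chimod chi1 subrr.
exists [ffun i : 'I_q => SeqSub (chir i%:Z)] => //.
apply/funext => n; rewrite /g insubT // => modn_lt; rewrite /= ffunE /= [RHS]chimod.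
congr chi; by rewrite gez0_abs// modz_ge0// eqz_nat; case: (q) q0.
Qed.

Lemma finite_nonprincipal_characters (R : realType) (q : nat) : (0 < q)%N ->
  finite_set (@nonprincipal_characters R q).
Proof.
move=> q0; apply: sub_finite_set (finite_dirichlet_characters R q0).
by move=> chi [].
Qed.

(* Main.v *)
Require Import Defs.
From HB Require Import structures.
From mathcomp Require Import all_boot all_order all_algebra.
From mathcomp Require Import complex.
From mathcomp Require Import all_classical all_reals all_analysis.
From mathcomp Require Import ring lra zify.
From mathcomp Require Import cyclic finfield.

Set Implicit Arguments.
Unset Strict Implicit.
Unset Printing Implicit Defensive.

Import Order.TTheory GRing.Theory Num.Theory.
Import numFieldNormedType.Exports.
Import ComplexField.

Local Open Scope ring_scope.
Local Open Scope complex_scope.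

(* Write k = u/v. Let P and A be short Dirichlet polynomials imitating
   L^(k-1) and L^(1/v): products, over blocks of primes, of truncated
   exponentials of the prime sums, as in the work of Heap and Soundararajan.
   Young's inequality gives, for each character and every T > 0,
     |L P A^u| <= (T/2) |L|^(2k) + (|L P|^2 + |P A^v|^2) / (2 T).
   Hence it suffices to bound the sum of |L P A^u| below, and those of |L P|^2
   and |P A^v|^2 above, by constant multiples of phi(q) (log q)^(k^2).
   Orthogonality of characters does this for |L P A^u| and |P A^v|^2, since P
   and A have length at most q^(1/100).

   For |L P|^2, the Dirichlet series of L is cut at a random point near
   sqrt q. The part below the cutoff has fewer than q terms and is again
   treated by orthogonality. The part above it is expanded into additive
   characters modulo q, where it becomes a dual sum of the same shape: this
   replaces the functional equation. The logarithm of the cutoff is a sum of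
   independent uniform variables, one for each block of primes, so that
   multiplying the cutoff by an integer m costs little on average; the
   coefficients of L P are thereby bounded by products of factors which depend
   on one block each, and an Euler product gives the sum of their squares.

   The finitely many small q only need some L(1/2, chi) to be nonzero. *)

(** * Additive and multiplicative characters *)

(** If [P] and [A] were exactly L^(k-1) and L^(1/v), the quantities |L P A^u|, |L P|^2 and |P A^v|^2
    would all equal |L|^(2k), which is why their sums can be expected to have the same order.
    Rationality of k makes A^u and A^v Dirichlet polynomials. The delicate sum is that of |L P|^2.
    With a sharp cutoff X, the coefficient of n is a sum over the divisors m of n with n/m <= X;
    this condition couples all primes and destroys the Euler product. Averaging over log X removes
    it at a cost of log m relative to the width of the window. A single window would multiply this
    cost by the trivial bound over all primes together, a power of log q. With one window per block
    the trivial bound is paid only inside that block, where the primes have a bounded sum of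
    reciprocals, and the costs of the blocks are summable. The number of blocks J is chosen so that
    2^J has the order of log q; the exponential of the sum of 1/p over the blocks is then at least
    of that order too, and its k^2-th power is the expected power of log q. *)

Section ComplexNorm.
Context {R : realType}.
Implicit Types (z w : R[i]).

Definition nm z : R := Normc.normc z.

Lemma nmE z : nm z ^+ 2 = complex.Re z ^+ 2 + complex.Im z ^+ 2.
Proof. by case: z => a b /=; rewrite sqr_sqrtr // addr_ge0 // sqr_ge0. Qed.

Lemma nm_ge0 z : 0 <= nm z.
Proof. by case: z => a b /=; exact: sqrtr_ge0. Qed.

Lemma nm0 : nm 0 = 0. Proof. exact: Normc.normc0. Qed.
Lemma nm1 : nm 1 = 1. Proof. exact: Normc.normc1. Qed.
Lemma nmM z w : nm (z * w) = nm z * nm w. Proof. exact: Normc.normcM. Qed.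
Lemma nmD z w : nm (z + w) <= nm z + nm w. Proof. exact: le_normcD. Qed.
Lemma nmN z : nm (- z) = nm z. Proof. exact: normcN. Qed.

Lemma nmB z w : nm (z - w) <= nm z + nm w.
Proof. by rewrite -(nmN w) nmD. Qed.

Lemma nm_subC z w : nm (z - w) = nm (w - z).
Proof. by rewrite -nmN opprB. Qed.

Lemma nmC (x : R) : nm x%:C = `|x|.
Proof. by rewrite /nm /= expr0n addr0 sqrtr_sqr. Qed.

Lemma nmJ z : nm (conjc z) = nm z.
Proof. by case: z => a b; rewrite /nm /= sqrrN. Qed.

Lemma nm_exp z n : nm (z ^+ n) = nm z ^+ n.
Proof. by elim: n => [|n IH]; rewrite ?nm1 // !exprS nmM IH. Qed.

Lemma nm_sum (I : Type) (r : seq I) (P : pred I) (F : I -> R[i]) :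
  nm (\sum_(i <- r | P i) F i) <= \sum_(i <- r | P i) nm (F i).
Proof.
elim/big_rec2: _ => [|i x y _ le]; first by rewrite nm0.
by apply: le_trans (nmD _ _) _; rewrite lerD2l.
Qed.

Lemma sqr_nmC z : z * (conjc z) = (nm z ^+ 2)%:C.
Proof.
rewrite nmE; case: z => a b; apply/eqP; rewrite eq_complex /=.
by apply/andP; split; apply/eqP; ring.
Qed.

Lemma Re_le_nm z : `|complex.Re z| <= nm z.
Proof.
rewrite -(ler_pXn2r (n := 2)) ?nnegrE ?nm_ge0 // nmE real_normK ?num_real //.
by rewrite lerDl sqr_ge0.
Qed.

Lemma Im_le_nm z : `|complex.Im z| <= nm z.
Proof.
rewrite -(ler_pXn2r (n := 2)) ?nnegrE ?nm_ge0 // nmE real_normK ?num_real //.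
by rewrite lerDr sqr_ge0.
Qed.

Lemma nm_le_ReIm z : nm z <= `|complex.Re z| + `|complex.Im z|.
Proof.
rewrite -(ler_pXn2r (n := 2)) ?nnegrE ?nm_ge0 ?addr_ge0 // nmE sqrrD !real_normK ?num_real //.
by rewrite -addrA lerD2l addrC -[leLHS]addr0 lerD2l ?mulrn_wge0 ?mulr_ge0.
Qed.

Lemma nm_eq0 z : nm z = 0 -> z = 0. Proof. exact: Normc.eq0_normc. Qed.

Lemma nm2D z w : nm (z + w) ^+ 2 <= 2 * nm z ^+ 2 + 2 * nm w ^+ 2.
Proof.
apply: le_trans (_ : (nm z + nm w) ^+ 2 <= _).
  by rewrite ler_pXn2r ?nnegrE ?addr_ge0 ?nm_ge0 // nmD.
have := sqr_ge0 (nm z - nm w); nra.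
Qed.

Lemma C_sum (I : Type) (r : seq I) (P : pred I) (F : I -> R) :
  (\sum_(i <- r | P i) F i)%:C = \sum_(i <- r | P i) (F i)%:C.
Proof. exact: (rmorph_sum (real_complex R)). Qed.

Lemma C_M (x y : R) : (x * y)%:C = x%:C * y%:C.
Proof. exact: (rmorphM (real_complex R)). Qed.

Lemma conj_sum (I : Type) (r : seq I) (P : pred I) (F : I -> R[i]) :
  (conjc (\sum_(i <- r | P i) F i)) = \sum_(i <- r | P i) (conjc (F i)).
Proof. exact: (rmorph_sum (@conjc R)). Qed.

Lemma conj_M z w : (conjc (z * w)) = (conjc z) * (conjc w).
Proof. exact: (rmorphM (@conjc R)). Qed.

Lemma conj_X z n : (conjc (z ^+ n)) = (conjc z) ^+ n.
Proof. exact: (rmorphXn (@conjc R)). Qed.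

End ComplexNorm.

Section RootsOfUnity.
Context {R : realType}.

Definition cis (x : R) : R[i] := cos x +i* sin x.

Lemma cisD x y : cis (x + y) = cis x * cis y.
Proof.
by rewrite /cis cosD sinD; apply/eqP; rewrite eq_complex /=; apply/andP; split; apply/eqP; ring.
Qed.

Lemma cis0 : cis 0 = 1. Proof. by rewrite /cis cos0 sin0. Qed.

Lemma nm_cis x : nm (cis x) = 1.
Proof. by rewrite /nm /= cos2Dsin2 sqrtr1. Qed.

Lemma cisMn x n : cis (x *+ n) = cis x ^+ n.
Proof. by elim: n => [|n IH]; rewrite ?cis0 // mulrS cisD IH exprS. Qed.

Lemma cis_2pi : cis (pi *+ 2) = 1.
Proof. by rewrite /cis cos2pi sin2pi. Qed.

Lemma nm_1Bcis x : nm (1 - cis (x *+ 2)) = 2 * `|sin x|.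
Proof.
have -> : 2 * `|sin x| = `|2 * sin x| by rewrite normrM ger0_norm.
apply/eqP; rewrite -(eqrXn2 (n := 2)) ?nm_ge0 // nmE real_normK ?num_real //=.
rewrite mulr2n cosD sinD; have := cos2Dsin2 x.
set c := cos x; set s := sin x => h.
have -> : (1 - (c * c - s * s)) ^+ 2 + (0 - (s * c + c * s)) ^+ 2 =
  (c ^+ 2 + s ^+ 2) ^+ 2 - 2 * (c ^+ 2 + s ^+ 2) + 1 + 4 * s ^+ 2 by ring.
by rewrite h; apply/eqP; ring.
Qed.

(** The additive character e(k/N) = exp(2 pi i k / N). The argument is a natural number, so that
    periodicity becomes a statement about [%%]. *)
Definition eN (N k : nat) : R[i] := cis (pi *+ 2 / N%:R * k%:R).

Lemma eND N a b : eN N (a + b) = eN N a * eN N b.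
Proof. by rewrite /eN natrD mulrDr cisD. Qed.

Lemma eN0 N : eN N 0 = 1. Proof. by rewrite /eN mulr0 cis0. Qed.

Lemma nm_eN N k : nm (eN N k) = 1. Proof. exact: nm_cis. Qed.

Lemma eNX N a k : eN N (a * k) = eN N a ^+ k.
Proof. by rewrite /eN natrM mulrA mulr_natr cisMn. Qed.

Lemma eNN N : (0 < N)%N -> eN N N = 1.
Proof. by move=> N0; rewrite /eN divfK ?pnatr_eq0 -?lt0n // cis_2pi. Qed.

Lemma eN_mod N a : (0 < N)%N -> eN N (a %% N) = eN N a.
Proof.
move=> N0; rewrite {2}(divn_eq a N) eND mulnC eNX eNN // expr1n mul1r //.
Qed.

Lemma eN_conjM N a : eN N a * (conjc (eN N a)) = 1.
Proof. by rewrite sqr_nmC nm_eN expr1n. Qed.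

Lemma cis_eq1 (x : R) : 0 < x -> x < pi *+ 2 -> cis x != 1.
Proof.
move=> x0 x1; rewrite -subr_eq0 -opprB oppr_eq0; apply/eqP => h.
have := nm_1Bcis (x / 2); rewrite -[x / 2 *+ 2]mulr_natr divfK ?pnatr_eq0 // h nm0.
have : 0 < sin (x / 2).
  by apply: sin_gt0_pi; rewrite divr_gt0 //= ltr_pdivrMr // mulr_natr.
by move=> s0 /esym/eqP; rewrite mulf_eq0 pnatr_eq0 /= normr_eq0 gt_eqF.
Qed.

Lemma eN_neq1 N a : (0 < a < N)%N -> eN N a != 1.
Proof.
move=> /andP[a0 aN]; have N0 : (0 < N)%N by apply: leq_trans aN.
have p0 : 0 < pi *+ 2 :> R by rewrite mulrn_wgt0 // pi_gt0.
apply: cis_eq1; first by rewrite mulr_gt0 ?divr_gt0 ?ltr0n.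
rewrite -mulrA gtr_pMr // mulrC ltr_pdivrMr ?ltr0n // mul1r ltr_nat //.
Qed.

Lemma eN_orth N (a b : nat) : (a < N)%N -> (b < N)%N ->
  \sum_(j < N) eN N (j * a) * (conjc (eN N (j * b))) = if a == b then N%:R else 0.
Proof.
move=> aN bN; have N0 : (0 < N)%N by apply: leq_ltn_trans aN.
case: eqVneq => [<-|ab].
  by under eq_bigr do rewrite eN_conjM; rewrite sumr_const card_ord.
set w := eN N a * (conjc (eN N b)).
have w1 : w != 1.
  apply/negP => /eqP w1.
  have wab : eN N a = eN N b.
    by rewrite -[RHS]mul1r -w1 /w -mulrA [X in _ * X]mulrC eN_conjM mulr1.
  wlog lt_ab : a b aN bN ab w w1 wab / (a < b)%N.
    move=> h; case: (ltngtP a b) => [l|l|e]; last by rewrite e eqxx in ab.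
      exact: (h a b).
    by apply: (h b a) => //; rewrite ?[b == a]eq_sym // -wab eN_conjM.
  have := @eN_neq1 N (b - a); rewrite subn_gt0 lt_ab /= => /(_ (leq_ltn_trans (leq_subr _ _) bN)).
  case/eqP; rewrite -[LHS]mul1r -(eN_conjM N a) mulrAC -eND subnKC ?(ltnW lt_ab) //.
  by rewrite -wab eN_conjM.
have wj j : eN N (j * a) * (conjc (eN N (j * b))) = w ^+ j.
  by rewrite /w exprMn -!conj_X -!eNX ![(_ * j)%N]mulnC.
(* The sum is now geometric with a ratio [w != 1] satisfying [w ^+ N = 1]. *)
under eq_bigr do rewrite wj.
have := subrX1 w N; rewrite /w exprMn -conj_X -!eNX mulnC eNX eNN // expr1n.
rewrite mulnC eNX eNN // expr1n conjc1 mulr1 subrr -/w => /esym/eqP.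
by rewrite mulf_eq0 subr_eq0 (negPf w1) /= => /eqP.
Qed.

Lemma eN_parseval N (f : nat -> R[i]) :
  \sum_(j < N) nm (\sum_(a < N) f a * eN N (j * a)) ^+ 2 =
  N%:R * \sum_(a < N) nm (f a) ^+ 2.
Proof.
apply: complexI; rewrite C_sum C_M C_sum rmorph_nat.
under eq_bigr => j _.
  rewrite -sqr_nmC conj_sum big_distrlr /=.
  under eq_bigr => a _ do under eq_bigr => b _ do rewrite conj_M mulrACA.
  over.
rewrite exchange_big /= mulr_sumr; apply: eq_bigr => a _.
rewrite exchange_big /= (bigD1 a) //= [X in _ + X]big1 ?addr0.
  by rewrite -mulr_sumr eN_orth // eqxx sqr_nmC mulrC.
move=> b ba; rewrite -mulr_sumr eN_orth // ifN ?mulr0 //.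
by rewrite eq_sym -(inj_eq val_inj) in ba.
Qed.

End RootsOfUnity.

Arguments nm {R} z : simpl never.

(** * The characters modulo a prime, through a discrete logarithm *)

Section Characters.
Context {R : realType} (q : nat) (q_pr : prime q).
Local Notation F := 'F_q.

Lemma Fp_fermat (x : F) : x != 0 -> x ^+ q.-1 = 1.
Proof.
move=> x0; apply: (mulIf x0); rewrite mul1r -exprSr prednK ?prime_gt0 //.
by have := expf_card x; rewrite card_Fp.
Qed.

Lemma prim_root_Fp : {w : F | q.-1.-primitive_root w}.
Proof.
have q1 : (0 < q.-1)%N by rewrite -ltnS prednK ?prime_gt0 // prime_gt1.
pose rs := enum [pred x : F | x != 0].
suff : has q.-1.-primitive_root rs by case/hasP/sig2W => w _ h; exists w.
apply: has_prim_root => //.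
- apply/allP => x; rewrite mem_enum inE => x0; by rewrite unity_rootE Fp_fermat.
- exact: enum_uniq.
- rewrite -cardE; have := card_Fp q_pr; rewrite (cardD1 0) inE add1n => h.
  apply: eq_leq; apply: etrans (esym (congr1 predn h)) _ => /=.
  by apply: eq_card => x; rewrite !inE andbT.
Qed.

Definition gen : F := sval prim_root_Fp.
Lemma genP : q.-1.-primitive_root gen. Proof. exact: (svalP prim_root_Fp). Qed.

Lemma dlog_subproof (x : F) : x != 0 -> {i : 'I_q.-1 | x = gen ^+ i}.
Proof.
by move=> x0; apply: (prim_rootP genP); exact: Fp_fermat.
Qed.

Definition dlog (x : F) : nat :=
  if pselect (x != 0) is left h then sval (dlog_subproof h) else 0.

Lemma dlogP x : x != 0 -> x = gen ^+ dlog x.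
Proof. by rewrite /dlog; case: pselect => // h _; exact: (svalP (dlog_subproof h)). Qed.

Lemma q1_gt0 : (0 < q.-1)%N.
Proof. by rewrite -ltnS prednK ?prime_gt0 // prime_gt1. Qed.

Lemma dlog_lt x : (dlog x < q.-1)%N.
Proof. by rewrite /dlog; case: pselect => [h|h]; [exact: ltn_ord|exact: q1_gt0]. Qed.

Lemma gen_neq0 : gen != 0.
Proof.
have := prim_expr_order genP; apply: contra_eq_neq => ->.
by rewrite expr0n gtn_eqF ?q1_gt0 // eq_sym oner_neq0.
Qed.

Lemma dlog_gen i : (i < q.-1)%N -> dlog (gen ^+ i) = i.
Proof.
move=> iq; have h : gen ^+ i != 0 by rewrite expf_neq0 // gen_neq0.
have := dlogP h; move/eqP; rewrite (eq_prim_root_expr genP) !modn_small ?dlog_lt //.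
by move/eqP.
Qed.

(** The discrete logarithm identifies the unit group with Z/(q-1), whose characters are the additive
    ones; [j = 0] gives the principal character. The value of [dlog] at 0 is a dummy, hence the
    separate case. *)
Definition X (j : nat) (x : F) : R[i] :=
  if x == 0 then 0 else eN q.-1 (j * dlog x).

Lemma X0 j : X j 0 = 0. Proof. by rewrite /X eqxx. Qed.

Lemma dlogM x y : x != 0 -> y != 0 -> dlog (x * y) = ((dlog x + dlog y) %% q.-1)%N.
Proof.
move=> x0 y0; have xy0 : x * y != 0 by rewrite mulf_neq0.
apply/eqP; rewrite -[X in X == _](modn_small (dlog_lt _)) -(eq_prim_root_expr genP).
by rewrite -dlogP // exprD -!dlogP.
Qed.

Lemma XM j x y : X j (x * y) = X j x * X j y.
Proof.
rewrite /X mulf_eq0; case: (eqVneq x 0) => [x0|x0] /=; first by rewrite mul0r.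
case: (eqVneq y 0) => [y0|y0] /=; first by rewrite mulr0.
by rewrite dlogM // -eND -mulnDr -[LHS]eN_mod ?q1_gt0 // modnMmr eN_mod ?q1_gt0.
Qed.

Lemma nmX j x : x != 0 -> nm (X j x) = 1.
Proof. by rewrite /X => /negPf ->; rewrite nm_eN. Qed.

Lemma nmX_le1 j x : nm (X j x) <= 1.
Proof. by case: (eqVneq x 0) => [->|/nmX->] //; rewrite X0 nm0. Qed.

Lemma X_neq0 j x : (X j x != 0) = (x != 0).
Proof.
case: (eqVneq x 0) => [->|x0]; first by rewrite X0 eqxx.
by apply/eqP => h; have := nmX j x0; rewrite h nm0 => /eqP; rewrite eq_sym oner_eq0.
Qed.

Lemma X01 x : x != 0 -> X 0 x = 1.
Proof. by rewrite /X => /negPf ->; rewrite mul0n eN0. Qed.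

Lemma reindex_dlog (V : nmodType) (f : F -> V) :
  \sum_(x | x != 0) f x = \sum_(i < q.-1) f (gen ^+ i).
Proof.
rewrite (reindex_onto (fun i : 'I_q.-1 => gen ^+ i) (fun x => Ordinal (dlog_lt x))) /=.
  apply: eq_bigl => i; rewrite expf_neq0 ?gen_neq0 //=; apply/eqP/val_inj => /=.
  by rewrite dlog_gen.
by move=> x x0; rewrite -dlogP.
Qed.

Lemma X_parseval (f : F -> R[i]) :
  \sum_(j < q.-1) nm (\sum_(x | x != 0) f x * X j x) ^+ 2 =
  q.-1%:R * \sum_(x | x != 0) nm (f x) ^+ 2.
Proof.
rewrite (reindex_dlog (fun x => nm (f x) ^+ 2)) -(eN_parseval q.-1 (fun i => f (gen ^+ i))).
apply: eq_bigr => j _; rewrite (reindex_dlog (fun x => f x * X j x)); congr (nm _ ^+ 2).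
by apply: eq_bigr => i _; rewrite /X (negPf (expf_neq0 _ gen_neq0)) dlog_gen.
Qed.

Lemma X_orth x y : x != 0 -> y != 0 ->
  \sum_(j < q.-1) X j x * conjc (X j y) = if x == y then q.-1%:R else 0.
Proof.
move=> x0 y0; rewrite /X (negPf x0) (negPf y0) eN_orth ?dlog_lt //.
have -> // : (dlog x == dlog y) = (x == y).
apply/eqP/eqP => [h|-> //]; by rewrite (dlogP x0) (dlogP y0) h.
Qed.

Lemma X_sum0 j : (0 < j < q.-1)%N -> \sum_(x | x != 0) X j x = 0.
Proof.
move=> /andP[j0 jq]; rewrite (reindex_dlog (X j)).
under eq_bigr => i _ do rewrite /X (negPf (expf_neq0 _ gen_neq0)) dlog_gen //.
have := eN_orth (R := R) (N := q.-1) jq q1_gt0; rewrite gtn_eqF // => h.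
rewrite -[RHS]h; apply: eq_bigr => i _.
by rewrite muln0 eN0 conjc1 mulr1 mulnC.
Qed.

Lemma X_inj i j : (i < q.-1)%N -> (j < q.-1)%N -> X i =1 X j -> i = j.
Proof.
move=> iq jq /(_ gen); rewrite /X (negPf gen_neq0).
have [q2|q2] := leqP q.-1 1%N.
  by move: iq jq; case: (q.-1) q2 => [|[|//]] //; case: i; case: j.
have -> : dlog gen = 1%N by rewrite -{1}[gen]expr1 dlog_gen.
rewrite !muln1 => h; apply/eqP; apply/negP => /negP ij.
have h2 := eN_orth (R := R) (N := q.-1) iq jq; move: h2; rewrite (negPf ij) => /eqP.
under eq_bigr => k _ do rewrite mulnC eNX h -eNX mulnC eN_conjM.
by rewrite sumr_const card_ord pnatr_eq0 -leqn0 leqNgt (leq_ltn_trans _ iq).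
Qed.

Definition chi (j : nat) (n : int) : R[i] := X j (n%:~R).

Lemma chi_nat j (n : nat) : chi j n%:Z = X j n%:R. Proof. by []. Qed.

Lemma natF_eq0 (n : nat) : (n%:R == 0 :> F) = (q %| n)%N.
Proof. by rewrite -(dvdn_pcharf (pchar_Fp q_pr)). Qed.

Lemma intF_eq0 (n : int) : (n%:~R == 0 :> F) = ~~ coprimez n q.
Proof.
have e (k : nat) : (k%:R == 0 :> F) = ~~ coprimez k q.
  by rewrite natF_eq0 coprimezE /= coprime_sym prime_coprime // negbK.
case: n => n; first exact: e.
by rewrite NegzE rmorphN /= oppr_eq0; rewrite -[n.+1%:~R]/(n.+1%:R) e !coprimezE.
Qed.

Lemma chi_dirichlet j : dirichlet_character q (chi j).
Proof.
split=> [n|m n|n].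
- have q0 : q%:~R = 0 :> F by apply/eqP; rewrite natF_eq0.
  by rewrite /chi rmorphD /= q0 addr0.
- by rewrite /chi rmorphM /= XM.
- by rewrite /chi X_neq0 intF_eq0 negbK.
Qed.

Lemma F_nat (x : F) : exists2 n : nat, (n < q)%N & x = n%:R.
Proof.
exists x; last by rewrite natr_Zp.
by rewrite -{2}(Fp_cast q_pr) ltn_ord.
Qed.

Lemma chi_nonprincipal j : (0 < j < q.-1)%N -> @nonprincipal_characters R q (chi j).
Proof.
move=> /andP[j0 jq]; split; first exact: chi_dirichlet.
move=> h; suff : j = 0%N by move=> e; rewrite e in j0.
apply: X_inj => //; first exact: q1_gt0.
move=> x; have [->|x0] := eqVneq x 0; first by rewrite !X0.
have [n nq xn] := F_nat x; rewrite X01 // xn -chi_nat h /principal_character.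
have := intF_eq0 n; rewrite -[n%:~R]/(n%:R) -xn (negPf x0) => /esym/negbFE -> //.
Qed.

Lemma chi_inj i j : (i < q.-1)%N -> (j < q.-1)%N -> chi i = chi j -> i = j.
Proof.
move=> iq jq h; apply: X_inj => // x.
by have [n nq ->] := F_nat x; rewrite -!chi_nat h.
Qed.

End Characters.

(** * Partial sums of L(1/2, chi) *)

Section LimitC.
Context {R : realType}.

Lemma normC_nm (z : R[i]) : `|z| = (nm z)%:C.
Proof. by rewrite normc_def /nm; case: z. Qed.

Lemma approx_cvgR (u w : nat -> R) (b : nat -> nat) (e : nat -> R) :
  (forall M N, (0 < M)%N -> (b M <= N)%N -> `|u N - w M| <= e M) ->
  (forall d, 0 < d -> exists2 M, (0 < M)%N & e M < d) ->
  cvgn u.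
Proof.
move=> ue e0; apply/cauchy_cvgP; apply: cauchy_exP => d d0.
have [M M0 eM] := e0 _ d0; exists (w M); exists (b M) => //= N /= bN.
rewrite /ball /= distrC; exact: le_lt_trans (ue _ _ M0 bN) eM.
Qed.

(** Each coordinate of [u] is Cauchy, so [limn] is a genuine limit and not a default value, and the
    bound on [u N - w M] passes to it. In use, [w M] is the partial sum up to a multiple of the
    modulus. *)
Lemma approx_limC (u w : nat -> R[i]) (b : nat -> nat) (e : nat -> R) :
  (forall M N, (0 < M)%N -> (b M <= N)%N -> nm (u N - w M) <= e M) ->
  (forall d, 0 < d -> exists2 M, (0 < M)%N & e M < d) ->
  forall M, (0 < M)%N -> nm (limn (u : nat -> (R[i])^o) - w M) <= e M.
Proof.
move=> ue e0.
have cr : cvgn (fun n => complex.Re (u n)).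
  apply: (@approx_cvgR _ (fun M => complex.Re (w M)) b e) => // M N M0 bN.
  apply: le_trans (ue M N M0 bN); apply: le_trans (Re_le_nm _).
  by case: (u N) => ? ?; case: (w M).
have ci : cvgn (fun n => complex.Im (u n)).
  apply: (@approx_cvgR _ (fun M => complex.Im (w M)) b e) => // M N M0 bN.
  apply: le_trans (ue M N M0 bN); apply: le_trans (Im_le_nm _).
  by case: (u N) => ? ?; case: (w M).
pose l : R[i] := limn (fun n => complex.Re (u n)) +i* limn (fun n => complex.Im (u n)).
have near_l d : 0 < d -> exists N0, forall N, (N0 <= N)%N -> nm (l - u N) <= d.
  move=> d0; have d20 : 0 < d / 2 by rewrite divr_gt0.
  have /cvgrPdist_le /(_ _ d20) [N1 _ h1] := cr.
  have /cvgrPdist_le /(_ _ d20) [N2 _ h2] := ci.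
  exists (maxn N1 N2) => N; rewrite geq_max => /andP[l1 l2].
  apply: le_trans (nm_le_ReIm _) _.
  have := h1 N l1; have := h2 N l2 => /=; case: (u N) => a c /= g2 g1.
  by rewrite [leRHS]splitr lerD.
have ul : ((u : nat -> (R[i])^o) @ \oo --> (l : (R[i])^o))%classic.
  apply/cvgrPdist_le => /= eps eps0.
  have epsE : eps = (complex.Re eps)%:C.
    by case: eps eps0 => a c; rewrite ltcE /= => /andP[/eqP -> _].
  have r0 : 0 < complex.Re eps by move: eps0; rewrite ltcE => /andP[].
  have [N0 hN0] := near_l _ r0; exists N0 => // N /= NN.
  by rewrite normC_nm epsE lecR; exact: hN0.
have -> : limn (u : nat -> (R[i])^o) = l by apply: cvg_lim => //; exact: norm_hausdorff.
move=> M M0; apply/ler_addgt0Pr => d d0; have [N0 hN0] := near_l _ d0.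
pose N := maxn N0 (b M).
have -> : l - w M = (u N - w M) + (l - u N) by ring.
apply: le_trans (nmD _ _) _; apply: lerD; first by apply: ue => //; exact: leq_maxr.
by apply: hN0; exact: leq_maxl.
Qed.

End LimitC.

Section Abel.
Context {R : realType}.

Lemma abel_bound (a : nat -> R) (c : nat -> R[i]) (A N : nat) (K : R) :
  (forall n, (A <= n)%N -> 0 <= a n.+1 <= a n) ->
  (forall n, (A <= n)%N -> nm (\sum_(A <= i < n) c i) <= K) ->
  0 <= a A ->
  nm (\sum_(A <= n < N) (a n)%:C * c n) <= K * a A.
Proof.
move=> ha hc aA0.
have K0 : 0 <= K by apply: le_trans (nm_ge0 _) (hc A _).
have [NA|AN] := leqP N A; first by rewrite big_geq // nm0 mulr_ge0.
(* Summation by parts: the partial sums of [c] meet the decrements of [a], which are nonnegative and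
   telescope. *)
have e n : \sum_(A <= i < A + n) (a i)%:C * c i =
    (a (A + n)%N)%:C * \sum_(A <= i < A + n) c i
    + \sum_(A <= i < A + n) (a i - a i.+1)%:C * \sum_(A <= k < i.+1) c k.
  elim: n => [|n IH]; first by rewrite addn0 !big_geq // mulr0 addr0.
  rewrite addnS big_nat_recr ?leq_addr //= IH.
  rewrite [X in _ = _ + X]big_nat_recr ?leq_addr //=.
  rewrite rmorphB /= (@big_nat_recr _ _ _ (A + n)) ?leq_addr //=; ring.
have tel n : \sum_(A <= i < A + n) (a i - a i.+1) = a A - a (A + n)%N.
  elim: n => [|n IH]; first by rewrite addn0 big_geq // subrr.
  by rewrite addnS big_nat_recr ?leq_addr //= IH; ring.
rewrite -(subnKC (ltnW AN)) e; apply: le_trans (nmD _ _) _.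
have aN n : 0 <= a (A + n)%N.
  by case: n => [|n]; [rewrite addn0|rewrite addnS; case/andP: (ha (A + n)%N (leq_addr _ _))].
have -> : K * a A = a (A + (N - A))%N * K + \sum_(A <= i < A + (N - A)) (a i - a i.+1) * K.
  by rewrite -mulr_suml tel; ring.
apply: lerD.
  by rewrite nmM nmC ger0_norm // ler_wpM2l // hc // leq_addr.
apply: le_trans (nm_sum _ _ _) _; rewrite !big_nat; apply: ler_sum => i /andP[Ai _].
have /andP[_ d] := ha i Ai.
by rewrite nmM nmC ger0_norm ?subr_ge0 // ler_wpM2l ?subr_ge0 // hc // leqW.
Qed.

(* Junk value: [isq 0 = 0]. *)
Definition isq (n : nat) : R := (Num.sqrt n%:R)^-1.

Lemma isq_ge0 n : 0 <= isq n. Proof. by rewrite invr_ge0 sqrtr_ge0. Qed.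

Lemma isqM m n : isq (m * n) = isq m * isq n.
Proof. by rewrite /isq natrM sqrtrM // invfM. Qed.

Lemma isq1 : isq 1 = 1. Proof. by rewrite /isq sqrtr1 invr1. Qed.

Lemma isq0 : isq 0 = 0. Proof. by rewrite /isq sqrtr0 invr0. Qed.

Lemma sqr_isq n : isq n ^+ 2 = n%:R^-1.
Proof. by rewrite /isq exprVn sqr_sqrtr. Qed.

Lemma isq_le m n : (0 < m)%N -> (m <= n)%N -> isq n <= isq m.
Proof.
move=> m0 mn; rewrite lef_pV2 ?posrE ?sqrtr_gt0 ?ltr0n // ?(leq_trans m0) //.
by rewrite ler_wsqrtr // ler_nat.
Qed.

Lemma isq_le1 n : isq n <= 1.
Proof. by case: n => [|n]; rewrite ?isq0 // -isq1 isq_le. Qed.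

Lemma natpow_half n : (0 < n)%N -> natpow_opp n ((2^-1)%:C : R[i]) = (isq n)%:C.
Proof.
move=> n0; rewrite /natpow_opp /= mul0r cos0 sin0 /isq -powR12_sqrt // -powRN.
by apply/eqP; rewrite eq_complex /=; apply/andP; split; apply/eqP; ring.
Qed.

End Abel.

Section LApprox.
Context {R : realType} (q : nat) (q_pr : prime q) (j : nat).
Hypothesis jq : (0 < j < q.-1)%N.
Local Notation F := 'F_q.

Lemma sumFq (V : nmodType) (f : F -> V) : \sum_(i < q) f i%:R = \sum_x f x.
Proof.
rewrite -(big_mkord xpredT (fun i => f i%:R)) -{1}(Fp_cast q_pr) big_mkord.
by apply: eq_bigr => i _; rewrite natr_Zp.
Qed.

Definition SL (N : nat) : R[i] := \sum_(1 <= n < N) (isq n)%:C * X q_pr j n%:R.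

Lemma X_sum_block b : \sum_(0 <= i < q * b) X q_pr j i%:R = 0 :> R[i].
Proof.
elim: b => [|b IH]; first by rewrite muln0 big_geq.
rewrite mulnS addnC (big_cat_nat (n := (q * b)%N)) ?leq_addr //= IH add0r.
rewrite -{1}[(q * b)%N]add0n big_addn addKn big_mkord.
have q0 : q%:R = 0 :> F by apply/eqP; rewrite natF_eq0.
under eq_bigr => i _ do rewrite natrD natrM q0 mul0r addr0.
rewrite sumFq (bigD1 0) //= X0 add0r.
exact: X_sum0.
Qed.

(** Complete periods cancel; the incomplete one at the end has fewer than [q] terms of modulus at
    most 1. *)
Lemma X_partial A n : (q * A <= n)%N ->
  nm (\sum_(q * A <= i < n) X q_pr j i%:R : R[i]) <= q%:R.
Proof.
move=> An; have -> : \sum_(q * A <= i < n) X q_pr j i%:R =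
    \sum_(q * (n %/ q) <= i < n) X q_pr j i%:R :> R[i].
  have h b : (q * b <= n)%N -> \sum_(0 <= i < n) X q_pr j i%:R = \sum_(q * b <= i < n) X q_pr j i%:R :> R[i].
    by move=> bn; rewrite (big_cat_nat (n := (q * b)%N)) //= X_sum_block add0r.
  by rewrite -h // -h // mulnC leq_divM.
apply: le_trans (nm_sum _ _ _) _.
apply: le_trans (_ : \sum_(q * (n %/ q) <= i < n) 1 <= _).
  by apply: ler_sum => i _; exact: nmX_le1.
rewrite big_const_nat iter_addr addr0 ler_nat {1}(divn_eq n q) mulnC addKn ltnW //.
by rewrite ltn_mod prime_gt0.
Qed.

(** Abel summation from [q * M] on. The later choice [M = q ^ 2] makes the error [isq q]. *)
Lemma dirichlet_L_approx M : (0 < M)%N ->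
  nm (dirichlet_L (2^-1)%:C (chi q_pr j) - SL (q * M)) <= q%:R * isq (q * M).
Proof.
have q0 := prime_gt0 q_pr.
rewrite /dirichlet_L.
have -> : (fun N : nat => \sum_(1 <= n < N.+1) chi q_pr j n%:Z * natpow_opp n (2^-1)%:C : R[i]) =
          (fun N => SL N.+1).
  apply/funext => N; rewrite /SL !big_nat; apply: eq_bigr => n /andP[n0 _].
  by rewrite natpow_half // mulrC chi_nat.
apply: (@approx_limC R (fun N => SL N.+1) (fun M => SL (q * M)) (fun M => q * M)%N (fun M => q%:R * isq (q * M))).
  move=> {}M N M0 qMN; rewrite /SL (@big_cat_nat _ _ _ (q * M)) ?muln_gt0 ?q0 ?M0 //=; last exact: leqW.
  rewrite addrAC subrr add0r; apply: abel_bound => //; last exact: isq_ge0.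
    by move=> n qn; rewrite isq_ge0 isq_le // (leq_trans _ qn) // muln_gt0 q0.
  by move=> n qn; exact: X_partial.
move=> d d0; pose M' := Num.bound ((q%:R / d) ^+ 2).
exists M'.+1 => //.
have M'0 : 0 < M'.+1%:R :> R by rewrite ltr0n.
rewrite -(ltr_pXn2r (n := 2)) ?nnegrE ?mulr_ge0 ?isq_ge0 ?(ltW d0) // exprMn sqr_isq.
have h : (q%:R / d) ^+ 2 < M'.+1%:R.
  apply: lt_le_trans (_ : M'%:R <= _); last by rewrite ler_nat.
  by have := @archi_boundP R ((q%:R / d) ^+ 2) (sqr_ge0 _).
rewrite expr_div_n ltr_pdivrMr ?exprn_gt0 // in h.
rewrite ltr_pdivrMr; last by rewrite ltr0n muln_gt0 q0.
apply: lt_le_trans h _; rewrite mulrC ler_pM2l ?exprn_gt0 // ler_nat.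
by rewrite leq_pmull.
Qed.

End LApprox.

(** * Sums over smooth integers *)

Section SmoothSums.

(** Being a [(pil s).-nat] means that all prime factors lie in [s]; the corresponding part of [n]
    collects its prime powers with base in [s]. *)
Definition pil (s : seq nat) : nat_pred := [pred p in s].

Lemma in_pil p s : (p \in pil s) = (p \in s). Proof. by []. Qed.

Lemma logn_pnat0 (pi : nat_pred) p m : p \notin pi -> pi.-nat m -> logn p m = 0%N.
Proof.
move=> ppi pm; rewrite lognE; case: ifP => // /and3P[pp m0 pd].
by move/(pnatP _ m0): pm => /(_ p pp pd); rewrite (negPf ppi).
Qed.

Lemma logn_partn (pi : nat_pred) p n : p \in pi -> logn p (n`_pi)%N = logn p n.
Proof.
move=> ppi; case: n => [|n]; first by rewrite partn0 logn0 logn1.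
rewrite -{2}(partnC pi (ltn0Sn n)) lognM ?part_gt0 //.
have np : p \notin pi^' by rewrite -[p \in pi^']/(p \notin pi) negbK.
by rewrite [X in (_ + X)%N](logn_pnat0 np) ?addn0 ?part_pnat.
Qed.

Lemma pnat_gt0 (pi : nat_pred) n : pi.-nat n -> (0 < n)%N.
Proof. by case/andP. Qed.

Definition disj (s1 s2 : seq nat) := forall p, p \in s1 -> p \notin s2.

Lemma pil_cat_part (s1 s2 : seq nat) n : disj s1 s2 -> (pil (s1 ++ s2)).-nat n ->
  (n`_(pil s1) * n`_(pil s2))%N = n.
Proof.
move=> d sn; rewrite -[RHS](partnC (pil s1) (pnat_gt0 sn)); congr muln.
apply: eq_in_partn => p ppn.
have : p \in pil (s1 ++ s2) by case/andP: sn => _ /allP; apply.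
rewrite in_pil mem_cat => h12; apply/idP/idP => [h2|h1].
  by apply/negP => h1; move: (d p h1); rewrite -[_ \in _]/(p \in pil s2) h2.
by case/orP: h12 => // h; case/negP: h1.
Qed.

Lemma partn_mul (s1 s2 : seq nat) a b : disj s1 s2 ->
  (pil s1).-nat a -> (pil s2).-nat b ->
  ((a * b)`_(pil s1) = a)%N /\ ((a * b)`_(pil s2) = b)%N.
Proof.
move=> d ha hb; rewrite !partnM ?(pnat_gt0 ha) ?(pnat_gt0 hb) //.
split.
  rewrite (part_pnat_id ha) part_p'nat ?muln1 //.
  apply: sub_in_pnat hb => p _ /=; rewrite -[p \in (pil s1)^']/(p \notin s1) in_pil => p2; apply/negP => p1.
  by have := d p p1; rewrite p2.
rewrite (part_pnat_id hb) part_p'nat ?mul1n //.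
by apply: sub_in_pnat ha => p _ /=; rewrite -[p \in (pil s2)^']/(p \notin s2) in_pil; exact: d.
Qed.

Lemma pnat_cat_mul (s1 s2 : seq nat) a b :
  (pil s1).-nat a -> (pil s2).-nat b -> (pil (s1 ++ s2)).-nat (a * b)%N.
Proof.
move=> ha hb; rewrite pnatM; apply/andP; split.
  by apply: sub_in_pnat ha => p _; rewrite !in_pil mem_cat => h; apply/orP; left.
by apply: sub_in_pnat hb => p _; rewrite !in_pil mem_cat => h; apply/orP; right.
Qed.

(** Unique factorization as a bijection between n and the pair of its two parts. All sums run below
    one bound [N], so the condition [a * b < N] has to stay. *)
Lemma sum_pnat_cat (V : nmodType) (s1 s2 : seq nat) N (F : nat -> nat -> V) :
  disj s1 s2 ->
  \sum_(n < N | (pil (s1 ++ s2)).-nat n) F (n`_(pil s1))%N (n`_(pil s2))%N =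
  \sum_(a < N | (pil s1).-nat a) \sum_(b < N | (pil s2).-nat b && (a * b < N)%N) F a b.
Proof.
case: N => [|N] d; first by rewrite !big_ord0.
rewrite pair_big_dep /=.
pose h (n : 'I_N.+1) : 'I_N.+1 * 'I_N.+1 := (inord (n`_(pil s1))%N, inord (n`_(pil s2))%N).
pose h' (ab : 'I_N.+1 * 'I_N.+1) : 'I_N.+1 := inord (ab.1 * ab.2)%N.
have lep (n : 'I_N.+1) s : (pil (s1 ++ s2)).-nat n -> (n`_(pil s) < N.+1)%N.
  move=> sn; apply: leq_ltn_trans (ltn_ord n); apply: dvdn_leq (dvdn_part _ _).
  exact: pnat_gt0 sn.
rewrite [RHS](reindex_onto h h').
  apply: esym; apply: eq_big => [n|n].
    apply/idP/idP => [/andP[/and3P[/= ha hb hab] /eqP e]|sn].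
      rewrite -e /h' /= inordK //; exact: pnat_cat_mul ha hb.
    rewrite /h /h' /= !inordK ?lep // !part_pnat /= pil_cat_part // ltn_ord /=.
    by apply/eqP/val_inj; rewrite /= inordK // ltn_ord.
  move=> /andP[/and3P[/= ha hb hab] /eqP e].
  have sn : (pil (s1 ++ s2)).-nat n.
    by rewrite -e /h' /= inordK //; exact: pnat_cat_mul ha hb.
  by rewrite !inordK ?lep.
move=> [a b] /= /and3P[ha hb hab]; rewrite /h /h' /= inordK //.
by have [-> ->] := partn_mul d ha hb; rewrite !inord_val.
Qed.

Lemma sum_pnat1 (V : nmodType) p N (F : nat -> V) : prime p ->
  \sum_(n < N | (pil [:: p]).-nat n) F n = \sum_(e < N | (p ^ e < N)%N) F (p ^ e)%N.
Proof.
case: N => [|N] pp; first by rewrite !big_ord0.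
pose h (e : 'I_N.+1) : 'I_N.+1 := inord (p ^ e)%N.
pose h' (n : 'I_N.+1) : 'I_N.+1 := inord (logn p n).
have pE n : (pil [:: p]).-nat n = p.-nat n by apply: eq_pnat => r; rewrite !inE.
have lg n : (n < N.+1)%N -> (logn p n < N.+1)%N.
  by case: n => [|n] nN; [rewrite logn0|exact: ltn_trans (ltn_logl p (ltn0Sn n)) nN].
rewrite (reindex_onto h h') => [|n]; last first.
  rewrite pE => /p_natP[k nk]; apply/val_inj; rewrite /h /h' /=.
  have e : (inord (logn p n) : 'I_N.+1) = logn p n :> nat by rewrite inordK ?lg.
  have pk : (p ^ logn p n)%N = n by rewrite {1}nk pfactorK.
  by rewrite e pk inordK.
have key (e : 'I_N.+1) :
    (pil [:: p]).-nat (h e) && (h' (h e) == e) = (p ^ e < N.+1)%N.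
  have [pe|pe] := ltnP (p ^ e) N.+1.
    rewrite /h inordK // pE pnatX pnat_id //=; apply/eqP.
    by rewrite /h' [X in logn p X]inordK // pfactorK // inord_val.
  (* [inord] sends a power that is out of range to 0, which is not a [pnat], so such exponents drop
     out. *)
  have -> : (h e : nat) = 0%N by rewrite /h /inord /insubd insubN // -leqNgt.
  by [].
apply: eq_big => [e|e]; first exact: key.
by rewrite key => pe; rewrite /h inordK.
Qed.
End SmoothSums.

(** * Multinomial expansion of powers of a sum over primes *)

Section Multinomial.
Context {V : numFieldType}.

(* [Om]! times [ka] is the multinomial coefficient of the factorization of the
   [s]-part of [n]. *)
Definition Om (s : seq nat) n := (\sum_(p <- s) logn p n)%N.
Definition ka (s : seq nat) n : V := \prod_(p <- s) ((logn p n)`!%:R)^-1.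

Lemma Om_part s n : Om s (n`_(pil s))%N = Om s n.
Proof. by apply: eq_big_seq => p ps; rewrite logn_partn. Qed.

Lemma ka_part s n : ka s (n`_(pil s))%N = ka s n.
Proof. by apply: eq_big_seq => p ps; rewrite logn_partn. Qed.

Lemma Om_cons p s n : Om (p :: s) n = (logn p n + Om s n)%N.
Proof. by rewrite /Om big_cons. Qed.

Lemma ka_ge0 s n : 0 <= ka s n.
Proof. by apply: prodr_ge0 => p _; rewrite invr_ge0 ler0n. Qed.

Lemma ka_le1 s n : ka s n <= 1.
Proof.
apply: prodr_ile1 => p _; rewrite invr_ge0 ler0n /=.
by rewrite invf_le1 ?ltr0n ?fact_gt0 // ler1n fact_gt0.
Qed.

Definition cmul (psi : nat -> V) := (psi 1%N = 1) /\ forall m n, psi (m * n)%N = psi m * psi n.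

Lemma cmulX psi p e : cmul psi -> psi (p ^ e)%N = psi p ^+ e.
Proof. by case=> h1 hM; elim: e => [|e IH]; rewrite ?expn0 // expnS hM IH exprS. Qed.

Lemma sum_ord_trunc (T : nat -> V) m n : (m <= n)%N ->
  (forall e, (m <= e)%N -> T e = 0) -> \sum_(e < n) T e = \sum_(e < m) T e.
Proof.
move=> mn h; rewrite -!(big_mkord xpredT T) (big_cat_nat (n := m)) //=.
by rewrite [X in _ + X]big_nat [X in _ + X]big1 ?addr0 // => i /andP[/h].
Qed.

Lemma disj1 p (s : seq nat) : p \notin s -> disj [:: p] s.
Proof. by move=> ps r; rewrite inE => /eqP ->. Qed.

(** The multinomial theorem, with the monomials indexed by the integers they form. Splitting off one
    prime with its exponent reduces it to the binomial theorem. The last hypothesis says that every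
    monomial lies below [N]. *)
Lemma multinomial_block (s : seq nat) (N d : nat) psi :
  uniq s -> all prime s -> cmul psi ->
  (forall n, (pil s).-nat n -> Om s n = d -> (n < N)%N) ->
  \sum_(n < N | (pil s).-nat n && (Om s n == d)) ka s n * psi n =
  (\sum_(p <- s) psi p) ^+ d / d`!%:R.
Proof.
move=> us ps hpsi; elim: s d us ps => [|p s IH] d.
  move=> _ _ hN; rewrite big_nil; case: d hN => [|d] hN.
    have N1 : (1 < N)%N by apply: hN; rewrite // /Om big_nil.
    rewrite (big_pred1 (Ordinal N1)) => [|n].
      by rewrite /ka big_nil mul1r (proj1 hpsi) expr0 divr1.
    rewrite /Om big_nil eqxx andbT /= -val_eqE /=.
    apply/idP/eqP => [|->//] /andP[n0 /allP h]; apply/eqP.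
    rewrite eqn_leq n0 andbT leqNgt; apply/negP => n1.
    have := h (pdiv n); rewrite mem_primes pdiv_prime // n0 pdiv_dvd => /(_ isT).
    by rewrite in_pil.
  by rewrite big_pred0 ?expr0n ?mul0r // => n; rewrite /Om big_nil andbF.
rewrite /= => /andP[pns us] /andP[pp ps] hN.
rewrite big_mkcondr /=.
pose F a b : V := if (logn p a + Om s b == d)%N then
   ((logn p a)`!%:R)^-1 * psi a * (ka s b * psi b) else 0.
have d1 := disj1 pns.
have FE n : (pil ([:: p] ++ s)).-nat n ->
   (if Om (p :: s) n == d then ka (p :: s) n * psi n else 0) =
   F (n`_(pil [:: p]))%N (n`_(pil s))%N.
  move=> sn; rewrite /F logn_partn ?in_pil ?mem_head // Om_part ka_part Om_cons.
  case: ifP => // _; rewrite -{2}(pil_cat_part d1 sn) (proj2 hpsi) /ka big_cons.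
  by rewrite -!mulrA; congr (_ * _); rewrite mulrCA.
rewrite (eq_bigr _ (fun n : 'I_N => FE n)) sum_pnat_cat //.
rewrite (sum_pnat1 N (fun a => \sum_(c < N | (pil s).-nat c && (a * c < N)%N) F a c) pp).
pose T e : V := \sum_(b < N | (pil s).-nat b && (p ^ e * b < N)%N) F (p ^ e)%N b.
have bnd e b : (e <= d)%N -> (pil s).-nat b -> Om s b = (d - e)%N -> (p ^ e * b < N)%N.
  move=> ed sb ob; have pe : (pil [:: p]).-nat (p ^ e)%N.
    rewrite pnatX; apply/orP; left; rewrite -(@eq_pnat p) ?pnat_id // => r.
    by rewrite in_pil !inE.
  apply: hN; first exact: pnat_cat_mul pe sb.
  have [h1 h2] := partn_mul d1 pe sb.
  rewrite Om_cons -(Om_part s) h2 ob -(@logn_partn (pil [:: p])) ?in_pil ?mem_head //.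
  by rewrite h1 pfactorK // subnKC.
have T0 e : (N <= p ^ e)%N -> T e = 0.
  move=> Npe; apply: big_pred0 => b; apply/negP => /andP[/pnat_gt0 b0].
  by rewrite ltnNge (leq_trans Npe) // leq_pmulr.
have Td e : (d < e)%N -> T e = 0.
  move=> de; apply: big1 => b _; rewrite /F pfactorK // gtn_eqF //.
  by rewrite (leq_trans de) // leq_addr.
have TE e : (e <= d)%N -> T e = (e`!%:R)^-1 * psi p ^+ e *
      ((\sum_(r <- s) psi r) ^+ (d - e) / (d - e)`!%:R).
  move=> ed; rewrite -IH //; last first.
    move=> n sn on; apply: leq_ltn_trans (bnd e n ed sn on).
    by rewrite leq_pmull // expn_gt0 prime_gt0.
  rewrite mulr_sumr /T big_mkcond [RHS]big_mkcond; apply: eq_bigr => b _.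
  rewrite /F pfactorK // cmulX //.
  have -> : ((e + Om s b)%N == d) = (Om s b == (d - e)%N).
    by rewrite -{1}(subnKC ed) eqn_add2l.
  case: eqVneq => [ob|_]; last by rewrite andbF; case: ifP.
  by case sb : (pnat _ _) => //=; rewrite bnd.
have -> : \sum_(e < N | (p ^ e < N)%N)
     \sum_(b < N | (pil s).-nat b && (p ^ e * b < N)%N) F (p ^ e)%N b =
   \sum_(e < d.+1) (e`!%:R)^-1 * psi p ^+ e *
      ((\sum_(r <- s) psi r) ^+ (d - e) / (d - e)`!%:R).
  transitivity (\sum_(e < N) T e).
    rewrite big_mkcond; apply: eq_bigr => e _; case: ltnP => // /T0 //.
  transitivity (\sum_(e < N + d.+1) T e).
    rewrite [RHS](sum_ord_trunc (m := N)) ?leq_addr // => e Ne; apply: T0.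
    exact: leq_trans Ne (ltnW (ltn_expl _ (prime_gt1 pp))).
  rewrite (sum_ord_trunc (m := d.+1)) ?leq_addl //.
  by apply: eq_bigr => e _; apply: TE; rewrite -ltnS.
rewrite big_cons addrC exprDn mulr_suml; apply: eq_bigr => e _.
have ed : (e <= d)%N by rewrite -ltnS.
rewrite -(bin_fact ed) !natrM -mulr_natr !invfM.
have h : ('C(d, e))%:R != 0 :> V by rewrite pnatr_eq0 -lt0n bin_gt0.
have h1 : e`!%:R != 0 :> V by rewrite pnatr_eq0 -lt0n fact_gt0.
have h2 : (d - e)`!%:R != 0 :> V by rewrite pnatr_eq0 -lt0n fact_gt0.
by field; rewrite h h1 h2.
Qed.

(** For a truncated exponential with parameter c the factorial cancels and the coefficient of n
    becomes c^(Om n) times [ka s n], which is multiplicative up to the truncation. *)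
Lemma poly_block (s : seq nat) (N : nat) psi (Q : {poly V}) :
  uniq s -> all prime s -> cmul psi ->
  (forall n, (pil s).-nat n -> (Om s n < size Q)%N -> (n < N)%N) ->
  \sum_(n < N | (pil s).-nat n) Q`_(Om s n) * (Om s n)`!%:R * ka s n * psi n =
  Q.[\sum_(p <- s) psi p].
Proof.
move=> us ps hpsi hN; rewrite horner_coef.
transitivity (\sum_(d < size Q) \sum_(n < N | (pil s).-nat n && (Om s n == d))
   Q`_d * d`!%:R * (ka s n * psi n)).
  rewrite (exchange_big_dep (fun n : 'I_N => (pil s).-nat n)) /=; last by move=> d n _ /andP[].
  apply: eq_bigr => n sn; rewrite -[LHS]mulrA.
  have [oQ|Qo] := ltnP (Om s n) (size Q).
    rewrite (big_pred1 (Ordinal oQ)) // => d; rewrite sn /= eq_sym.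
    by rewrite -val_eqE.
  rewrite nth_default // !mul0r big1 // => d /andP[_ /eqP od].
  by move: (ltn_ord d); rewrite -od ltnNge Qo.
apply: eq_bigr => d _; rewrite -mulr_sumr multinomial_block //.
  by field; rewrite pnatr_eq0 -lt0n fact_gt0.
by move=> n sn on; apply: hN; rewrite // on.
Qed.

End Multinomial.

(** * Products over disjoint blocks of primes *)

Section Blocks.
Context {V : numFieldType} (b : nat -> seq nat).
Hypothesis b_prime : forall i, all prime (b i).
Hypothesis b_uniq : forall i, uniq (b i).
Hypothesis b_disj : forall i j, i != j -> disj (b i) (b j).

Fixpoint bl (J : nat) : seq nat := if J is J'.+1 then bl J' ++ b J' else [::].

Lemma bl_mem J p : p \in bl J -> exists2 i, (i < J)%N & p \in b i.
Proof.
elim: J => // J IH; rewrite /= mem_cat => /orP[/IH[i iJ pi]|pJ].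
  by exists i => //; exact: leqW.
by exists J.
Qed.

Lemma mem_bl J i p : (i < J)%N -> p \in b i -> p \in bl J.
Proof.
elim: J => // J IH; rewrite ltnS leq_eqVlt => /predU1P[->|iJ] pi.
  by rewrite /= mem_cat pi orbT.
by rewrite /= mem_cat IH.
Qed.

Lemma bl_disj J : disj (bl J) (b J).
Proof.
move=> p /bl_mem[i iJ pi]; apply: b_disj pi.
by rewrite ltn_eqF.
Qed.

Definition coefB (Q : nat -> {poly V}) J n : V :=
  \prod_(i < J) ((Q i)`_(Om (b i) n) * (Om (b i) n)`!%:R * ka (b i) n).

Lemma Om_sub_part (s1 s2 : seq nat) n : {subset s1 <= s2} -> Om s1 (n`_(pil s2))%N = Om s1 n.
Proof.
by move=> h; apply: eq_big_seq => p /h ps; rewrite logn_partn.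
Qed.

Lemma ka_sub_part (s1 s2 : seq nat) n : {subset s1 <= s2} -> ka s1 (n`_(pil s2))%N = ka s1 n :> V.
Proof.
by move=> h; apply: eq_big_seq => p /h ps; rewrite logn_partn.
Qed.

Lemma coefB_part Q J n : coefB Q J (n`_(pil (bl J)))%N = coefB Q J n.
Proof.
apply: eq_bigr => i _; have h : {subset b i <= bl J} by move=> p; exact: mem_bl.
by rewrite Om_sub_part // ka_sub_part.
Qed.

Lemma Om_pnat0 (s1 s2 : seq nat) n : disj s1 s2 -> (pil s2).-nat n -> Om s1 n = 0%N.
Proof.
by move=> d sn; rewrite /Om big1_seq // => p /= ps; apply: logn_pnat0 sn; exact: d.
Qed.

Lemma disjC (s1 s2 : seq nat) : disj s1 s2 -> disj s2 s1.
Proof. by move=> d p p2; apply/negP => p1; have := d p p1; rewrite p2. Qed.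

Lemma prod_block (Q : nat -> {poly V}) J N (psi : nat -> V) : cmul psi ->
  (forall n, (pil (bl J)).-nat n ->
     (forall i, (i < J)%N -> (Om (b i) n < size (Q i))%N) -> (n < N)%N) ->
  (forall i, Q i != 0) ->
  \sum_(n < N | (pil (bl J)).-nat n) coefB Q J n * psi n =
  \prod_(i < J) (Q i).[\sum_(p <- b i) psi p].
Proof.
move=> hpsi; elim: J N => [|J IH] N hN Q0.
  rewrite big_ord0; have N1 : (1 < N)%N by apply: hN.
  rewrite (big_pred1 (Ordinal N1)) => [|n].
    by rewrite /coefB big_ord0 mul1r (proj1 hpsi).
  rewrite /= -val_eqE /=; apply/idP/eqP => [|->//] /andP[n0 /allP h]; apply/eqP.
  rewrite eqn_leq n0 andbT leqNgt; apply/negP => n1.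
  by have := h (pdiv n); rewrite mem_primes pdiv_prime // n0 pdiv_dvd => /(_ isT).
pose F a c : V := coefB Q J a * psi a *
  ((Q J)`_(Om (b J) c) * (Om (b J) c)`!%:R * ka (b J) c * psi c).
have FE n : (pil (bl J.+1)).-nat n -> coefB Q J.+1 n * psi n =
    F (n`_(pil (bl J)))%N (n`_(pil (b J)))%N.
  move=> sn; rewrite /F coefB_part Om_part ka_part.
  rewrite -{2}(pil_cat_part (@bl_disj J) sn) (proj2 hpsi) /coefB big_ord_recr /=.
  by ring.
rewrite (eq_bigr _ (fun n : 'I_N => FE n)) sum_pnat_cat; last exact: bl_disj.
have dj := @bl_disj J.
have sub1 (n : nat) : (pil (bl J)).-nat n -> (pil (bl J ++ b J)).-nat n.
  by move=> sn; rewrite -[n]muln1; apply: pnat_cat_mul.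
have sub2 (n : nat) : (pil (b J)).-nat n -> (pil (bl J ++ b J)).-nat n.
  by move=> sn; rewrite -[n]mul1n; apply: pnat_cat_mul.
have szQ i : (0 < size (Q i))%N by rewrite lt0n size_poly_eq0.
have subJ i : (i < J)%N -> {subset b i <= bl J} by move=> iJ p; exact: mem_bl.
have coef0 a i : coefB Q J a != 0 -> (i < J)%N -> (Om (b i) a < size (Q i))%N.
  move=> /prodf_neq0 h iJ; have := h (Ordinal iJ) isT; rewrite ltnNge /=.
  by apply: contraNN => Qo; rewrite nth_default // !mul0r.
rewrite big_ord_recr /= -(IH N) //; last first.
  move=> n sn on; apply: hN; first exact: sub1.
  move=> i; rewrite ltnS leq_eqVlt => /predU1P[->|]; last exact: on.
  by rewrite (@Om_pnat0 (b J) (bl J)) //; exact: disjC.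
rewrite -(@poly_block V (b J) N psi (Q J)) //; last first.
  move=> n sn on; apply: hN; first exact: sub2.
  move=> i; rewrite ltnS leq_eqVlt => /predU1P[->//|iJ].
  by rewrite (@Om_pnat0 (b i) (b J)) //; apply: b_disj; rewrite ltn_eqF.
rewrite mulr_suml; apply: eq_bigr => a sa; rewrite mulr_sumr big_mkcond [RHS]big_mkcond.
apply: eq_bigr => c _; case sc : (pnat _ c) => //=; case: ltnP => // Nac.
(* A pair with [a * c >= N] contributes nothing: nonzero coefficients force the degree conditions,
   and [hN] then puts the product below [N]. *)
rewrite /F; apply/esym/eqP; apply: contraTT Nac; rewrite !mulf_eq0 !negb_or.
move=> /andP[/andP[ca _] /andP[/andP[/andP[qc _] _] _]].
rewrite -ltnNge; apply: hN; first exact: pnat_cat_mul sa sc.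
have [h1 h2] := partn_mul dj sa sc.
move=> i; rewrite ltnS leq_eqVlt => /predU1P[->|iJ].
  rewrite -Om_part h2 ltnNge; apply: contraNN qc => Qo.
  by rewrite nth_default.
by rewrite -(Om_sub_part _ (subJ _ iJ)) h1; exact: coef0.
Qed.

(** Dropping the condition [a * c < N] only adds nonnegative terms, after which the sum factors over
    the blocks. *)
Lemma b_part_le_prod (F : nat -> nat -> V) J N :
  (forall i n, 0 <= F i n) ->
  (forall i n, F i (n`_(pil (b i)))%N = F i n) ->
  \sum_(n < N | (pil (bl J)).-nat n) (\prod_(i < J) F i n) / n%:R <=
  \prod_(i < J) \sum_(n < N | (pil (b i)).-nat n) F i n / n%:R.
Proof.
move=> F0 Fp; elim: J => [|J IH].
  rewrite big_ord0; case: N => [|[|N]]; rewrite ?big_ord0 //.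
    by rewrite big1 // => n; case/andP; case: n => -[].
  have N1 : (1 < N.+2)%N by [].
  rewrite (big_pred1 (Ordinal N1)) => [|n]; first by rewrite big_ord0 divr1.
  rewrite /= -val_eqE /=; apply/idP/eqP => [|->//] /andP[n0 /allP h]; apply/eqP.
  rewrite eqn_leq n0 andbT leqNgt; apply/negP => n1.
  by have := h (pdiv n); rewrite mem_primes pdiv_prime // n0 pdiv_dvd => /(_ isT).
have dj := @bl_disj J.
pose G a c : V := (\prod_(i < J) F i a) / a%:R * (F J c / c%:R).
have GE n : (pil (bl J.+1)).-nat n -> (\prod_(i < J.+1) F i n) / n%:R =
    G (n`_(pil (bl J)))%N (n`_(pil (b J)))%N.
  move=> sn; rewrite /G Fp -{2}(pil_cat_part dj sn) natrM invfM big_ord_recr /=.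
  rewrite [RHS]mulrACA; congr (_ * _ * _); apply: eq_bigr => i _.
  rewrite -(Fp i) -[in RHS](Fp i); congr (F i _); apply: eq_partn_from_log.
  - exact: pnat_gt0 sn.
  - exact: part_gt0.
  by move=> p pi; rewrite logn_partn // in_pil; apply: mem_bl pi.
rewrite (eq_bigr _ (fun n : 'I_N => GE n)) sum_pnat_cat // big_ord_recr /=.
have S0 : 0 <= \sum_(n < N | (pil (b J)).-nat n) F J n / n%:R.
  by apply: sumr_ge0 => n _; rewrite divr_ge0.
apply: le_trans (ler_wpM2r S0 IH).
rewrite mulr_suml; apply: ler_sum => a sa; rewrite mulr_sumr.
rewrite big_mkcond [leRHS]big_mkcond; apply: ler_sum => c _.
have G0 : 0 <= G a c by rewrite mulr_ge0 ?divr_ge0 ?prodr_ge0.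
by case sc : (pnat _ c) => //=; case: ltnP.
Qed.

End Blocks.

Section EulerProduct.
Context {V : numFieldType}.

Lemma euler_prod_le (s : seq nat) (phi : nat -> nat -> V) N : all prime s -> uniq s ->
  (forall p e, 0 <= phi p e) ->
  \sum_(n < N | (pil s).-nat n) (\prod_(p <- s) phi p (logn p n)) / n%:R <=
  \prod_(p <- s) \sum_(e < N) phi p e / p%:R ^+ e.
Proof.
move=> + + phi0; elim: s => [|p s IH].
  move=> _ _; rewrite big_nil; case: N => [|[|N]]; rewrite ?big_ord0 //.
    by rewrite big1 // => n; case/andP; case: n => -[].
  have N1 : (1 < N.+2)%N by [].
  rewrite (big_pred1 (Ordinal N1)) => [|n]; first by rewrite big_nil divr1.
  rewrite /= -val_eqE /=; apply/idP/eqP => [|->//] /andP[n0 /allP h]; apply/eqP.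
  rewrite eqn_leq n0 andbT leqNgt; apply/negP => n1.
  by have := h (pdiv n); rewrite mem_primes pdiv_prime // n0 pdiv_dvd => /(_ isT).
move=> /= /andP[pp ps] /andP[pns us]; have dj := disj1 pns.
pose G a c : V := phi p (logn p a) / a%:R * ((\prod_(r <- s) phi r (logn r c)) / c%:R).
have GE n : (pil ([:: p] ++ s)).-nat n -> (\prod_(r <- p :: s) phi r (logn r n)) / n%:R =
    G (n`_(pil [:: p]))%N (n`_(pil s))%N.
  move=> sn; rewrite /G logn_partn ?in_pil ?mem_head // -{2}(pil_cat_part dj sn).
  rewrite natrM invfM big_cons [RHS]mulrACA; congr (_ * _ * _).
  by apply: eq_big_seq => r rs; rewrite logn_partn.
rewrite (eq_bigr _ (fun n : 'I_N => GE n)) sum_pnat_cat // big_cons.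
rewrite (sum_pnat1 N (fun a => \sum_(c < N | (pil s).-nat c && (a * c < N)%N) G a c) pp).
have S0 : 0 <= \sum_(e < N) phi p e / p%:R ^+ e.
  by apply: sumr_ge0 => n _; rewrite divr_ge0 ?exprn_ge0.
apply: le_trans (ler_wpM2l S0 (IH ps us)).
rewrite mulr_suml big_mkcond; apply: ler_sum => e _.
have P0 c : 0 <= \prod_(r <- s) phi r (logn r c) by apply: prodr_ge0.
have RHS0 : 0 <= phi p e / p%:R ^+ e *
    (\sum_(n < N | (pil s).-nat n) (\prod_(r <- s) phi r (logn r n)) / n%:R).
  rewrite mulr_ge0 ?divr_ge0 ?exprn_ge0 //; apply: sumr_ge0 => n _.
  by rewrite divr_ge0.
case: ltnP => // peN; rewrite mulr_sumr.
rewrite big_mkcond [leRHS]big_mkcond; apply: ler_sum => c _.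
rewrite /G pfactorK // natrX.
have G0 : 0 <= phi p e / p%:R ^+ e * ((\prod_(r <- s) phi r (logn r c)) / c%:R).
  by rewrite mulr_ge0 ?divr_ge0 ?exprn_ge0.
by case sc : (pnat _ c) => //=; case: ltnP.
Qed.

(** An equality, unlike [euler_prod_le]: divisors of [n] lie below [N] by themselves, so the
    truncation loses nothing. *)
Lemma divisor_sum_prod (s : seq nat) (phi : nat -> nat -> V) N n : all prime s -> uniq s ->
  (0 < n < N)%N ->
  \sum_(m < N | (pil s).-nat m && (m %| n)%N) \prod_(p <- s) phi p (logn p m) =
  \prod_(p <- s) \sum_(e < (logn p n).+1) phi p e.
Proof.
move=> + + /andP[n0 nN]; elim: s => [|p s IH].
  move=> _ _; rewrite big_nil; have N1 : (1 < N)%N by apply: leq_ltn_trans nN.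
  rewrite (big_pred1 (Ordinal N1)) => [|m]; first by rewrite big_nil.
  rewrite /= -val_eqE /=; apply/idP/eqP => [/andP[/andP[m0 /allP h] _]|->]; last by rewrite /= dvd1n.
  apply/eqP.
  rewrite eqn_leq m0 andbT leqNgt; apply/negP => m1.
  by have := h (pdiv m); rewrite mem_primes pdiv_prime // m0 pdiv_dvd => /(_ isT).
move=> /= /andP[pp ps] /andP[pns us]; have dj := disj1 pns.
rewrite big_mkcondr /=.
pose G a c : V := if (a * c %| n)%N then phi p (logn p a) * (\prod_(r <- s) phi r (logn r c)) else 0.
have GE m : (pil ([:: p] ++ s)).-nat m ->
    (if (m %| n)%N then \prod_(r <- p :: s) phi r (logn r m) else 0) =
    G (m`_(pil [:: p]))%N (m`_(pil s))%N.
  move=> sm; rewrite /G pil_cat_part // logn_partn ?in_pil ?mem_head // big_cons.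
  case: ifP => // _; congr (_ * _).
  by apply: eq_big_seq => r rs; rewrite logn_partn.
rewrite (eq_bigr _ (fun n : 'I_N => GE n)) sum_pnat_cat // big_cons -IH //.
rewrite (sum_pnat1 N (fun a => \sum_(c < N | (pil s).-nat c && (a * c < N)%N) G a c) pp).
pose T e : V := if (e < (logn p n).+1)%N then phi p e * (\sum_(m < N | (pil s).-nat m && (m %| n)%N) \prod_(r <- s) phi r (logn r m)) else 0.
transitivity (\sum_(e < N) T e).
  rewrite big_mkcond; apply: eq_bigr => e _.
  rewrite /T ltnS -(pfactor_dvdn e pp n0).
  case: ifP => [peN|/negbT peN]; last first.
    case: ifP => // pd; case/negP: peN; apply: leq_ltn_trans nN; exact: dvdn_leq.
  have cop c : (pil s).-nat c -> coprime (p ^ e) c.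
    move=> sc; apply: (@pnat_coprime (pil [:: p])).
      rewrite pnatX; apply/orP; left; rewrite -(@eq_pnat p) ?pnat_id // => r.
      by rewrite in_pil !inE.
    apply: sub_in_pnat sc => r _; rewrite -[r \in (pil [:: p])^']/(r \notin [:: p]) in_pil.
    by move=> rs; apply: disjC dj r rs.
  case: ifP => pd.
    rewrite mulr_sumr big_mkcond [RHS]big_mkcond; apply: eq_bigr => c _.
    case sc : (pnat _ c) => //=; rewrite /G Gauss_dvd ?cop // pd /= pfactorK //.
    case: ifP => acN; case: ifP => // cd; case/negP: (negbT acN).
    by apply: leq_ltn_trans nN; apply: dvdn_leq => //; rewrite Gauss_dvd ?cop ?pd.
  rewrite big1 // => c /andP[sc _]; rewrite /G ifN //; apply/negP => h.
  by have := dvdn_trans (dvdn_mulr _ (dvdnn _)) h; rewrite pd.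
rewrite (sum_ord_trunc (m := (logn p n).+1)) //.
- by rewrite mulr_suml; apply: eq_bigr => e _; rewrite /T ltn_ord.
- exact: leq_trans (ltn_logl p n0) (ltnW nN).
- by move=> e le; rewrite /T ltnNge le.
Qed.

End EulerProduct.

Lemma eqle {R : realType} (x y : R) : x = y -> x <= y. Proof. by move->. Qed.

(** * Blocks of primes *)

Section PrimeBlocks.

(* The blocks are doubly exponential so that each has a bounded sum of
   reciprocals, while the first [J] together contribute [J * ln 2 + O(1)]. *)
Definition bd (i : nat) : nat := 2 ^ (2 ^ i).
Definition blk (i : nat) : seq nat :=
  [seq p <- index_iota (bd i).+1 (bd i.+1).+1 | prime p].

Lemma bdS i : bd i.+1 = (bd i ^ 2)%N.
Proof. by rewrite /bd expnS mulnC expnM. Qed.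

Lemma bd_gt1 i : (1 < bd i)%N.
Proof. by rewrite /bd -{1}(expn0 2) ltn_exp2l // expn_gt0. Qed.

Lemma bd_mono i j : (i <= j)%N -> (bd i <= bd j)%N.
Proof. by move=> ij; rewrite /bd !leq_exp2l. Qed.

Lemma mem_blk i p : (p \in blk i) = prime p && (bd i < p <= bd i.+1)%N.
Proof. by rewrite mem_filter mem_index_iota ltnS. Qed.

Lemma blk_prime i : all prime (blk i).
Proof. by apply/allP => p; rewrite mem_blk => /andP[]. Qed.

Lemma blk_uniq i : uniq (blk i).
Proof. by rewrite filter_uniq // iota_uniq. Qed.

Lemma blk_disj i j : i != j -> disj (blk i) (blk j).
Proof.
move=> ij p; rewrite !mem_blk => /and3P[_ ip pi]; apply/negP => /and3P[_ jp pj].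
case: (ltngtP i j) ij => // [l|l] _.
  by have := leq_ltn_trans (leq_trans pi (bd_mono l)) jp; rewrite ltnn.
by have := leq_ltn_trans (leq_trans pj (bd_mono l)) ip; rewrite ltnn.
Qed.

Lemma pnatE (s : seq nat) n : uniq s -> all prime s -> (pil s).-nat n ->
  n = (\prod_(p <- s) p ^ logn p n)%N.
Proof.
elim: s n => [|p s IH] n.
  move=> _ _ /andP[n0 /allP h]; rewrite big_nil; apply/eqP.
  rewrite eqn_leq n0 andbT leqNgt; apply/negP => n1.
  by have := h (pdiv n); rewrite mem_primes pdiv_prime // n0 pdiv_dvd => /(_ isT).
move=> /= /andP[pns us] /andP[pp ps] sn.
rewrite big_cons -{1}(@pil_cat_part [:: p] s n (disj1 pns) sn); congr muln.
  rewrite -p_part; apply: eq_in_partn => r _; by rewrite in_pil !inE.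
rewrite [LHS](IH _ us ps (part_pnat _ _)); apply: eq_big_seq => r rs.
by rewrite logn_partn.
Qed.

Lemma Om_expn_le (s : seq nat) n B : uniq s -> all prime s -> (0 < n)%N ->
  (forall p, p \in s -> (B <= p)%N) -> (B ^ Om s n <= n)%N.
Proof.
move=> us ps n0 hB; apply: leq_trans (dvdn_leq n0 (dvdn_part (pil s) n)).
rewrite [leqRHS](pnatE us ps (part_pnat _ _)) -Om_part /Om expn_sum.
rewrite big_seq [leqRHS]big_seq; apply: leq_prod => p pI.
by case: (logn p _) => // k; rewrite leq_exp2r // hB.
Qed.

Lemma le_Om_expn (s : seq nat) n B : uniq s -> all prime s -> (pil s).-nat n ->
  (forall p, p \in s -> (p <= B)%N) -> (n <= B ^ Om s n)%N.
Proof.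
move=> us ps sn hB; rewrite {1}(pnatE us ps sn) /Om expn_sum.
rewrite big_seq [leqRHS]big_seq; apply: leq_prod => p pI.
by case: (logn p _) => // k; rewrite leq_exp2r // hB.
Qed.

Lemma fact_le_expn n : (n`! <= n ^ n)%N.
Proof.
case: n => // n; elim: n => // n IH; rewrite factS expnS leq_mul2l /=.
by apply: leq_trans IH _; rewrite leq_exp2r.
Qed.

Context {R : realType}.

Definition sB i : R := \sum_(p <- blk i) p%:R^-1.

Lemma sB_ge0 i : 0 <= sB i. Proof. by apply: sumr_ge0 => p _; rewrite invr_ge0. Qed.

(* [blk i] lies in (bd i, n]; each of its primes [p] divides [n`!] at least
   [n %/ p] times, and [n`! <= n ^ n = bd i ^ (2 * n)]. *)
Lemma sB_le4 i : sB i <= 4.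
Proof.
pose n := bd i.+1; have n0 : (0 < n)%N by rewrite ltnW // bd_gt1.
have h1 : (bd i ^ Om (blk i) n`! <= bd i ^ (2 * n))%N.
  apply: leq_trans (_ : n`! <= _)%N.
    apply: Om_expn_le; rewrite ?blk_uniq ?blk_prime ?fact_gt0 //.
    by move=> p; rewrite mem_blk => /and3P[_ /ltnW].
  apply: leq_trans (fact_le_expn n) _; rewrite expnM -bdS //.
rewrite leq_exp2l ?bd_gt1 // in h1.
have h2 : (\sum_(p <- blk i) n %/ p <= 2 * n)%N.
  apply: leq_trans h1; rewrite /Om big_seq [leqRHS]big_seq; apply: leq_sum => p.
  rewrite mem_blk => /andP[pp /andP[bp pb]]; rewrite logn_fact // big_add1 /= /index_iota.
  rewrite (bigD1_seq 0) /= ?iota_uniq ?mem_iota ?subn0 ?n0 //.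
  by rewrite expn1 leq_addr.
have h3 : \sum_(p <- blk i) n%:R / 2 * p%:R^-1 <= (2 * n)%:R :> R.
  apply: le_trans (_ : (\sum_(p <- blk i) n %/ p)%:R <= _); last by rewrite ler_nat.
  rewrite natr_sum big_seq [leRHS]big_seq; apply: ler_sum => p.
  rewrite mem_blk => /andP[pp /andP[bp pb]].
  have p0 : (0 < p)%N by rewrite prime_gt0.
  rewrite ler_pdivrMr ?ltr0n // ler_pdivrMr // -!natrM ler_nat.
  have d1 : (0 < n %/ p)%N by rewrite divn_gt0.
  rewrite {1}(divn_eq n p); have := ltn_pmod n p0; nia.
rewrite -mulr_sumr natrM in h3.
have nR : 0 < n%:R :> R by rewrite ltr0n.
rewrite /sB; set S := \sum_(p <- _) _ in h3 *.
rewrite -(ler_pM2l (x := n%:R / 2)) ?divr_gt0 //; apply: le_trans h3 _; lra.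
Qed.

(** Since 1/(1 - 1/p) = 1 + 1/p + 1/(p(p-1)), this collects what the Euler factors contain beyond
    [sB]. *)
Definition rB i : R := \sum_(p <- blk i) (p%:R * (p.-1)%:R)^-1.

Lemma rB_ge0 i : 0 <= rB i.
Proof. by apply: sumr_ge0 => p _; rewrite invr_ge0 mulr_ge0. Qed.

(** Comparison with the sum over all integers of the block, which telescopes. *)
Lemma rB_le i : rB i <= (bd i)%:R^-1 - (bd i.+1)%:R^-1.
Proof.
have bb : ((bd i).+1 <= (bd i.+1).+1)%N by rewrite ltnS bd_mono.
have b0 : (0 < bd i)%N by rewrite ltnW // bd_gt1.
have : \sum_((bd i).+1 <= n < (bd i.+1).+1) (n%:R * (n.-1)%:R)^-1 =
  (bd i)%:R^-1 - (bd i.+1)%:R^-1 :> R.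
  rewrite big_add1 /= (@telescope_sumr_eq R (bd i) (bd i.+1) (fun k => - (k%:R)^-1)); last 2 first.
  - by rewrite bd_mono.
  - move=> k /andP[bk _]; have k0 : (0 < k)%N by apply: leq_trans bk.
    have h : k%:R != 0 :> R by rewrite pnatr_eq0 -lt0n.
    have h' : k%:R + 1 != 0 :> R by rewrite natr1 pnatr_eq0.
    by rewrite -natr1 mulrC; field; rewrite h h'.
  by ring.
move=> <-; rewrite /rB /blk big_filter big_mkcond; apply: ler_sum => p _.
by case: ifP => // _; rewrite invr_ge0 mulr_ge0.
Qed.

Lemma rB_sum J : \sum_(i < J) rB i <= 2^-1.
Proof.
suff : \sum_(i < J) rB i <= 2^-1 - (bd J)%:R^-1.
  by move=> h; apply: le_trans h _; rewrite gerBl invr_ge0.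
elim: J => [|J IH]; first by rewrite big_ord0 /bd expn0 expn1 subrr.
rewrite big_ord_recr /=; apply: le_trans (lerD IH (rB_le J)) _.
by rewrite addrA addrNK.
Qed.

Lemma harmonic_ge m : m%:R / 2 <= \sum_(1 <= n < (2 ^ m).+1) n%:R^-1 :> R.
Proof.
elim: m => [|m IH]; first by rewrite mul0r expn0 big_nat1 invr_ge0.
rewrite (big_cat_nat (n := (2 ^ m).+1)) //=; last by rewrite ltnS leq_exp2l.
rewrite -natr1 mulrDl; apply: lerD => //.
apply: le_trans (_ : \sum_((2 ^ m).+1 <= n < (2 ^ m.+1).+1) (2 ^ m.+1)%:R^-1 <= _).
  rewrite sumr_const_nat subSS expnS mul2n -addnn addnK -mulr_natl natrD.
  have h : (2 ^ m)%:R != 0 :> R by rewrite pnatr_eq0 -lt0n expn_gt0.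
  by apply: eqle; field.
rewrite !big_nat; apply: ler_sum => n /andP[n0 n1]; rewrite lef_pV2 ?posrE ?ltr0n ?ler_nat //.
  by rewrite expn_gt0.
by apply: leq_ltn_trans n0.
Qed.

Definition sJ J : R := \sum_(i < J) sB i.

Lemma geo_le (x : R) N : 0 <= x < 1 -> \sum_(e < N) x ^+ e <= (1 - x)^-1.
Proof.
move=> /andP[x0 x1]; have h : 0 < 1 - x by rewrite subr_gt0.
rewrite -(ler_pM2l h) divff ?gt_eqF // -opprB mulNr -subrX1 opprB.
by rewrite gerBl exprn_ge0.
Qed.

(** The blocks begin above [bd 0 = 2], so the prime 2 is adjoined by hand. *)
Lemma bl_cover J n : (0 < n <= bd J)%N -> (pil ([:: 2%N] ++ bl blk J)).-nat n.
Proof.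
move=> /andP[n0 nb]; apply/(pnatP _ n0) => p pp pn; rewrite in_pil mem_cat inE.
have pb : (p <= bd J)%N by apply: leq_trans nb; apply: dvdn_leq.
have [->|p2] //= := eqVneq p 2%N.
have p3 : (bd 0 < p)%N by rewrite /bd /= ltn_neqAle eq_sym p2 prime_gt1.
elim: J pb {nb} => [|J IH] pb; first by move: p3; rewrite ltnNge pb.
rewrite /= mem_cat; have [/IH ->//|bp] := leqP p (bd J).
by rewrite mem_blk pp bp pb orbT.
Qed.

Lemma bl_uniq J : uniq (bl blk J).
Proof.
elim: J => // J IH; rewrite /= cat_uniq IH blk_uniq andbT /=.
by apply/hasPn => p pJ; apply/negP => /(bl_disj blk_disj); rewrite pJ.
Qed.

Lemma bl_prime J : all prime (bl blk J).
Proof. by elim: J => // J IH; rewrite /= all_cat IH blk_prime. Qed.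

Lemma bl_gt2 J p : p \in bl blk J -> (2 < p)%N.
Proof.
move=> /bl_mem[i _]; rewrite mem_blk => /and3P[_ h _].
by apply: leq_ltn_trans h; exact: (bd_mono (leq0n i)).
Qed.

Lemma sum_bl (f : nat -> R) J :
  \sum_(p <- bl blk J) f p = \sum_(i < J) \sum_(p <- blk i) f p.
Proof.
elim: J => [|J IH]; first by rewrite big_nil big_ord0.
by rewrite /= big_cat /= IH big_ord_recr.
Qed.

(** The lower half of Mertens' theorem. The harmonic sum up to 2^(2^J) is at least 2^J/2 and at most
    the Euler product, in which the prime 2 contributes 2 and the other primes at most exp(sJ + 1/2)
    <= 4 exp(sJ). *)
Lemma exp_sJ_ge J : (2 ^ J)%:R / 16 <= expR (sJ J).
Proof.
pose N := (bd J).+1.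
have us : uniq ([:: 2%N] ++ bl blk J).
  by rewrite /= bl_uniq andbT; apply/negP => /bl_gt2.
have ps : all prime ([:: 2%N] ++ bl blk J) by rewrite /= bl_prime.
have h1 : (2 ^ J)%:R / 2 <= \prod_(p <- [:: 2%N] ++ bl blk J) (1 - p%:R^-1)^-1 :> R.
  apply: le_trans (harmonic_ge _) _; rewrite -/(bd J).
  apply: le_trans (_ : \prod_(p <- [:: 2%N] ++ bl blk J) \sum_(e < N) 1 / p%:R ^+ e <= _).
    apply: le_trans (euler_prod_le (phi := fun _ _ => 1 : R) N ps us _) => [|p e]; last by [].
    rewrite -(big_mkord (fun n => (pil ([:: 2%N] ++ bl blk J)).-nat n) (fun n => (\prod_(p <- [:: 2%N] ++ bl blk J) (1 : R)) / n%:R)).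
    rewrite [leRHS]big_mkcond [leRHS]big_ltn // -[leLHS]add0r; apply: lerD; [by []|]; rewrite !big_nat; apply: eqle; apply: eq_bigr => n /andP[n0 nN].
    have := @bl_cover J n; rewrite n0 -ltnS nN => /(_ isT) /= ->.
    by rewrite big1_seq ?mul1r.
  rewrite big_seq [leRHS]big_seq; apply: ler_prod => p pI.
  have p1 : (1 < p)%N by apply: prime_gt1; move/allP: ps => /(_ p pI).
  apply/andP; split; first by apply: sumr_ge0 => e _; rewrite divr_ge0 ?exprn_ge0.
  under eq_bigr => e _ do rewrite mul1r -exprVn.
  by apply: geo_le; rewrite invr_ge0 ler0n /= invf_lt1 ?ltr0n ?ltr1n // ltnW.
rewrite big_cat big_seq1 /= in h1.
have h2 : \prod_(p <- bl blk J) (1 - p%:R^-1)^-1 <= expR (sJ J + 2^-1) :> R.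
  apply: le_trans (_ : expR (sJ J + \sum_(i < J) rB i) <= _); last first.
    by rewrite ler_expR lerD2l rB_sum.
  rewrite /sJ /sB /rB -!sum_bl -big_split /= expR_sum.
  rewrite big_seq [leRHS]big_seq; apply: ler_prod => p pI.
  have p2 := bl_gt2 pI; have p0 : 0 < p%:R :> R by rewrite ltr0n; lia.
  have p1 : 1 < p%:R :> R by rewrite ltr1n; lia.
  have pp : p.-1%:R = p%:R - 1 :> R by rewrite -subn1 natrB //; lia.
  have i1 : p%:R^-1 < 1 :> R by rewrite invf_lt1.
  rewrite invr_ge0 subr_ge0 (ltW i1) /=; apply: le_trans (expR_ge1Dx _).
  have n0 : p%:R != 0 :> R by rewrite gt_eqF.
  have n1 : p%:R - 1 != 0 :> R by rewrite gt_eqF // subr_gt0.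
  by rewrite pp; apply: eqle; field; rewrite n0 n1.
have h3 : expR (2^-1) <= 4 :> R.
  have e4 : expR (- 2^-1) >= 2^-1 :> R.
    by apply: le_trans (expR_ge1Dx _); lra.
  by rewrite -[2^-1 in X in X <= _]opprK expRN -[4]invrK lef_pV2 ?posrE ?expR_gt0 ?invr_gt0 //; apply: le_trans e4; lra.
rewrite expRD in h2.
have e0 : 0 < expR (sJ J) :> R := expR_gt0 _.
have : (2 ^ J)%:R / 2 <= 2 * (expR (sJ J) * 4) :> R.
  apply: le_trans h1 _; apply: ler_pM.
  - by rewrite invr_ge0; lra.
  - by apply: prodr_ge0 => p _; rewrite invr_ge0 subr_ge0; case: p => [|p]; rewrite ?invr0 // invf_le1 ?ltr0n // ler1n.
  - by rewrite -[leRHS]invrK lef_pV2 ?posrE; lra.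
  - by apply: le_trans h2 _; rewrite ler_wpM2l // ltW.
by lra.
Qed.

End PrimeBlocks.

(** * The Dirichlet polynomials P and A *)

Section ExpPoly.
Context {R : realType}.
Implicit Types (p : {poly R}).

Lemma exp_coef_add (c d : R) i :
  \sum_(j < i.+1) (c ^+ j / j`!%:R) * (d ^+ (i - j) / (i - j)`!%:R) = (c + d) ^+ i / i`!%:R.
Proof.
rewrite addrC exprDn mulr_suml; apply: eq_bigr => j _.
have ji : (j <= i)%N by rewrite -ltnS.
rewrite -(bin_fact ji) !natrM -mulr_natr !invfM.
have h : ('C(i, j))%:R != 0 :> R by rewrite pnatr_eq0 -lt0n bin_gt0.
have h1 : j`!%:R != 0 :> R by rewrite pnatr_eq0 -lt0n fact_gt0.
have h2 : (i - j)`!%:R != 0 :> R by rewrite pnatr_eq0 -lt0n fact_gt0.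
by field; rewrite h h1 h2.
Qed.

Definition Etr (c : R) (l : nat) : {poly R} := \poly_(i < l.+1) (c ^+ i / i`!%:R).

(* Coefficients dominated by those of [exp (c x)]. *)
Definition expdom (c : R) p := forall i, `|p`_i| <= c ^+ i / i`!%:R.
Definition expeq (c : R) (l : nat) p := forall i, (i <= l)%N -> p`_i = c ^+ i / i`!%:R.

Lemma expdomM c d p q : expdom c p -> expdom d q -> expdom (c + d) (p * q).
Proof.
move=> hp hq i; rewrite coefM -exp_coef_add; apply: le_trans (ler_norm_sum _ _ _) _.
by apply: ler_sum => j _; rewrite normrM ler_pM.
Qed.

Lemma expeqM c d l p q : expeq c l p -> expeq d l q -> expeq (c + d) l (p * q).
Proof.
move=> hp hq i il; rewrite coefM -exp_coef_add; apply: eq_bigr => j _.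
by rewrite hp ?hq //; apply: leq_trans il; rewrite ?leq_subr // -ltnS.
Qed.

Lemma expeq1 l : expeq 0 l 1.
Proof. by move=> [|i] _; rewrite coef1 ?expr0 ?divr1 // expr0n mul0r. Qed.

Lemma expdom1 : expdom 0 1.
Proof. by move=> [|i]; rewrite coef1 ?expr0 ?divr1 ?normr1 // normr0 expr0n mul0r. Qed.

Lemma expdomX c p m : expdom c p -> expdom (c *+ m) (p ^+ m).
Proof.
move=> hp; elim: m => [|m IH]; first by rewrite mulr0n expr0; exact: expdom1.
by rewrite mulrS exprS; exact: expdomM.
Qed.

Lemma expeqX c l p m : expeq c l p -> expeq (c *+ m) l (p ^+ m).
Proof.
move=> hp; elim: m => [|m IH]; first by rewrite mulr0n expr0; exact: expeq1.
by rewrite mulrS exprS; exact: expeqM.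
Qed.

Lemma expeq_Etr c l m : (l <= m)%N -> expeq c l (Etr c m).
Proof. by move=> lm i il; rewrite coef_poly ltnS (leq_trans il lm). Qed.

Lemma expdom_Etr c l : expdom `|c| (Etr c l).
Proof.
move=> i; rewrite coef_poly; case: ifP => _.
  by rewrite normrM normrX normfV normr_nat.
by rewrite normr0 divr_ge0 ?exprn_ge0.
Qed.

Lemma Etr_neq0 c l : Etr c l != 0.
Proof.
by apply/eqP => /(congr1 (fun p => p`_0)); rewrite coef_poly coef0 expr0 divr1 => /eqP; rewrite oner_eq0.
Qed.

Lemma size_Etr c l : (size (Etr c l) <= l.+1)%N. Proof. exact: size_poly. Qed.

Lemma size_expn_le p l m : (size p <= l.+1)%N -> (size (p ^+ m) <= (m * l).+1)%N.
Proof.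
move=> hp; elim: m => [|m IH]; first by rewrite expr0 size_poly1.
rewrite exprS; apply: leq_trans (size_polyMleq _ _) _; rewrite mulSn.
by move: hp IH; move: (size p) (size _) => a b; lia.
Qed.

Lemma exp_sum_le (x : R) N : 0 <= x -> \sum_(d < N) x ^+ d / d`!%:R <= expR x.
Proof.
move=> x0; have := @nondecreasing_cvgn_le R (series (exp_coeff x)).
have nd : {homo series (exp_coeff x) : n m / (n <= m)%N >-> n <= m}.
  by apply: nondecreasing_series => n _ _; apply: exp_coeff_ge0.
move=> /(_ nd (is_cvg_series_exp_coeff x) N) /=.
by rewrite /series /= big_mkord.
Qed.

(** Rankin's trick: x^d <= 2^(-L) (2x)^d for d >= L. *)
Lemma exp_tail_le (x : R) L : 0 <= x ->
  expR x - 2^-1 ^+ L * expR (2 * x) <= \sum_(d < L) x ^+ d / d`!%:R.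
Proof.
move=> x0; rewrite lerBlDr.
apply: (limr_le (f := series (exp_coeff x))); first exact: is_cvg_series_exp_coeff.
near=> N; rewrite /series /= big_mkord.
have t0 d : 0 <= x ^+ d / d`!%:R by rewrite divr_ge0 ?exprn_ge0.
have [NL|LN] := leqP N L.
  rewrite -!(big_mkord xpredT (fun d => x ^+ d / d`!%:R)) [X in _ <= X + _](big_cat_nat (n := N)) //=.
  rewrite -addrA lerDl addr_ge0 ?sumr_ge0 // mulr_ge0 ?exprn_ge0 // ?expR_ge0 //.
rewrite -!(big_mkord xpredT (fun d => x ^+ d / d`!%:R)) (big_cat_nat (n := L)) //=; last exact: ltnW.
rewrite lerD2l.
apply: le_trans (_ : 2^-1 ^+ L * \sum_(0 <= d < N) (2 * x) ^+ d / d`!%:R <= _); last first.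
  by rewrite ler_wpM2l ?exprn_ge0 // big_mkord exp_sum_le // mulr_ge0.
rewrite [\sum_(0 <= d < N) _](big_cat_nat (n := L)) //=; last exact: ltnW.
rewrite mulrDr -[leLHS]add0r lerD //.
  by rewrite mulr_ge0 ?exprn_ge0 // sumr_ge0 // => d _; rewrite divr_ge0 ?exprn_ge0 ?mulr_ge0.
rewrite mulr_sumr !big_nat; apply: ler_sum => d /andP[Ld _].
rewrite exprMn; have -> : 2^-1 ^+ L * (2 ^+ d * x ^+ d / d`!%:R) = (2^-1 ^+ L * 2 ^+ d) * (x ^+ d / d`!%:R) by rewrite !mulrA.
rewrite -[leLHS]mul1r ler_wpM2r //.
by rewrite exprVn mulrC ler_pdivlMr ?exprn_gt0 // mul1r ler_weXn2l // ler1n.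
Unshelve. all: by end_near.
Qed.

Lemma expR_half_le2 : expR (2^-1) <= 2 :> R.
Proof.
have e4 : expR (- 2^-1) >= 2^-1 :> R by apply: le_trans (expR_ge1Dx _); lra.
by rewrite -[2^-1 in X in X <= _]opprK expRN -[leRHS]invrK lef_pV2 ?posrE ?expR_gt0 ?invr_gt0.
Qed.

Lemma expR4_le : expR 4 <= 2 ^+ 8 :> R.
Proof.
have -> : 4 = 2^-1 * 8%:R :> R by lra.
by rewrite expRM_natr ler_pXn2r ?nnegrE ?expR_ge0 // expR_half_le2.
Qed.

Lemma expRN2_le (t : R) : 0 <= t <= 2^-1 -> expR (- (2 * t)) <= 1 - t.
Proof.
move=> /andP[t0 t1]; have h : 0 < 1 - t by lra.
rewrite expRN -[leRHS]invrK lef_pV2 ?posrE ?expR_gt0 ?invr_gt0 //.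
apply: le_trans (expR_ge1Dx _); rewrite -[leLHS]mul1r ler_pdivrMr //; nra.
Qed.

(** An alternating series with decreasing terms stays between its first two partial sums, 1 and 1 -
    b. Even and odd partial sums are carried through the induction together. *)
Lemma altexp_pair (b : R) m : 0 <= b <= 1 ->
  [/\ 1 - b <= \sum_(e < m.*2.+2) (- b) ^+ e / e`!%:R,
      \sum_(e < m.*2.+2) (- b) ^+ e / e`!%:R <= 1,
      1 - b <= \sum_(e < m.*2.+1) (- b) ^+ e / e`!%:R &
      \sum_(e < m.*2.+1) (- b) ^+ e / e`!%:R <= 1].
Proof.
move=> /andP[b0 b1]; set S := fun n => \sum_(e < n) (- b) ^+ e / e`!%:R.
have t0 d : 0 <= b ^+ d / d`!%:R by rewrite divr_ge0 ?exprn_ge0.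
have td d : b ^+ d.+1 / d.+1`!%:R <= b ^+ d / d`!%:R.
  rewrite exprS factS natrM invfM mulrACA ler_piMl //.
  by rewrite ler_pdivrMr ?ltr0n // mul1r (le_trans b1) // ler1n.
have So d : S d.*2.+2 = S d.*2.+1 - b ^+ d.*2.+1 / d.*2.+1`!%:R.
  rewrite /S big_ord_recr /=; congr (_ + _).
  by rewrite exprNn -signr_odd /= odd_double expr1 !mulN1r mulNr.
have Se d : S d.*2.+3 = S d.*2.+2 + b ^+ d.*2.+2 / d.*2.+2`!%:R.
  rewrite /S big_ord_recr /=; congr (_ + _).
  by rewrite exprNn -signr_odd /= odd_double expr0 mul1r.
rewrite -/(S m.*2.+2) -/(S m.*2.+1).
suff [h1 h2] : 1 - b <= S m.*2.+2 /\ S m.*2.+1 <= 1.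
  have := So m; have := t0 m.*2.+1; split => //; lra.
elim: m => [|m [IH1 IH2]].
  by rewrite /S !big_ord_recl !big_ord0 /= !fact0 /bump /= factS fact0 expr0 expr1; split; lra.
rewrite doubleS; have := So m.+1; rewrite doubleS => e1; rewrite e1.
have e2 := Se m; have e3 := So m.
have := td m.*2.+1; have := td m.*2.+2; split; lra.
Qed.

(** With [b = 1 - kk] the alternating sum is the coefficient of L P at p^a, which is thus at least
    kk^a and at most 1. *)
Lemma altexp_bounds (b : R) a : 0 <= b <= 1 ->
  (1 - b) ^+ a <= \sum_(e < a.+1) (- b) ^+ e / e`!%:R <= 1 /\
  ((0 < a)%N -> 1 - b <= \sum_(e < a.+1) (- b) ^+ e / e`!%:R).
Proof.
move=> hb; have [b0 b1] := andP hb.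
have h : 1 - b <= \sum_(e < a.+1) (- b) ^+ e / e`!%:R <= 1.
  rewrite -(odd_double_half a); have [h1 h2 h3 h4] := altexp_pair a./2 hb.
  by case: (odd a); rewrite /= ?add0n ?add1n; apply/andP; split.
have /andP[h1 h2] := h; split; last by [].
rewrite h2 andbT.
case: a {h h2} h1 => [|a] h1.
  by rewrite big_ord_recl big_ord0 /= !expr0 divr1 addr0.
apply: le_trans h1; rewrite exprS ler_piMr ?exprn_ile1 ?subr_ge0 //; lra.
Qed.

End ExpPoly.

Section DirichletPolys.
Context {R : realType} (u v J : nat).
Hypothesis uv : (0 < u < v)%N.

Definition kk : R := u%:R / v%:R.
(* On block [i], [PP] imitates [L^(k-1)] and [AA] imitates [L^(1/v)]; [RR] and
   [WW] correspond to [A^u] and [P A^v]. *)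
Definition lp i : nat := (J + 8 - i)%N.
Definition PP i : {poly R} := Etr (- (1 - kk)) (v * lp i).
Definition AA i : {poly R} := Etr (v%:R^-1) (lp i).
Definition RR i : {poly R} := AA i ^+ u.
Definition WW i : {poly R} := PP i * AA i ^+ v.
(** The degrees allowed by [smallQ] are [2 * v * lp i] and the primes of block i are at most
    2^(2^(i+1)), so [sum_lp] yields the exponent 2 v * 20 * 2^J. *)
Definition ylen : nat := 2 ^ (40 * v * 2 ^ J).

Lemma v_gt0 : (0 < v)%N. Proof. by case/andP: uv => _; apply: leq_trans. Qed.

Lemma kk_bounds : 0 < kk < 1.
Proof.
have v0 := v_gt0; have /andP[u0 uv1] := uv.
by rewrite /kk divr_gt0 ?ltr0n //= ltr_pdivrMr ?ltr0n // mul1r ltr_nat.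
Qed.

Definition smallQ (Q : nat -> {poly R}) :=
  forall i, Q i != 0 /\ (size (Q i) <= (2 * v * lp i).+1)%N.

Lemma PP_small : smallQ PP.
Proof.
move=> i; split; first exact: Etr_neq0.
by apply: leq_trans (size_Etr _ _) _; rewrite ltnS leq_mul2r leq_pmull ?orbT.
Qed.

Lemma RR_size i : (size (RR i) <= (u * lp i).+1)%N.
Proof. exact: size_expn_le (size_Etr _ _). Qed.

Lemma RR_small : smallQ RR.
Proof.
move=> i; split; first by rewrite expf_neq0 // Etr_neq0.
apply: leq_trans (RR_size i) _; rewrite ltnS leq_mul2r.
by case/andP: uv => _ /ltnW h; rewrite (leq_trans h) ?orbT // leq_pmull.
Qed.

Lemma WW_small : smallQ WW.
Proof.
move=> i; split; first by rewrite mulf_neq0 ?expf_neq0 ?Etr_neq0.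
apply: leq_trans (size_polyMleq _ _) _.
have h1 := size_Etr (- (1 - kk)) (v * lp i).
have h2 : (size (AA i ^+ v) <= (v * lp i).+1)%N by apply: size_expn_le; exact: size_Etr.
rewrite -/(PP i) in h1; move: h1 h2; rewrite -mulnA; move: (size _) (size _) (v * lp i)%N => a b c; lia.
Qed.

Lemma RR_expeq i : expeq kk (lp i) (RR i).
Proof. by rewrite /kk mulrC mulr_natr; apply: expeqX; apply: expeq_Etr. Qed.

Lemma RR_ge0 i d : 0 <= (RR i)`_d.
Proof.
rewrite /RR; elim: (u) d => [|m IH] d; first by rewrite expr0 coef1 ler0n.
rewrite exprS coefM; apply: sumr_ge0 => e _; rewrite mulr_ge0 // coef_poly.
by case: ifP => // _; rewrite divr_ge0 ?exprn_ge0 ?invr_ge0.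
Qed.

(** The parameters add up: -(1 - k) + v (1/v) = k. *)
Lemma WW_expeq i : expeq kk (lp i) (WW i).
Proof.
have -> : kk = - (1 - kk) + v%:R^-1 *+ v.
  by rewrite -[v%:R^-1 *+ v]mulr_natr mulVf ?pnatr_eq0 -?lt0n ?v_gt0 //; ring.
apply: expeqM; last by apply: expeqX; apply: expeq_Etr.
by apply: expeq_Etr; rewrite leq_pmull // v_gt0.
Qed.

Lemma WW_dom i d : `|(WW i)`_d| <= 2 ^+ d / d`!%:R.
Proof.
have /andP[k0 k1] := kk_bounds.
have h : expdom ((1 - kk) + v%:R^-1 *+ v) (WW i).
  apply: expdomM.
    have -> : 1 - kk = `|- (1 - kk)| by rewrite normrN ger0_norm // subr_ge0 ltW.
    exact: expdom_Etr.
  apply: expdomX; have -> : v%:R^-1 = `|v%:R^-1| :> R by rewrite ger0_norm // invr_ge0.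
  exact: expdom_Etr.
apply: le_trans (h d) _; rewrite ler_wpM2r ?invr_ge0 //.
rewrite -[v%:R^-1 *+ v]mulr_natr mulVf ?pnatr_eq0 -?lt0n ?v_gt0 //.
by apply: lerXn2r; rewrite ?nnegrE; lra.
Qed.

(** With d = J - i the sum is 2^(J+1) times that of (d + 8)/2^d, which is below 10. Degrees
    decreasing linearly in i thus cost only a constant factor in the length exponent, while
    [sum_lp_geo] shows that the truncation errors remain summable. *)
Lemma sum_lp : (\sum_(i < J) 2 ^ i.+1 * lp i <= 20 * 2 ^ J)%N.
Proof.
rewrite /lp; elim: J => [|m IH]; first by rewrite big_ord0.
rewrite big_ord_recr /=.
have -> : (\sum_(i < m) 2 ^ i.+1 * (m.+1 + 8 - i) =
   \sum_(i < m) 2 ^ i.+1 * (m + 8 - i) + \sum_(i < m) 2 ^ i.+1)%N.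
  rewrite -big_split /=; apply: eq_bigr => i _; have im := ltn_ord i.
  have e : (m.+1 + 8 - i = (m + 8 - i).+1)%N by lia.
  by rewrite e mulnS addnC.
have h : (\sum_(i < m) 2 ^ i.+1 <= 2 ^ m.+1)%N.
  elim: m {IH} => [|m IH]; first by rewrite big_ord0.
  by rewrite big_ord_recr /= [leqRHS]expnS mul2n -addnn leq_add2r.
have -> : (m.+1 + 8 - m = 9)%N by lia.
move: IH h; rewrite !expnS; set a := (\sum_(i < m) _)%N; set b := (\sum_(i < m) _)%N; move: (2 ^ m)%N a b => c a b; lia.
Qed.

Lemma pnat_bl_le (K : nat) (L : nat -> nat) n : (pil (bl blk K)).-nat n ->
  (forall i, (i < K)%N -> (Om (blk i) n <= L i)%N) ->
  (n <= \prod_(i < K) bd i.+1 ^ L i)%N.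
Proof.
elim: K n => [|K IH] n sn hn.
  rewrite big_ord0; have := pnatE (bl_uniq 0) (bl_prime 0) sn.
  by rewrite big_nil => ->.
rewrite big_ord_recr /= -{1}(pil_cat_part (bl_disj (J := K) blk_disj) sn).
apply: leq_mul.
  apply: IH => [|i iK]; first exact: part_pnat.
  rewrite Om_sub_part; last by move=> p; apply: mem_bl.
  by apply: hn; exact: ltnW.
apply: leq_trans (le_Om_expn (blk_uniq K) (blk_prime K) (part_pnat _ _) (B := bd K.+1) _) _.
  by move=> p; rewrite mem_blk => /and3P[].
by rewrite Om_part leq_exp2l ?bd_gt1 // hn.
Qed.

Lemma len_bound n : (pil (bl blk J)).-nat n ->
  (forall i, (i < J)%N -> (Om (blk i) n <= 2 * v * lp i)%N) -> (n <= ylen)%N.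
Proof.
move=> sn hn; apply: leq_trans (pnat_bl_le sn hn) _.
have -> : (\prod_(i < J) bd i.+1 ^ (2 * v * lp i) = 2 ^ (2 * v * \sum_(i < J) 2 ^ i.+1 * lp i))%N.
  rewrite big_distrr /= expn_sum; apply: eq_bigr => i _.
  by rewrite /bd -expnM mulnCA.
rewrite leq_exp2l // -mulnA -[(40 * _ * _)%N]mulnA (_ : 40 = 2 * 20)%N // -!mulnA leq_mul2l /=.
by rewrite mulnCA leq_mul2l sum_lp orbT.
Qed.

(* The coefficient of [n] in [DP Q], see [DP_sum]. *)
Definition cf (Q : nat -> {poly R}) n : R :=
  if (pil (bl blk J)).-nat n then coefB blk Q J n else 0.

Lemma coefB_neq0 (Q : nat -> {poly R}) n i : coefB blk Q J n != 0 -> (i < J)%N ->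
  (Om (blk i) n < size (Q i))%N.
Proof.
move=> /prodf_neq0 h iJ; have := h (Ordinal iJ) isT; rewrite ltnNge /=.
by apply: contraNN => Qo; rewrite nth_default // !mul0r.
Qed.

Lemma cf_supp (Q : nat -> {poly R}) n : smallQ Q -> cf Q n != 0 -> (n <= ylen)%N.
Proof.
rewrite /cf => Qs; case: ifP => [sn c0|_]; last by rewrite eqxx.
apply: len_bound => // i iJ; rewrite -ltnS.
by apply: leq_trans (coefB_neq0 c0 iJ) (proj2 (Qs i)).
Qed.

Lemma cf0 Q : cf Q 0 = 0. Proof. by []. Qed.

Lemma cf_prod (Q : nat -> {poly R}) N (psi : nat -> R) : cmul psi -> smallQ Q -> (ylen < N)%N ->
  \sum_(n < N) cf Q n * psi n = \prod_(i < J) (Q i).[\sum_(p <- blk i) psi p].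
Proof.
move=> hpsi Qs yN; rewrite -(@prod_block R blk blk_prime blk_uniq blk_disj Q J N psi hpsi).
- rewrite [RHS]big_mkcond; apply: eq_bigr => n _; rewrite /cf; case: ifP => // _; exact: mul0r.
- move=> n sn hn; apply: leq_ltn_trans yN; apply: len_bound => // i iJ; rewrite -ltnS.
  by apply: leq_trans (hn i iJ) (proj2 (Qs i)).
- by move=> i; have [] := Qs i.
Qed.

Definition DP (Q : nat -> {poly R}) (psi : nat -> R[i]) : R[i] :=
  \prod_(i < J) (map_poly (real_complex R) (Q i)).[\sum_(p <- blk i) psi p].

Lemma DP_sum (Q : nat -> {poly R}) N psi : cmul psi -> smallQ Q -> (ylen < N)%N ->
  DP Q psi = \sum_(n < N) (cf Q n)%:C * psi n.
Proof.
move=> hpsi Qs yN; rewrite /DP -(@prod_block _ blk blk_prime blk_uniq blk_disj (fun i => map_poly (real_complex R) (Q i)) J N psi hpsi).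
- rewrite big_mkcond; apply: eq_bigr => n _; rewrite /cf; case: ifP => [_|_]; last by rewrite mul0r.
  congr (_ * _); rewrite /coefB rmorph_prod; apply: eq_bigr => i _ /=.
  rewrite coef_map /= !rmorphM /= rmorph_nat; congr (_ * _).
  by rewrite /ka rmorph_prod; apply: eq_bigr => p _; rewrite fmorphV rmorph_nat.
- move=> n sn hn; apply: leq_ltn_trans yN; apply: len_bound => // i iJ; rewrite -ltnS.
  apply: leq_trans (hn i iJ) _; rewrite size_map_poly; exact: proj2 (Qs i).
- by move=> i; rewrite map_poly_eq0; have [] := Qs i.
Qed.

Lemma DP_mul (Q1 Q2 : nat -> {poly R}) psi :
  DP (fun i => Q1 i * Q2 i) psi = DP Q1 psi * DP Q2 psi.
Proof. by rewrite /DP -big_split /=; apply: eq_bigr => i _; rewrite rmorphM hornerM. Qed.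

Lemma DP_exp (Q : nat -> {poly R}) m psi :
  DP (fun i => Q i ^+ m) psi = DP Q psi ^+ m.
Proof. by rewrite /DP -prodrXl; apply: eq_bigr => i _; rewrite rmorphXn horner_exp. Qed.

Lemma cmul_inv : cmul (fun n : nat => n%:R^-1 : R).
Proof. by split=> [|m n]; rewrite ?invr1 // natrM invfM. Qed.

Lemma sum_lp_geo : \sum_(i < J) (2^-1 : R) ^+ lp i <= 2^-1 ^+ 8.
Proof.
rewrite /lp; elim: J => [|m IH]; first by rewrite big_ord0 exprn_ge0.
rewrite big_ord_recr /=.
have -> : \sum_(i < m) (2^-1 : R) ^+ (m.+1 + 8 - i) = 2^-1 * \sum_(i < m) (2^-1 : R) ^+ (m + 8 - i).
  rewrite mulr_sumr; apply: eq_bigr => i _; rewrite -exprS; congr (_ ^+ _).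
  by have := ltn_ord i; lia.
have -> : (m.+1 + 8 - m = 9)%N by lia.
rewrite [2^-1 ^+ 9]exprS; move: IH; set a := \sum_(i < m) _; lra.
Qed.

(** Up to degree [lp i] the factor of block i agrees with the series of exp(k^2 [sB i]); the higher
    degrees are a tail of relative size 2^(-lp i), summable over the blocks. *)
Lemma WW_mean N : (ylen < N)%N ->
  \sum_(n < N) cf WW n ^+ 2 / n%:R <= expR (kk ^+ 2 * sJ J + expR 32).
Proof.
move=> yN; have /andP[k0 k1] := kk_bounds.
(* Squaring the coefficient of n produces [ka] squared. Bounding one factor [ka] by 1 leaves the
   coefficient belonging to this polynomial, so that the sum factors over the blocks again. *)
pose W2 i : {poly R} := \poly_(d < size (WW i)) ((WW i)`_d ^+ 2 * d`!%:R).
have szW i : (0 < size (WW i))%N by rewrite lt0n size_poly_eq0; have [] := WW_small i.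
have W2s : smallQ W2.
  move=> i; split; last by apply: leq_trans (size_poly _ _) _; have [] := WW_small i.
  apply/eqP => /(congr1 (fun p : {poly R} => p`_0)); rewrite coef_poly szW coef0 (@WW_expeq i 0%N) //.
  by rewrite expr0 divr1 expr1n mul1r => /eqP; rewrite oner_eq0.
apply: le_trans (_ : \sum_(n < N) cf W2 n * n%:R^-1 <= _).
  apply: ler_sum => n _; rewrite ler_wpM2r ?invr_ge0 // /cf; case: ifP => _; last by rewrite expr0n.
  rewrite /coefB -prodrXl; apply: ler_prod => i _; rewrite sqr_ge0 /= coef_poly.
  have [lt|ge] := ltnP (Om (blk i) n) (size (WW i)); last first.
    by rewrite nth_default // !mul0r expr0n.
  set a := (WW i)`_ _; set c := ka _ _; set f := _`!%:R.
  have -> : (a * f * c) ^+ 2 = a ^+ 2 * f * f * c ^+ 2 by ring.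
  apply: ler_wpM2l; first by apply: mulr_ge0 => //; apply: mulr_ge0 => //; exact: sqr_ge0.
  by rewrite expr2 ler_piMl ?ka_ge0 ?ka_le1.
rewrite (cf_prod cmul_inv W2s yN).
apply: le_trans (_ : \prod_(i < J) expR (kk ^+ 2 * sB i + 2^-1 ^+ lp i * expR 32) <= _); last first.
  rewrite -expR_sum ler_expR big_split /= -mulr_sumr -mulr_suml lerD2l.
  apply: ler_piMl; first exact: expR_ge0.
  apply: le_trans sum_lp_geo _.
  by apply: exprn_ile1; lra.
apply: ler_prod => i _; rewrite -/(sB i); have s0 := @sB_ge0 R i; have s4 := @sB_le4 R i.
move: (sB i) s0 s4 => s s0 s4; rewrite horner_poly; apply/andP; split.
  by apply: sumr_ge0 => d _; apply: mulr_ge0; [apply: mulr_ge0 => //; exact: sqr_ge0|exact: exprn_ge0].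
have x0 : 0 <= kk ^+ 2 * s by apply: mulr_ge0 => //; exact: sqr_ge0.
have y0 : 0 <= 8 * s :> R by apply: mulr_ge0.
apply: le_trans (_ : \sum_(d < size (WW i)) ((kk ^+ 2 * s) ^+ d / d`!%:R + 2^-1 ^+ lp i * ((8 * s) ^+ d / d`!%:R)) <= _).
  apply: ler_sum => d _.
  have f0 : 0 < d`!%:R :> R by rewrite ltr0n fact_gt0.
  have [dl|ld] := leqP d (lp i).
    rewrite (WW_expeq dl) -[leLHS]addr0 lerD //; last first.
      by apply: mulr_ge0; rewrite ?exprn_ge0 // divr_ge0 ?exprn_ge0 // ltW.
    apply: eqle; rewrite [(kk ^+ 2 * s) ^+ d]exprMn [(kk ^+ 2) ^+ d]exprAC.
    have : d`!%:R != 0 :> R by rewrite gt_eqF.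
    by move: (d`!%:R) (kk ^+ d) (s ^+ d) => a b c a0; field.
  rewrite -[leLHS]add0r lerD //; first by rewrite divr_ge0 ?exprn_ge0 // ltW.
  have h : (WW i)`_d ^+ 2 <= (2 ^+ d / d`!%:R) ^+ 2.
    by rewrite -(real_normK (num_real _)) lerXn2r ?nnegrE ?divr_ge0 ?exprn_ge0 ?WW_dom // ltW.
  apply: le_trans (_ : (2 ^+ d / d`!%:R) ^+ 2 * d`!%:R * s ^+ d <= _).
    by rewrite ler_wpM2r ?exprn_ge0 // ler_wpM2r // ltW.
  (* Rankin's trick beyond degree [lp i]: 4 = 8/2, and 2^(-d) is at most 2^(-lp i). *)
  have -> : (2 ^+ d / d`!%:R) ^+ 2 * d`!%:R * s ^+ d = 2^-1 ^+ d * ((8 * s) ^+ d / d`!%:R).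
    have -> : 8 * s = 2 * 2 * 2 * s by ring.
    rewrite !exprMn exprVn.
    have : d`!%:R != 0 :> R by rewrite gt_eqF.
    have : (2 : R) ^+ d != 0 by rewrite expf_neq0.
    move: (2 ^+ d) (d`!%:R) (s ^+ d) => a b c a0 b0.
    by field; rewrite a0 b0.
  rewrite ler_wpM2r //; first by rewrite divr_ge0 ?exprn_ge0 // ltW.
  by apply: ler_wiXn2l; [by []|by lra|exact: ltnW].
rewrite big_split /= -mulr_sumr expRD.
have h1 := @exp_sum_le R (kk ^+ 2 * s) (size (WW i)) x0.
have h2 := @exp_sum_le R (8 * s) (size (WW i)) y0.
have h3 : expR (8 * s) <= expR 32 by rewrite ler_expR; lra.
have e1 : 1 <= expR (kk ^+ 2 * s) by rewrite -expR0 ler_expR.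
have g0 : 0 <= (2^-1 : R) ^+ lp i by rewrite exprn_ge0.
apply: le_trans (_ : expR (kk ^+ 2 * s) * (1 + 2^-1 ^+ lp i * expR 32) <= _); last first.
  by rewrite ler_wpM2l ?expR_ge0 // expR_ge1Dx.
rewrite mulrDr mulr1 lerD // mulrA [expR _ * _]mulrC -mulrA ler_wpM2l //.
apply: le_trans (le_trans h2 h3) _; by rewrite ler_peMl ?expR_ge0.
Qed.

Definition gg N n : R := \sum_(m < N | (m %| n)%N) cf PP m.

Lemma coefB_exp (c : R) (L : nat -> nat) n : (forall i, (i < J)%N -> (Om (blk i) n <= L i)%N) ->
  coefB blk (fun i => Etr c (L i)) J n = \prod_(p <- bl blk J) (c ^+ logn p n / (logn p n)`!%:R).
Proof.
move=> hn.
have -> : \prod_(p <- bl blk J) (c ^+ logn p n / (logn p n)`!%:R) =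
   \prod_(i < J) \prod_(p <- blk i) (c ^+ logn p n / (logn p n)`!%:R).
  elim: J {hn} => [|K IH]; first by rewrite big_nil big_ord0.
  by rewrite /= big_cat /= IH big_ord_recr.
apply: eq_bigr => i _; rewrite coef_poly ltnS hn // divfK ?pnatr_eq0 -?lt0n ?fact_gt0 //.
by rewrite big_split /= /ka prodrXr.
Qed.

(** At such n no divisor reaches the truncation of [PP], so the divisor sum is a full product over
    primes, bounded below by [altexp_bounds]. The support of [RR] satisfies the condition because u
    < v: this is why [PP] has degree [v * lp i]. *)
Lemma gg_lower N n : (0 < n < N)%N -> (pil (bl blk J)).-nat n ->
  (forall i, (i < J)%N -> (Om (blk i) n <= v * lp i)%N) ->
  kk ^+ Om (bl blk J) n <= gg N n.
Proof.
move=> n0N sn hn; have /andP[n0 nN] := n0N; have /andP[k0 k1] := kk_bounds.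
have -> : gg N n = \sum_(m < N | (pil (bl blk J)).-nat m && (m %| n)%N)
    \prod_(p <- bl blk J) ((- (1 - kk)) ^+ logn p m / (logn p m)`!%:R).
  rewrite /gg big_mkcond [RHS]big_mkcond; apply: eq_bigr => m _.
  rewrite andbC; case: ifP => //= mn; rewrite /cf; case: ifP => // sm.
  apply: coefB_exp => i iJ; apply: leq_trans (hn i iJ).
  by apply: leq_sum => p _; apply: dvdn_leq_log.
rewrite (divisor_sum_prod (fun _ e => (- (1 - kk)) ^+ e / e`!%:R) (bl_prime J) (bl_uniq J) n0N).
rewrite /Om -prodrXr; apply: ler_prod => p _.
apply/andP; split; first by rewrite exprn_ge0 // ltW.
have [] := altexp_bounds (b := 1 - kk) (logn p n); first by lra.
by move=> /andP[h _] _; apply: le_trans h; rewrite opprB addrCA subrr addr0.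
Qed.

Lemma cmul_kO : cmul (fun n : nat => kk ^+ Om (bl blk J) n / n%:R : R).
Proof.
split=> [|m n]; first by rewrite /Om big1 ?expr0 ?divr1 // => p _; rewrite logn1.
case: m => [|m]; first by rewrite mul0n invr0 !mulr0 mul0r.
case: n => [|n]; first by rewrite muln0 invr0 !mulr0.
rewrite natrM invfM mulrACA; congr (_ * _); rewrite -exprD; congr (_ ^+ _).
by rewrite /Om -big_split; apply: eq_bigr => p _; rewrite lognM.
Qed.

(** Once [gg] is replaced by its completely multiplicative lower bound, the sum factors into the
    values of [RR i] at [kk * sB i], which are close to exp(k^2 [sB i]). The 2 is the total loss
    from the truncations. *)
Lemma main_lower N : (ylen < N)%N ->
  expR (kk ^+ 2 * sJ J - 2) <= \sum_(n < N) gg N n * cf RR n / n%:R.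
Proof.
move=> yN; have /andP[k0 k1] := kk_bounds.
apply: le_trans (_ : \sum_(n < N) cf RR n * (kk ^+ Om (bl blk J) n / n%:R) <= _); last first.
  apply: ler_sum => n _; rewrite mulrCA mulrA ler_wpM2r ?invr_ge0 //.
  have [->|c0] := eqVneq (cf RR n) 0; first by rewrite !mulr0.
  have cge : 0 <= cf RR n.
    rewrite /cf; case: ifP => // _; apply: prodr_ge0 => i _.
    by rewrite !mulr_ge0 ?RR_ge0 ?ka_ge0.
  rewrite ler_wpM2r //; move: c0; rewrite /cf; case: ifP => [sn c0|_]; last by rewrite eqxx.
  apply: gg_lower => //; first by rewrite (pnat_gt0 sn) ltn_ord.
  move=> i iJ; rewrite -ltnS; apply: leq_trans (coefB_neq0 c0 iJ) _.
  apply: leq_trans (RR_size i) _; rewrite ltnS leq_mul2r.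
  by case/andP: uv => _ /ltnW ->; rewrite orbT.
rewrite (cf_prod cmul_kO RR_small yN).
apply: le_trans (_ : \prod_(i < J) expR (kk ^+ 2 * sB i - 2 * (2^-1 ^+ lp i * 2 ^+ 8)) <= _).
  rewrite -expR_sum ler_expR sumrB -mulr_sumr lerD2l lerN2 -mulr_sumr -mulr_suml.
  have h := sum_lp_geo; rewrite -[leRHS]mulr1 ler_wpM2l //.
  apply: le_trans (_ : 2^-1 ^+ 8 * 2 ^+ 8 <= _); first by rewrite ler_wpM2r ?exprn_ge0.
  by rewrite -exprMn mulVf // expr1n.
apply: ler_prod => i _; rewrite expR_ge0 /=.
have -> : \sum_(p <- blk i) kk ^+ Om (bl blk J) p / p%:R = kk * sB i.
  rewrite mulr_sumr big_seq [RHS]big_seq; apply: eq_bigr => p pI; congr (_ * _).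
  have pJ : p \in bl blk J by apply: mem_bl pI.
  have pp : prime p by move/allP: (blk_prime i) => /(_ p pI).
  rewrite /Om (bigD1_seq p) ?bl_uniq //= logn_prime // eqxx big1_seq ?addn0 ?expr1 //.
  by move=> r /andP[rp _]; rewrite logn_prime // (negPf rp).
have s0 := @sB_ge0 R i; have s4 := @sB_le4 R i.
set x := kk ^+ 2 * sB i; have x0 : 0 <= x by rewrite mulr_ge0 ?sqr_ge0.
have x4 : x <= 4.
  by apply: le_trans s4; rewrite ler_piMl // exprn_ile1 // ltW.
apply: le_trans (_ : expR x - 2^-1 ^+ (lp i).+1 * expR (2 * x) <= _); last first.
  apply: le_trans (exp_tail_le _ x0) _.
  have szR : ((lp i).+1 <= size (RR i))%N.
    rewrite ltnNge; apply/negP => h; have := RR_expeq (leqnn (lp i)).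
    rewrite nth_default // => /esym/eqP; rewrite mulf_eq0 invr_eq0 pnatr_eq0.
    by rewrite -[_ == 0%N]negbK -lt0n fact_gt0 orbF expf_eq0 gt_eqF ?andbF.
  rewrite horner_coef -!(big_mkord xpredT (fun d => x ^+ d / d`!%:R)) -(big_mkord xpredT (fun d => (RR i)`_d * (kk * sB i) ^+ d)).
  rewrite [leRHS](big_cat_nat (n := (lp i).+1)) //= -[leLHS]addr0 lerD //; last first.
    by apply: sumr_ge0 => d _; rewrite mulr_ge0 ?RR_ge0 ?exprn_ge0 ?mulr_ge0 // ltW.
  rewrite !big_nat; apply: ler_sum => d /andP[_ dl]; rewrite RR_expeq //.
  by apply: eqle; rewrite /x [(kk ^+ 2 * sB i) ^+ d]exprMn [(kk * sB i) ^+ d]exprMn [(kk ^+ 2) ^+ d]exprAC; move: (kk ^+ d) (sB i ^+ d) (d`!%:R) => a b c; ring.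
(* 2^8 bounds exp(x), as x <= 4. The 8 in [lp], together with i < J, makes [t <= 1/2], as
   [expRN2_le] requires. *)
set t := 2^-1 ^+ lp i * 2 ^+ 8.
have iJ := ltn_ord i.
have t1 : t <= 2^-1.
  rewrite /t; have -> : lp i = (8 + (J - i))%N by rewrite /lp; lia.
  rewrite exprD mulrAC -exprMn mulVf // expr1n mul1r.
  have -> : (J - i = (J - i).-1.+1)%N by lia.
  by rewrite exprS ler_piMr // exprn_ile1 //; lra.
have t0 : 0 <= t by rewrite mulr_ge0 ?exprn_ge0.
have := @expRN2_le R t; rewrite t0 t1 => /(_ isT) h.
apply: le_trans (_ : expR x * (1 - t) <= _); first by rewrite expRD ler_wpM2l ?expR_ge0.
have -> : expR (2 * x) = expR x * expR x by rewrite mulr_natl mulr2n expRD.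
have ex4 : expR x <= 2 ^+ 8 by apply: le_trans expR4_le; rewrite ler_expR.
rewrite mulrBr mulr1 lerD2l lerN2 mulrCA ler_wpM2l ?expR_ge0 // /t.
rewrite exprS -mulrA; apply: le_trans (_ : 2^-1 ^+ lp i * expR x <= _).
  apply: ler_piMl; last by lra.
  by rewrite mulr_ge0 ?expR_ge0 ?exprn_ge0.
by rewrite ler_wpM2l ?exprn_ge0.
Qed.

End DirichletPolys.

(** * The moments of L P A^u and P A^v *)

Section FirstMoment.
Context {R : realType} (q : nat) (q_pr : prime q).
Local Notation F := 'F_q.
Local Notation X := (@X R q q_pr).

Let q0 : (0 < q)%N. Proof. exact: prime_gt0. Qed.

Lemma val_F (n : nat) : (n < q)%N -> (n%:R : F) = n :> nat.
Proof. by move=> nq; rewrite val_Fp_nat // modn_small. Qed.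

Lemma ltF (x : F) : (x < q)%N.
Proof. by have [n nq ->] := F_nat q_pr x; rewrite val_F. Qed.

Lemma X1 j : X j 1 = 1.
Proof.
have h : X j 1 != 0 by rewrite X_neq0 oner_neq0.
by apply: (mulfI h); rewrite -XM !mulr1.
Qed.

Definition psi (j n : nat) : R[i] := (isq n)%:C * X j n%:R.

Lemma cmul_psi j : cmul (psi j).
Proof.
split=> [|m n]; first by rewrite /psi isq1 X1 mulr1.
by rewrite /psi isqM natrM XM C_M mulrACA.
Qed.

(** An exact identity: integers below [q] are distinct residues, so orthogonality leaves only the
    diagonal. *)
Lemma mean_value (b : nat -> R[i]) N : (N <= q)%N -> b 0%N = 0 ->
  \sum_(j < q.-1) nm (\sum_(n < N) b n * X j n%:R) ^+ 2 =
  q.-1%:R * \sum_(n < N) nm (b n) ^+ 2.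
Proof.
move=> Nq b0; pose g n := if (n < N)%N then b n else 0.
have hN (V : nmodType) (h : nat -> V) : (forall n, (N <= n)%N -> h n = 0) ->
    \sum_(n < N) h n = \sum_(n < q) h n.
  move=> h0; rewrite -!(big_mkord xpredT h) [RHS](big_cat_nat (n := N)) //=.
  by rewrite [X in _ + X]big_nat [X in _ + X]big1 ?addr0 // => i /andP[/h0].
have gN n : (N <= n)%N -> g n = 0 by move=> Nn; rewrite /g ltnNge Nn.
have := X_parseval q_pr (fun x : F => g x).
have e2 : \sum_(x : F | x != 0) nm (g x) ^+ 2 = \sum_(n < N) nm (b n) ^+ 2.
  transitivity (\sum_(n < q) nm (g n) ^+ 2).
    rewrite big_mkcond /= -(sumFq q_pr); apply: eq_bigr => i _.
    rewrite natF_eq0 // val_F //; case: ifP => // /negbFE qi.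
    suff -> : (i : nat) = 0%N by rewrite /g b0 if_same nm0 expr0n.
    apply/eqP; rewrite -leqn0 leqNgt; apply/negP => i0.
    by have := dvdn_leq i0 qi; rewrite leqNgt ltn_ord.
  rewrite -(hN _ (fun n => nm (g n) ^+ 2)); last by move=> n /gN ->; rewrite nm0 expr0n.
  by apply: eq_bigr => n _; rewrite /g ltn_ord.
rewrite e2 => <-; apply: eq_bigr => j _; congr (nm _ ^+ 2).
transitivity (\sum_(n < q) g n * X j n%:R).
  rewrite -(hN _ (fun n => g n * X j n%:R)); last by move=> n /gN ->; rewrite mul0r.
  by apply: eq_bigr => n _; rewrite /g ltn_ord.
transitivity (\sum_(n < q) (fun x : F => g x * X j x) n%:R).
  by apply: eq_bigr => n _; rewrite val_F.
by rewrite (sumFq q_pr (fun x : F => g x * X j x)) (bigD1 (0 : F)) //= X0 mulr0 add0r.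
Qed.

(* The weight of a residue class in [SL]. Subtracting the constant [T1 M] does
   not change the sum over a non-principal character, and leaves
   [a^(-1/2) + O(q^(-1/2))]. *)
Definition class_sum (M a : nat) : R := \sum_(b < M) isq (q * b + a).
Definition T1 (M : nat) : R := \sum_(1 <= b < M) isq (q * b).

Lemma sum_blocks (V : nmodType) (f : nat -> V) M :
  \sum_(0 <= n < q * M) f n = \sum_(b < M) \sum_(a < q) f (q * b + a)%N.
Proof.
elim: M => [|M IH]; first by rewrite muln0 big_geq // big_ord0.
rewrite mulnS addnC (big_cat_nat (n := (q * M)%N)) ?leq_addr //= IH big_ord_recr /=; congr (_ + _).
rewrite -{1}[(q * M)%N]add0n big_addn addKn big_mkord.
by apply: eq_bigr => i _; rewrite addnC.
Qed.

Lemma SL_class_sum j M : (0 < M)%N ->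
  SL q_pr j (q * M) = \sum_(a < q) (class_sum M a)%:C * X j a%:R.
Proof.
move=> M0; transitivity (\sum_(0 <= n < q * M) (isq n)%:C * X j n%:R).
  by rewrite [RHS]big_ltn ?muln_gt0 ?q0 // isq0 mul0r add0r.
rewrite sum_blocks exchange_big /=; apply: eq_bigr => a _.
rewrite /class_sum C_sum mulr_suml; apply: eq_bigr => b _.
have qF : q%:R = 0 :> F by apply/eqP; rewrite natF_eq0.
by rewrite natrD natrM qF mul0r add0r.
Qed.

(** For b > 0 the point [q * b + a] lies between [q * b] and [q * b.+1], so the differences are
    dominated by a telescoping sum. *)
Lemma class_sum_bound M a : (0 < M)%N -> (0 < a < q)%N ->
  `|class_sum M a - T1 M - isq a| <= isq q.
Proof.
case: M => // M _ /andP[a0 aq].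
rewrite /class_sum big_ord_recl muln0 add0n /T1 big_add1 /= big_mkord.
have -> : isq a + \sum_(i < M) isq (q * bump 0 i + a) - \sum_(i < M) isq (q * i.+1) - isq a =
   - \sum_(i < M) (isq (q * i.+1) - isq (q * i.+1 + a)) :> R.
  rewrite sumrB /bump /=; under eq_bigr => i _ do rewrite add1n.
  by ring.
rewrite normrN ger0_norm; last first.
  by apply: sumr_ge0 => i _; rewrite subr_ge0 isq_le ?leq_addr // muln_gt0 q0.
suff : \sum_(i < M) (isq (q * i.+1) - isq (q * i.+1 + a)) <= isq q - isq (q * M.+1) :> R.
  by move=> h; apply: le_trans h _; rewrite gerBl isq_ge0.
elim: M => [|M IH]; first by rewrite big_ord0 muln1 subrr.
rewrite big_ord_recr /=; apply: le_trans (lerD IH (lexx _)) _.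
rewrite addrA addrNK lerD2l lerN2 isq_le ?ltn_addl //.
by rewrite [(q * M.+2)%N]mulnS addnC leq_add2r ltnW.
Qed.

Lemma isq_sub (a : nat) : isq a.+1 <= 2 * (Num.sqrt a.+1%:R - Num.sqrt a%:R) :> R.
Proof.
set x := Num.sqrt a.+1%:R; set y := Num.sqrt a%:R.
have x0 : 0 < x by rewrite sqrtr_gt0 ltr0n.
have y0 : 0 <= y by rewrite sqrtr_ge0.
have x2 : x ^+ 2 = a%:R + 1 by rewrite sqr_sqrtr // natr1.
have y2 : y ^+ 2 = a%:R by rewrite sqr_sqrtr.
rewrite /isq -/x -[leLHS]mul1r ler_pdivrMr //; nra.
Qed.

Lemma sum_isq_le N : \sum_(a < N) isq a <= 2 * Num.sqrt N%:R :> R.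
Proof.
apply: le_trans (_ : \sum_(a < N.+1) isq a <= _).
  by rewrite big_ord_recr /= lerDl isq_ge0.
rewrite big_ord_recl isq0 add0r; elim: N => [|N IH]; first by rewrite big_ord0 mulr_ge0 ?sqrtr_ge0.
rewrite big_ord_recr /=; apply: le_trans (lerD IH (isq_sub N)) _.
by apply: eqle; rewrite /bump /=; ring.
Qed.

Section WithPolys.
Variables (u v J : nat).
Hypothesis uv : (0 < u < v)%N.
Hypothesis yq : (ylen v J < q)%N.
Local Notation y := (ylen v J).
Local Notation PP := (PP u v J : nat -> {poly R}).
Local Notation RR := (RR u v J : nat -> {poly R}).
Local Notation AA := (AA v J : nat -> {poly R}).
Local Notation WW := (WW u v J : nat -> {poly R}).
Local Notation cf := (cf J).
Local Notation DP := (DP J).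

Lemma cf_le1 (Q : nat -> {poly R}) n : (forall i d, `|(Q i)`_d| <= 1 / d`!%:R) -> `|cf Q n| <= 1.
Proof.
move=> hQ; rewrite /cf; case: ifP => _; last by rewrite normr0.
rewrite /coefB normr_prod; apply: prodr_ile1 => i _; rewrite normr_ge0 /=.
rewrite !normrM; have f0 : 0 < (Om (blk i) n)`!%:R :> R by rewrite ltr0n fact_gt0.
apply: mulr_ile1; rewrite ?mulr_ge0 //; last by rewrite ger0_norm ?ka_ge0 ?ka_le1.
by rewrite (ger0_norm (ltW f0)) -ler_pdivlMr // hQ.
Qed.

Lemma cf_PP_le1 n : `|cf PP n| <= 1.
Proof.
apply: cf_le1 => i d; have /andP[k0 k1] := @kk_bounds R _ _ uv.
apply: le_trans (expdom_Etr _ _ _) _; rewrite ler_wpM2r ?invr_ge0 //.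
have h : 0 <= 1 - kk u v :> R by lra.
by rewrite normrN ger0_norm //; apply: exprn_ile1 => //; lra.
Qed.

Lemma cf_RR_le1 n : `|cf RR n| <= 1.
Proof.
apply: cf_le1 => i d; have /andP[k0 k1] := @kk_bounds R _ _ uv.
have h : expdom (v%:R^-1 *+ u) (RR i).
  by apply: expdomX => e; have := expdom_Etr (v%:R^-1 : R) (lp J i) e; rewrite [X in X ^+ e]ger0_norm ?invr_ge0.
apply: le_trans (h d) _; rewrite ler_wpM2r ?invr_ge0 //.
rewrite -[_ *+ u]mulr_natr mulrC -/(kk u v).
by rewrite exprn_ile1 // ltW.
Qed.

Lemma third_moment : \sum_(j < q.-1) nm (DP PP (psi j) * DP AA (psi j) ^+ v) ^+ 2 <=
  q.-1%:R * expR (kk u v ^+ 2 * sJ J + expR 32).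
Proof.
have e j : DP PP (psi j) * DP AA (psi j) ^+ v = \sum_(n < q) ((cf WW n)%:C * (isq n)%:C) * X j n%:R.
  rewrite -DP_exp -DP_mul -/WW (DP_sum uv (cmul_psi j) (WW_small J uv) yq).
  by apply: eq_bigr => n _; rewrite /psi mulrA.
under eq_bigr => j _ do rewrite e.
rewrite (mean_value (b := fun n => (cf WW n)%:C * (isq n)%:C)) //; last by rewrite isq0 mulr0.
rewrite ler_wpM2l //; apply: le_trans (WW_mean uv yq); apply: eqle; apply: eq_bigr => n _.
by rewrite -C_M nmC real_normK ?num_real // exprMn sqr_isq.
Qed.

Lemma DP_le_len (Q : nat -> {poly R}) j : smallQ v J Q -> (forall n, `|cf Q n| <= 1) ->
  nm (DP Q (psi j)) <= y%:R.
Proof.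
move=> Qs Q1; rewrite (DP_sum uv (cmul_psi j) Qs (ltnSn y)).
apply: le_trans (nm_sum _ _ _) _.
rewrite big_ord_recl /= cf0 mul0r nm0 add0r.
apply: le_trans (_ : \sum_(i < y) 1 <= _); last by rewrite sumr_const card_ord.
apply: ler_sum => i _; rewrite nmM nmC /psi nmM nmC.
apply: mulr_ile1 => //; first by rewrite mulr_ge0 ?nm_ge0.
apply: mulr_ile1; rewrite ?nm_ge0 ?nmX_le1 //.
by rewrite ger0_norm ?isq_ge0 ?isq_le1.
Qed.

Definition t0 M (a : nat) : R := class_sum M a - T1 M.

(** If m divides l, the residue l/m is represented by the integer l/m. Otherwise its representative
    a satisfies a m = l modulo q but not as integers, so a m >= q and [isq m * isq a <= isq q]. *)
Lemma t0_ratio M m l : (0 < M)%N -> (0 < m <= y)%N -> (0 < l <= y)%N ->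
  `|isq m * (t0 M (l%:R / m%:R : F) - if (m %| l)%N then isq (l %/ m) else 0)| <= 2 * isq q.
Proof.
move=> M0 /andP[m0 my] /andP[l0 ly].
have mq : (m < q)%N by apply: leq_ltn_trans yq.
have lq : (l < q)%N by apply: leq_ltn_trans yq.
have nzF n : (0 < n < q)%N -> n%:R != 0 :> F.
  by move=> /andP[n0 nq]; rewrite natF_eq0 //; apply/negP => /(dvdn_leq n0); rewrite leqNgt nq.
have mF : m%:R != 0 :> F by rewrite nzF ?m0.
have lF : l%:R != 0 :> F by rewrite nzF ?l0.
pose a := nat_of_ord (l%:R / m%:R : F).
have aq : (a < q)%N by exact: ltF.
have aF : a%:R = l%:R / m%:R :> F by rewrite natr_Zp.
have a0 : (0 < a)%N.
  rewrite lt0n; apply/eqP => a0; have := mulf_neq0 lF (invr_neq0 mF).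
  by rewrite -aF a0 eqxx.
have tb : `|t0 M a - isq a| <= isq q by rewrite /t0 class_sum_bound ?a0.
have isqm : `|isq m : R| = isq m by rewrite ger0_norm ?isq_ge0.
rewrite -/a normrM isqm.
have mod_e : a * m = l %[mod q].
  apply/eqP; rewrite -(val_Fp_nat q_pr) -[X in _ == X](val_Fp_nat q_pr); apply/eqP; congr (nat_of_ord _).
  by rewrite natrM aF divfK.
case: ifP => [ml|nml].
  have -> : (l %/ m)%N = a.
    have : l %/ m = a %[mod q].
      apply/eqP; rewrite -(val_Fp_nat q_pr) -[X in _ == X](val_Fp_nat q_pr); apply/eqP; congr (nat_of_ord _).
      by rewrite aF -{2}(divnK ml) natrM mulfK.
    by rewrite !modn_small // (leq_ltn_trans (leq_div _ _)).
  apply: le_trans (_ : 1 * isq q <= _); last by rewrite ler_wpM2r ?isq_ge0 //; lra.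
  by apply: ler_pM => //; rewrite ?isq_ge0 ?isq_le1.
rewrite subr0.
have amq : (q <= a * m)%N.
  rewrite leqNgt; apply/negP => h; move: mod_e; rewrite !modn_small // => e.
  by rewrite -e dvdn_mull in nml.
have am : isq m * isq a <= isq q :> R by rewrite mulrC -isqM isq_le.
have iq0 := isq_ge0 (R := R) q; have im0 := isq_ge0 (R := R) m.
have im1 := isq_le1 (R := R) m; have ia0 := isq_ge0 (R := R) a.
have : `|t0 M a| <= isq q + isq a.
  have -> : t0 M a = (t0 M a - isq a) + isq a by ring.
  by apply: le_trans (ler_normD _ _) _; rewrite lerD // ger0_norm.
move: (isq m) (isq q) (isq a) (`|t0 M a|) im0 im1 ia0 iq0 am => im iq ia t; nra.
Qed.

(** Controls the principal character, which orthogonality forces into the first moment. *)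
Lemma t0_sum M : (0 < M)%N -> \sum_(1 <= a < q) `|t0 M a| <= 3 * Num.sqrt q%:R.
Proof.
move=> M0; apply: le_trans (_ : \sum_(1 <= a < q) (isq a + isq q) <= _).
  rewrite !big_nat; apply: ler_sum => a /andP[a0 aq].
  have -> : t0 M a = (t0 M a - isq a) + isq a by ring.
  apply: le_trans (ler_normD _ _) _; rewrite addrC lerD //; first by rewrite ger0_norm ?isq_ge0.
  by rewrite /t0 class_sum_bound // a0.
rewrite big_split /= (_ : 3 * Num.sqrt q%:R = 2 * Num.sqrt q%:R + Num.sqrt q%:R); last by ring.
apply: lerD.
  apply: le_trans (sum_isq_le q); rewrite -(big_mkord xpredT isq) [leRHS]big_ltn //.
  by rewrite isq0 add0r.
rewrite sumr_const_nat -[isq q *+ _]mulr_natr.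
have s0 : 0 < Num.sqrt q%:R :> R by rewrite sqrtr_gt0 ltr0n.
apply: le_trans (_ : isq q * q%:R <= _).
  by rewrite ler_wpM2l ?isq_ge0 // ler_nat leq_subr.
have sq : Num.sqrt q%:R ^+ 2 = q%:R :> R by rewrite sqr_sqrtr.
apply: eqle; rewrite /isq -[X in _ * X]sq; field.
by rewrite gt_eqF.
Qed.

Lemma bilinear_sum (f : F -> R[i]) (b c : nat -> R[i]) :
  b 0%N = 0 -> c 0%N = 0 -> 
  \sum_(j < q.-1) (\sum_(x : F | x != 0) f x * X j x) * (\sum_(m < q) b m * X j m%:R) *
     conjc (\sum_(l < q) c l * X j l%:R) =
  q.-1%:R * \sum_(l < q | (0 < l)%N) \sum_(m < q | (0 < m)%N) b m * conjc (c l) * f (l%:R / m%:R).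
Proof.
move=> b0 c0.
have nzF n : (n < q)%N -> (n%:R != 0 :> F) = (0 < n)%N.
  move=> nq; rewrite natF_eq0 //; case: n nq => [|n] nq; first by rewrite dvdn0.
  by apply/negP => /(dvdn_leq (ltn0Sn n)); rewrite leqNgt nq.
have pos (g : nat -> R[i]) : g 0%N = 0 -> \sum_(n < q) g n = \sum_(n < q | (0 < n)%N) g n.
  move=> g0; rewrite [RHS]big_mkcond; apply: eq_bigr => n _.
  by case: (val n) => // /=; rewrite g0.
transitivity (\sum_(j < q.-1) \sum_(l < q | (0 < l)%N) \sum_(m < q | (0 < m)%N)
    \sum_(x : F | x != 0) b m * conjc (c l) * f x * (X j (x * m%:R) * conjc (X j l%:R))).
  apply: eq_bigr => j _; rewrite (pos (fun m => b m * X j m%:R)) ?b0 ?mul0r //.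
  rewrite (pos (fun l => c l * X j l%:R)) ?c0 ?mul0r // conj_sum mulr_sumr; apply: eq_bigr => l _.
  rewrite mulrAC [_ * (\sum_(m < q | _) _)]mulr_sumr; apply: eq_bigr => m _.
  rewrite !mulr_suml; apply: eq_bigr => x _.
  rewrite conj_M XM; ring.
rewrite exchange_big mulr_sumr; apply: eq_bigr => l l0.
rewrite exchange_big mulr_sumr; apply: eq_bigr => m m0.
rewrite exchange_big /= (bigD1 (l%:R / m%:R)) /=; last first.
  by rewrite mulf_neq0 ?invr_neq0 ?nzF.
rewrite [X in _ + X]big1 ?addr0.
  rewrite -mulr_sumr divfK ?nzF // X_orth ?nzF // eqxx; ring.
move=> x /andP[x0 xlm]; rewrite -mulr_sumr X_orth ?mulf_neq0 ?nzF //.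
rewrite ifN ?mulr0 //; apply: contraNneq xlm => <-.
by rewrite mulfK // nzF.
Qed.

Lemma first_moment M : (0 < M)%N ->
  q.-1%:R * (expR (kk u v ^+ 2 * sJ J - 2) - 2 * y%:R ^+ 2 * isq q) - 3 * y%:R ^+ 2 * Num.sqrt q%:R <=
  \sum_(j < q.-1 | (0 < j)%N) nm (SL q_pr j (q * M)) * nm (DP PP (psi j)) * nm (DP AA (psi j)) ^+ u.
Proof.
move=> M0; have q10 := q1_gt0 q_pr.
(* [G] coincides with the partial sum of L for non-principal characters and also makes sense at j =
   0, so that orthogonality over all characters applies. *)
pose G (j : nat) : R[i] := \sum_(x : F | x != 0) (t0 M x)%:C * X j x.
have GSL j : (0 < j < q.-1)%N -> G j = SL q_pr j (q * M).
  move=> jq; rewrite SL_class_sum // (eq_bigr (fun a : 'I_q => (fun x : F => (class_sum M x)%:C * X j x) a%:R)); last first.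
    by move=> a _; rewrite val_F.
  rewrite (sumFq q_pr (fun x : F => (class_sum M x)%:C * X j x)) (bigD1 (0 : F)) //= X0 mulr0 add0r.
  have e0 : \sum_(x : F | x != 0) (T1 M)%:C * X j x = 0.
    by rewrite -mulr_sumr [X in _ * X](X_sum0 q_pr jq) mulr0.
  rewrite /G -[LHS]addr0 -[X in _ + X]e0 -big_split /=.
  by apply: eq_bigr => x _ /=; rewrite -mulrDl /t0 rmorphB /= addrNK.
pose T j := G j * DP PP (psi j) * conjc (DP RR (psi j)).
have nT j : nm (T j) = nm (G j) * nm (DP PP (psi j)) * nm (DP AA (psi j)) ^+ u.
  by rewrite /T !nmM nmJ -nm_exp -DP_exp.
have hT : nm (\sum_(j < q.-1) T j) <= 3 * y%:R ^+ 2 * Num.sqrt q%:R +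
   \sum_(j < q.-1 | (0 < j)%N) nm (SL q_pr j (q * M)) * nm (DP PP (psi j)) * nm (DP AA (psi j)) ^+ u.
  apply: le_trans (nm_sum _ _ _) _; rewrite (bigD1 (Ordinal q10)) //=; apply: lerD.
    rewrite /T !nmM nmJ.
    have h1 := DP_le_len 0 (PP_small u v J) cf_PP_le1.
    have h2 := DP_le_len 0 (RR_small J uv) cf_RR_le1.
    have h3 : nm (G 0%N) <= 3 * Num.sqrt q%:R.
      apply: le_trans (t0_sum M0); apply: le_trans (nm_sum _ _ _) _.
      apply: le_trans (_ : \sum_(x : F | x != 0) `|t0 M x| <= _).
        by apply: ler_sum => x x0; rewrite nmM X01 // nm1 mulr1 nmC.
      rewrite big_mkcond /= -(sumFq q_pr (fun x : F => if x != 0 then `|t0 M x| else 0)).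
      rewrite -(big_mkord xpredT (fun i => if (i%:R : F) != 0 then `|t0 M (i%:R : F)| else 0)).
      rewrite big_ltn // eqxx add0r !big_nat; apply: ler_sum => i /andP[_ iq].
      by rewrite val_F //; case: ifP.
    have -> : 3 * y%:R ^+ 2 * Num.sqrt q%:R = 3 * Num.sqrt q%:R * y%:R * y%:R :> R by ring.
    by rewrite ler_pM ?mulr_ge0 ?nm_ge0 // ler_pM ?nm_ge0.
  apply: eqle; apply: eq_big => [j|j j0]; first by rewrite -lt0n.
  by rewrite nT GSL // lt0n j0 ltn_ord.
rewrite lerBlDl; apply: le_trans hT.
pose p m : R := cf PP m * isq m.
pose r l : R := cf RR l * isq l.
have eT : \sum_(j < q.-1) T j = (q.-1%:R * \sum_(l < q | (0 < l)%N) \sum_(m < q | (0 < m)%N)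
     p m * r l * t0 M (l%:R / m%:R : F))%:C.
  have := bilinear_sum (fun x => (t0 M x)%:C) (b := fun m => (p m)%:C) (c := fun m => (r m)%:C).
  rewrite /p /r isq0 !mulr0 => /(_ erefl erefl) h.
  transitivity (q.-1%:R * \sum_(l < q | (0 < l)%N) \sum_(m < q | (0 < m)%N)
     (p m)%:C * conjc ((r l)%:C) * (t0 M (l%:R / m%:R : F))%:C); last first.
    rewrite C_M rmorph_nat C_sum; congr (_ * _); apply: eq_bigr => l _.
    by rewrite C_sum; apply: eq_bigr => m _; rewrite conjc_real !C_M.
  rewrite -h; apply: eq_bigr => j _; rewrite /T; congr (_ * _ * conjc _).
    rewrite (DP_sum uv (cmul_psi j) (PP_small u v J) yq).
    by apply: eq_bigr => m _; rewrite /psi mulrA C_M.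
  rewrite (DP_sum uv (cmul_psi j) (RR_small J uv) yq).
  by apply: eq_bigr => m _; rewrite /psi mulrA C_M.
rewrite eT nmC; apply: le_trans (ler_norm _); rewrite ler_wpM2l //.
rewrite lerBlDr; apply: le_trans (main_lower uv yq) _.
rewrite -lerBlDl.
(* Writing 1/l as [isq l * isq (l %/ m) * isq m], the pairs with m dividing l assemble the
   coefficients of L P against those of A^u. *)
have -> : \sum_(n < q) gg u v J q n * cf RR n / n%:R =
   \sum_(l < q | (0 < l)%N) \sum_(m < q | (0 < m)%N)
     p m * r l * (if (m %| l)%N then isq (l %/ m) else 0) :> R.
  rewrite [RHS]big_mkcond; apply: eq_bigr => l _; case: ltnP => [l0|]; last first.
    by rewrite leqn0 => /eqP ->; rewrite invr0 mulr0.
  rewrite /gg -mulrA mulr_suml big_mkcond [RHS]big_mkcond; apply: eq_bigr => m _.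
  case: ltnP => [m0|]; last first.
    by rewrite leqn0 => /eqP ->; case: ifP => //; rewrite cf0 mul0r.
  case: ifP => ml; last by rewrite mulr0.
  have -> : l%:R^-1 = isq l * (isq (l %/ m) * isq m) :> R.
    by rewrite -isqM divnK // -expr2 sqr_isq.
  by rewrite /p /r; ring.
have cnt : \sum_(l < q | (0 < l)%N) (l <= y)%N%:R <= y%:R :> R.
  rewrite big_mkcond (sum_ord_trunc (T := fun l => if (0 < l)%N then (l <= y)%N%:R else 0) yq); last first.
    by move=> e; rewrite ltnNge => /negPf ->; rewrite if_same.
  rewrite big_ord_recl add0r; apply: le_trans (_ : \sum_(i < y) 1 <= _); last by rewrite sumr_const card_ord.
  by apply: ler_sum => i _; rewrite lern1 leq_b1.
(* At most y^2 pairs (l, m) have nonzero coefficients, and each one costs the error of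
   [t0_ratio]. *)
rewrite -sumrB; apply: le_trans (_ : \sum_(l < q | (0 < l)%N) \sum_(m < q | (0 < m)%N) (l <= y)%N%:R * ((m <= y)%N%:R * (2 * isq q)) <= _).
  apply: ler_sum => l l0; rewrite -sumrB; apply: ler_sum => m m0.
  have [ly|yl] := leqP l y; last first.
    have -> : r l = 0.
      rewrite /r; have [->|c0] := eqVneq (cf RR l) 0; first exact: mul0r.
      by have := cf_supp uv (RR_small J uv) c0; rewrite leqNgt yl.
    by rewrite mulr0 !mul0r subrr.
  have [my|ym] := leqP m y; last first.
    have -> : p m = 0.
      rewrite /p; have [->|c0] := eqVneq (cf PP m) 0; first exact: mul0r.
      by have := cf_supp uv (PP_small u v J) c0; rewrite leqNgt ym.
    by rewrite !mul0r mulr0 subrr.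
  rewrite !mul1r; apply: le_trans (ler_norm _) _.
  have := @t0_ratio M m l M0; rewrite m0 l0 my ly => /(_ isT isT).
  set t := t0 _ _; set c := if _ then _ else _ => h.
  have -> : p m * r l * c - p m * r l * t = - (cf PP m * (cf RR l * isq l)) * (isq m * (t - c)).
    by rewrite /p /r; ring.
  rewrite normrM normrN; apply: le_trans (_ : 1 * `|isq m * (t - c)| <= _); last by rewrite mul1r.
  apply: ler_wpM2r => //; rewrite normrM; apply: mulr_ile1; rewrite ?cf_PP_le1 //.
  rewrite normrM; apply: mulr_ile1; rewrite ?cf_RR_le1 //.
  by rewrite ger0_norm ?isq_ge0 ?isq_le1.
under eq_bigr => l _ do rewrite -mulr_sumr -mulr_suml.
rewrite -mulr_suml; have i0 := isq_ge0 (R := R) q.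
have c0 : 0 <= \sum_(l < q | (0 < l)%N) (l <= y)%N%:R :> R by apply: sumr_ge0.
have -> : 2 * y%:R ^+ 2 * isq q = y%:R * (y%:R * (2 * isq q)) :> R by ring.
have h2 : 0 <= 2 * isq q :> R by rewrite mulr_ge0.
by apply: ler_pM => //; rewrite ?mulr_ge0 // ler_wpM2r.
Qed.

End WithPolys.
End FirstMoment.

(** * Averages over the cutoff *)

Section Averaging.
Context {R : realType}.
Implicit Types (F : int -> R[i]) (x : int).

Definition Av (M : nat) F x : R[i] := (M%:R^-1)%:C * \sum_(i < M) F (x + i%:Z).

(* The expectation of [F (x + i_0 + ... + i_(J-1))] for independent [i_j]
   uniform in {0, ..., Ms j - 1}. *)
Fixpoint AvL (Ms : nat -> nat) (J : nat) F : int -> R[i] :=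
  if J is J'.+1 then AvL Ms J' (Av (Ms J') F) else F.

Lemma Av_bound M F C x : (0 < M)%N -> (forall z, nm (F z) <= C) -> nm (Av M F x) <= C.
Proof.
move=> M0 hF; rewrite /Av nmM nmC ger0_norm ?invr_ge0 // mulrC ler_pdivrMr ?ltr0n //.
apply: le_trans (nm_sum _ _ _) _; apply: le_trans (_ : \sum_(i < M) C <= _).
  by apply: ler_sum => i _.
by rewrite sumr_const card_ord mulr_natr.
Qed.

Lemma AvL_bound Ms J F C x : (forall i, 0 < Ms i)%N -> (forall z, nm (F z) <= C) ->
  nm (AvL Ms J F x) <= C.
Proof.
move=> M0; elim: J F => [|J IH] F hF //=.
by apply: IH => z; apply: Av_bound.
Qed.

Lemma Av_lin (I : Type) (r : seq I) (P : pred I) (k : I -> R[i]) (G : I -> int -> R[i]) M x :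
  Av M (fun z => \sum_(c <- r | P c) k c * G c z) x =
  \sum_(c <- r | P c) k c * Av M (G c) x.
Proof.
rewrite /Av exchange_big /= mulr_sumr; apply: eq_bigr => c _.
by rewrite -mulr_sumr mulrCA.
Qed.

Lemma AvL_lin (I : Type) (r : seq I) (P : pred I) (k : I -> R[i]) (G : I -> int -> R[i]) Ms J x :
  AvL Ms J (fun z => \sum_(c <- r | P c) k c * G c z) x =
  \sum_(c <- r | P c) k c * AvL Ms J (G c) x.
Proof.
elim: J G => [|J IH] G //=; rewrite -IH; congr (AvL _ _ _ x).
by apply/funext => z; rewrite Av_lin.
Qed.

Lemma Av_shift M F (h : int) x : Av M (fun z => F (z + h)) x = Av M F (x + h).
Proof. by rewrite /Av; congr (_ * _); apply: eq_bigr => i _; rewrite addrAC. Qed.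

Lemma AvL_shift Ms J F (h : int) x : AvL Ms J (fun z => F (z + h)) x = AvL Ms J F (x + h).
Proof.
elim: J F => [|J IH] F //=; rewrite -IH; congr (AvL _ _ _ x).
by apply/funext => z; rewrite Av_shift.
Qed.

Lemma Av_lip1 M F C x : (0 < M)%N -> (forall z, nm (F z) <= C) ->
  nm (Av M F (x + 1) - Av M F x) <= 2 * C / M%:R.
Proof.
move=> M0 hF; rewrite /Av -mulrBr nmM nmC ger0_norm ?invr_ge0 // mulrC ler_wpM2r ?invr_ge0 //.
have -> : \sum_(i < M) F (x + 1 + i%:Z) - \sum_(i < M) F (x + i%:Z) = F (x + M%:Z) - F x.
  rewrite -sumrB -(big_mkord xpredT (fun i => F (x + 1 + i%:Z) - F (x + i%:Z))).
  rewrite (@telescope_sumr_eq _ 0 M (fun i : nat => F (x + i%:Z))) //; first by rewrite addr0.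
  by move=> i _; congr (F _ - _); rewrite -addrA -[i.+1]add1n PoszD.
by apply: le_trans (nmB _ _) _; rewrite mulr2n mulrDl !mul1r lerD.
Qed.

Lemma Av_lip M F C x (h : nat) : (0 < M)%N -> (forall z, nm (F z) <= C) ->
  nm (Av M F (x + h%:Z) - Av M F x) <= 2 * C / M%:R * h%:R.
Proof.
move=> M0 hF; elim: h => [|h IH]; first by rewrite addr0 subrr nm0 mulr0.
have -> : Av M F (x + h.+1%:Z) - Av M F x =
   (Av M F (x + h%:Z + 1) - Av M F (x + h%:Z)) + (Av M F (x + h%:Z) - Av M F x).
  by rewrite addrA addrNK -[h.+1]addn1 PoszD addrA.
apply: le_trans (nmD _ _) _; rewrite -[h.+1%:R]natr1 mulrDr mulr1 addrC lerD //.
exact: Av_lip1.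
Qed.

(** The cutoff moves up in the direct sum, where n/m <= X becomes n <= m X, and down in the dual
    sum. *)
Definition sg (s : bool) (h : nat) : int := if s then h%:Z else - h%:Z.

Lemma sgD s a b : sg s (a + b) = sg s a + sg s b.
Proof. by case: s; rewrite /sg ?PoszD ?opprD. Qed.

Lemma Av_lip_sg M F C x s (h : nat) : (0 < M)%N -> (forall z, nm (F z) <= C) ->
  nm (Av M F (x + sg s h) - Av M F x) <= 2 * C / M%:R * h%:R.
Proof.
move=> M0 hF; case: s; first exact: Av_lip.
rewrite /= nm_subC -{1}[x](addrNK h%:Z); exact: Av_lip.
Qed.

End Averaging.

(** * Divisor sums under an averaged shift of the cutoff *)

Section ShiftedConvolution.
Context {R : realType} (b : nat -> seq nat).
Hypothesis b_prime : forall i, all prime (b i).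
Hypothesis b_uniq : forall i, uniq (b i).
Hypothesis b_disj : forall i j, i != j -> disj (b i) (b j).
Variables (f : nat -> nat -> R) (lam : nat -> nat) (Ms : nat -> nat).
Hypothesis f_loc : forall i n, f i (n`_(pil (b i)))%N = f i n.
Hypothesis Ms0 : forall i, (0 < Ms i)%N.

Definition Lam (s : seq nat) m := (\sum_(p <- s) logn p m * lam p)%N.

Lemma Lam_part (s1 s2 : seq nat) n : {subset s1 <= s2} -> Lam s1 (n`_(pil s2))%N = Lam s1 n.
Proof. by move=> h; apply: eq_big_seq => p /h ps; rewrite logn_partn. Qed.

(** The exact divisor sum within block i, plus the price of ignoring the shift by [Lam] inside a
    window of length [Ms i]. *)
Definition GG N i n : R :=
  `|\sum_(m < N | (pil (b i)).-nat m && (m %| n)%N) f i m| +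
  \sum_(m < N | (pil (b i)).-nat m && (m %| n)%N) `|f i m| * (2 * (Lam (b i) m)%:R / (Ms i)%:R).

Lemma GG_ge0 N i n : 0 <= GG N i n.
Proof.
by apply: addr_ge0 => //; apply: sumr_ge0 => m _; rewrite mulr_ge0 // divr_ge0 ?mulr_ge0.
Qed.

Lemma pnat_disj_coprime (s1 s2 : seq nat) a c : disj s1 s2 ->
  (pil s1).-nat a -> (pil s2).-nat c -> coprime a c.
Proof.
move=> d ha hc; apply: (@pnat_coprime (pil s1)) => //.
apply: sub_in_pnat hc => r _ rs; rewrite -[r \in (pil s1)^']/(r \notin s1).
exact: disjC d r rs.
Qed.

Lemma prod_f_loc J n : \prod_(i < J) f i (n`_(pil (bl b J)))%N = \prod_(i < J) f i n.
Proof.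
apply: eq_bigr => i _; rewrite -(f_loc i) -[in RHS](f_loc i); congr (f i _).
case: n => [|n]; first by rewrite !partn0 partn1.
by apply: eq_partn_from_log; rewrite ?part_gt0 // => p pi; rewrite logn_partn // in_pil; apply: mem_bl pi.
Qed.

(* Peel off the last block: within its own window the shift by [Lam] changes the
   average by at most [2 * Lam / Ms], and without the shift the sum over that
   block factors out. *)
Lemma averaged_convolution_le N n J F C x s : (0 < n < N)%N -> (forall z, nm (F z) <= C) ->
  nm (\sum_(m < N | (pil (bl b J)).-nat m && (m %| n)%N)
        (\prod_(i < J) f i m)%:C * AvL Ms J F (x + sg s (Lam (bl b J) m)))
  <= C * \prod_(i < J) GG N i n.
Proof.
move=> /andP[n0 nN]; elim: J F C => [|J IH] F C hF.
  have N1 : (1 < N)%N by apply: leq_ltn_trans nN.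
  rewrite big_ord0 mulr1 (big_pred1 (Ordinal N1)) => [|m].
    by rewrite big_ord0 mul1r /=; exact: hF.
  rewrite /= -val_eqE /=; apply/idP/eqP => [/andP[/andP[m0 /allP h] _]|->]; last by rewrite /= dvd1n.
  apply/eqP; rewrite eqn_leq m0 andbT leqNgt; apply/negP => m1.
  by have := h (pdiv m); rewrite mem_primes pdiv_prime // m0 pdiv_dvd => /(_ isT).
have dj : disj (bl b J) (b J) := bl_disj b_disj (J := J).
pose F' z := \sum_(c < N | (pil (b J)).-nat c && (c %| n)%N)
   (f J c)%:C * Av (Ms J) F (z + sg s (Lam (b J) c)).
pose H a c : R[i] := if (a * c %| n)%N then (\prod_(i < J) f i a)%:C * (f J c)%:C *
   AvL Ms J (Av (Ms J) F) (x + sg s (Lam (bl b J) a) + sg s (Lam (b J) c)) else 0.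
have HE m : (pil (bl b J ++ b J)).-nat m ->
   (if (m %| n)%N then (\prod_(i < J.+1) f i m)%:C * AvL Ms J.+1 F (x + sg s (Lam (bl b J.+1) m)) else 0)
   = H (m`_(pil (bl b J)))%N (m`_(pil (b J)))%N.
  move=> sm; rewrite /H pil_cat_part //; case: ifP => // _.
  rewrite f_loc prod_f_loc big_ord_recr /= C_M; congr (_ * _).
  rewrite -addrA -sgD !Lam_part //; congr (AvL _ _ _ (_ + sg s _)).
  by rewrite /Lam big_cat.
rewrite big_mkcondr (eq_bigr _ (fun m : 'I_N => HE m)) sum_pnat_cat //.
have -> : \sum_(a < N | (pil (bl b J)).-nat a)
     \sum_(c < N | (pil (b J)).-nat c && (a * c < N)%N) H a c =
   \sum_(a < N | (pil (bl b J)).-nat a && (a %| n)%N)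
        (\prod_(i < J) f i a)%:C * AvL Ms J F' (x + sg s (Lam (bl b J) a)).
  rewrite [RHS]big_mkcondr; apply: eq_bigr => a sa.
  case: ifP => an; last first.
    rewrite big1 // => c _; rewrite /H ifN //; apply/negP => h.
    by have := dvdn_trans (dvdn_mulr _ (dvdnn _)) h; rewrite an.
  have -> : AvL Ms J F' (x + sg s (Lam (bl b J) a)) =
     \sum_(c < N | (pil (b J)).-nat c && (c %| n)%N)
       (f J c)%:C * AvL Ms J (Av (Ms J) F) (x + sg s (Lam (bl b J) a) + sg s (Lam (b J) c)).
    rewrite /F' (AvL_lin _ _ (fun c : 'I_N => (f J c)%:C) (fun (c : 'I_N) z => Av (Ms J) F (z + sg s (Lam (b J) c)))).
    by apply: eq_bigr => c _; rewrite AvL_shift.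
  rewrite mulr_sumr big_mkcond [RHS]big_mkcond; apply: eq_bigr => c _.
  case sc : (pnat _ c) => //=.
  have cop := pnat_disj_coprime dj sa sc.
  rewrite /H Gauss_dvd // an /=; case: ifP => [acN|/negbT acN].
    by case: ifP => // _; rewrite mulrA.
  case: ifP => // cn; case/negP: acN; apply: leq_ltn_trans nN; apply: dvdn_leq => //.
  by rewrite Gauss_dvd // an.
rewrite big_ord_recr /= [\prod_(i < J) _ * _]mulrC mulrA; apply: IH => z.
have C0 : 0 <= C by apply: le_trans (nm_ge0 _) (hF 0).
have -> : F' z = (\sum_(c < N | (pil (b J)).-nat c && (c %| n)%N) f J c)%:C * Av (Ms J) F z +
   \sum_(c < N | (pil (b J)).-nat c && (c %| n)%N)
     (f J c)%:C * (Av (Ms J) F (z + sg s (Lam (b J) c)) - Av (Ms J) F z).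
  rewrite C_sum mulr_suml -big_split /=; apply: eq_bigr => c _.
  by rewrite mulrBr addrC addrNK.
apply: le_trans (nmD _ _) _; rewrite /GG mulrDr; apply: lerD.
  by rewrite nmM nmC mulrC ler_wpM2r // Av_bound.
apply: le_trans (nm_sum _ _ _) _; rewrite mulr_sumr; apply: ler_sum => c _.
rewrite nmM nmC mulrCA ler_wpM2l //; apply: le_trans (Av_lip_sg _ _ _ _ hF) _ => //.
by apply: eqle; ring.
Qed.

Lemma GG_part N i n : (0 < n)%N -> GG N i (n`_(pil (b i)))%N = GG N i n.
Proof.
move=> n0.
have e m : (pil (b i)).-nat m -> (m %| n`_(pil (b i)))%N = (m %| n)%N.
  move=> sm; apply/idP/idP => h; first by apply: dvdn_trans h (dvdn_part _ _).
  by rewrite -(part_pnat_id sm) partn_dvd.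
rewrite /GG; congr (`|_| + _).
  by apply: eq_bigl => m; case sm : (pnat _ _) => //=; rewrite e.
by apply: eq_bigl => m; case sm : (pnat _ _) => //=; rewrite e.
Qed.

End ShiftedConvolution.

(** * Local factors of the coefficients of L P *)

Section LocalFactors.
Context {R : realType} (u v J q : nat).
Hypothesis uv : (0 < u < v)%N.
Hypothesis q0 : (0 < q)%N.
Local Notation PP := (PP u v J : nat -> {poly R}).
Local Notation kk := (kk u v : R).
Local Notation lp := (lp J).

(* Logarithms to base 2 are measured in units of [1 / QQ]: [lam p] is the
   logarithm of [p] rounded down, [Ms i] the width of the window of block [i]. *)
Definition QQ : nat := (q * 2 ^ J)%N.
Definition Ms (i : nat) : nat := (q * 4 ^ i * 3 ^ (J - i))%N.
Definition lam (p : nat) : nat := trunc_log 2 (p ^ QQ).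
Definition fP (i m : nat) : R := (PP i)`_(Om (blk i) m) * (Om (blk i) m)`!%:R * ka (blk i) m.
Definition GP (N i n : nat) : R := GG blk fP lam Ms N i n.
(** An admissible m of block i shifts by at most [v * lp i * 2 ^ i.+1 * QQ], and 2^i [QQ] / [Ms i] =
    (2/3)^(J-i). The base 3 in [Ms] exceeds 2, which makes these costs summable, and is below 4,
    which keeps the total width of the windows of order q 4^J. *)
Definition eps (i : nat) : R := 4 * v%:R * (J + 8 - i)%:R * (2 / 3) ^+ (J - i).

Let v0 : (0 < v)%N := v_gt0 uv.

Lemma Ms_gt0 i : (0 < Ms i)%N.
Proof. by rewrite /Ms !muln_gt0 q0 !expn_gt0. Qed.

Lemma fP_loc i n : fP i (n`_(pil (blk i)))%N = fP i n.
Proof. by rewrite /fP Om_part ka_part. Qed.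

Lemma leq_exp2r' a b e : (a <= b)%N -> (a ^ e <= b ^ e)%N.
Proof. by case: e => // e ab; rewrite leq_exp2r. Qed.

Lemma lam_le i p : p \in blk i -> (lam p <= 2 ^ i.+1 * QQ)%N.
Proof.
rewrite mem_blk => /and3P[pp _ pb].
rewrite -[leqRHS](@trunc_expnK 2) //; apply: leq_trunc_log; rewrite expnM.
exact: leq_exp2r'.
Qed.

Lemma Lam_le i m : (Lam lam (blk i) m <= Om (blk i) m * (2 ^ i.+1 * QQ))%N.
Proof.
rewrite /Lam /Om big_distrl /= big_seq [leqRHS]big_seq; apply: leq_sum => p pI.
by rewrite leq_mul2l lam_le ?orbT.
Qed.

Lemma eps_ge0 i : 0 <= eps i.
Proof. by rewrite /eps !mulr_ge0 // exprn_ge0 // divr_ge0. Qed.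

Lemma Lam_eps i m : (i < J)%N -> (Om (blk i) m <= v * lp i)%N ->
  2 * (Lam lam (blk i) m)%:R / (Ms i)%:R <= eps i.
Proof.
move=> iJ om; have M0 := Ms_gt0 i.
rewrite ler_pdivrMr ?ltr0n //.
have h : (Lam lam (blk i) m <= v * lp i * (2 ^ i.+1 * QQ))%N.
  by apply: leq_trans (Lam_le i m) _; rewrite leq_mul2r om orbT.
apply: le_trans (_ : 2 * (v * lp i * (2 ^ i.+1 * QQ))%:R <= _).
  by rewrite ler_wpM2l // ler_nat.
apply: eqle; rewrite /eps /Ms /QQ /lp !natrM !natrX.
have -> : (2 : R) ^+ J = 2 ^+ i * 2 ^+ (J - i) by rewrite -exprD subnKC // ltnW.
have -> : (4 : R) ^+ i = 2 ^+ i * 2 ^+ i by rewrite -exprMn; congr (_ ^+ _); ring.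
rewrite expr_div_n exprS.
have h3 : (3 : R) ^+ (J - i) != 0 by rewrite expf_neq0.
by move: (2 ^+ i) (2 ^+ (J - i)) (3 ^+ (J - i)) h3 => a b c c0; field.
Qed.

(** The coefficient at p^a of L times the untruncated exponential: the divisor sum over 1, p, ...,
    p^a. *)
Definition Ealt (a : nat) : R := \sum_(e < a.+1) (- (1 - kk)) ^+ e / e`!%:R.
Definition tau (a : nat) : R := if a == 0%N then 1 else 4.

Let kb : 0 <= 1 - kk <= 1.
Proof. by have /andP[k0 k1] := @kk_bounds R _ _ uv; apply/andP; split; lra. Qed.

Lemma Ealt_bounds a : 0 <= Ealt a <= 1.
Proof.
have [/andP[h1 h2] _] := altexp_bounds a kb; apply/andP; split => //.
apply: le_trans h1; rewrite exprn_ge0 //; have /andP[k0 k1] := @kk_bounds R _ _ uv; lra.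
Qed.

Lemma tau_ge1 a : 1 <= tau a.
Proof. by rewrite /tau; case: eqP => _ //; lra. Qed.

Lemma beta_sum_le a : \sum_(e < a.+1) (1 - kk) ^+ e / e`!%:R <= tau a.
Proof.
rewrite /tau; case: eqP => [->|_]; first by rewrite big_ord_recl big_ord0 expr0 divr1 addr0.
have /andP[b0 b1] := kb.
apply: le_trans (exp_sum_le _ b0) _; apply: le_trans (_ : expR 1 <= _); first by rewrite ler_expR.
have -> : 1 = 2^-1 * 2%:R :> R by rewrite mulVf.
rewrite expRM_natr; apply: le_trans (_ : 2 ^+ 2 <= _); last by lra.
by rewrite lerXn2r ?nnegrE ?expR_ge0 // expR_half_le2.
Qed.

Definition gh i n : R := \prod_(p <- blk i) Ealt (logn p n).
Definition tauprod i n : R := \prod_(p <- blk i) tau (logn p n).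

Lemma gh_bounds i n : 0 <= gh i n <= 1.
Proof.
apply/andP; split; first by apply: prodr_ge0 => p _; have /andP[] := Ealt_bounds (logn p n).
by apply: prodr_ile1 => p _; exact: Ealt_bounds.
Qed.

Lemma tauprod_ge1 i n : 1 <= tauprod i n.
Proof.
apply: le_trans (_ : \prod_(p <- blk i) 1 <= _); first by rewrite big1.
by apply: ler_prod => p _; rewrite ler01 tau_ge1.
Qed.

Lemma fPE i m : (Om (blk i) m <= v * lp i)%N ->
  fP i m = \prod_(p <- blk i) ((- (1 - kk)) ^+ logn p m / (logn p m)`!%:R).
Proof.
move=> om; rewrite /fP coef_poly ltnS om divfK ?pnatr_eq0 -?lt0n ?fact_gt0 //.
by rewrite big_split /= /ka prodrXr.
Qed.

Lemma fP0 i m : (v * lp i < Om (blk i) m)%N -> fP i m = 0.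
Proof. by move=> om; rewrite /fP coef_poly ltnS leqNgt om /= !mul0r. Qed.

Lemma fP_abs i m : `|fP i m| <= \prod_(p <- blk i) ((1 - kk) ^+ logn p m / (logn p m)`!%:R).
Proof.
have /andP[b0 b1] := kb.
have [om|om] := leqP (Om (blk i) m) (v * lp i).
  rewrite fPE // normr_prod; apply: eqle; apply: eq_bigr => p _.
  by rewrite normrM normrX normrN (ger0_norm b0) normfV normr_nat.
by rewrite fP0 // normr0; apply: prodr_ge0 => p _; rewrite divr_ge0 ?exprn_ge0.
Qed.

Lemma fP_sum_abs N i n : (0 < n < N)%N ->
  \sum_(m < N | (pil (blk i)).-nat m && (m %| n)%N) `|fP i m| <= tauprod i n.
Proof.
move=> n0N; have /andP[b0 b1] := kb.
apply: le_trans (_ : \sum_(m < N | (pil (blk i)).-nat m && (m %| n)%N) \prod_(p <- blk i) ((1 - kk) ^+ logn p m / (logn p m)`!%:R) <= _).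
  by apply: ler_sum => m _; exact: fP_abs.
rewrite (divisor_sum_prod (fun _ e => (1 - kk) ^+ e / e`!%:R) (blk_prime i) (blk_uniq i) n0N).
apply: ler_prod => p _; rewrite beta_sum_le andbT; apply: sumr_ge0 => e _.
by rewrite divr_ge0 ?exprn_ge0.
Qed.

Definition ind (b : bool) : R := if b then 1 else 0.

(** Unless n has more than [v * lp i] prime factors in the block, the truncation of [PP] is
    invisible and the divisor sum equals [gh]. The exceptional n and the cost of the shift are
    bounded trivially through [tauprod]. *)
Lemma GP_le N i n : (i < J)%N -> (0 < n < N)%N ->
  GP N i n <= gh i n + (ind (v * lp i < Om (blk i) n)%N + eps i) * tauprod i n.
Proof.
move=> iJ n0N; rewrite /GP /GG mulrDl addrA; apply: lerD; last first.
  apply: le_trans (_ : eps i * \sum_(m < N | (pil (blk i)).-nat m && (m %| n)%N) `|fP i m| <= _); last first.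
    by rewrite ler_wpM2l ?eps_ge0 // fP_sum_abs.
  rewrite mulr_sumr; apply: ler_sum => m _.
  have [om|om] := leqP (Om (blk i) m) (v * lp i); last by rewrite fP0 // normr0 mul0r mulr0.
  by rewrite mulrC ler_wpM2r // Lam_eps.
have /andP[g0 g1] := gh_bounds i n.
rewrite /ind; have [om|om] := leqP (Om (blk i) n) (v * lp i).
  rewrite mul0r addr0 (eq_bigr (fun m : 'I_N => \prod_(p <- blk i) ((- (1 - kk)) ^+ logn p m / (logn p m)`!%:R))); last first.
    move=> m /andP[_ mn]; apply: fPE; apply: leq_trans om; apply: leq_sum => p _.
    by apply: dvdn_leq_log => //; case/andP: n0N.
  rewrite (divisor_sum_prod (fun _ e => (- (1 - kk)) ^+ e / e`!%:R) (blk_prime i) (blk_uniq i) n0N).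
  by rewrite -/(gh i n) ger0_norm.
rewrite mul1r -[leLHS]add0r lerD //; apply: le_trans (ler_norm_sum _ _ _) _.
exact: fP_sum_abs.
Qed.

Definition eta i : R := 4 * 2^-1 ^+ (v * lp i) + 2 * eps i + 2 * eps i ^+ 2.

(** With g <= 1, T <= T^2 and x^2 <= x for the indicator x, squaring g + (x + e) T costs at most (4x
    + 2e + 2e^2) T^2. Rankin's trick then replaces x by 2^(Om n - v lp i), a multiplicative
    weight. *)
Lemma GP_sqr N i n : (i < J)%N -> (0 < n < N)%N ->
  GP N i n ^+ 2 <= gh i n ^+ 2 + eta i * (2 ^+ Om (blk i) n * tauprod i n ^+ 2).
Proof.
move=> iJ n0N; have h := GP_le iJ n0N.
have g0 : 0 <= GP N i n by apply: GG_ge0.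
have /andP[h0 h1] := gh_bounds i n; have T1 := tauprod_ge1 i n; have e0 := eps_ge0 i.
have p0 : 1 <= (2 : R) ^+ Om (blk i) n by rewrite exprn_ege1 // ler1n.
have ib : ind (v * lp i < Om (blk i) n)%N <= 2^-1 ^+ (v * lp i) * 2 ^+ Om (blk i) n.
  rewrite /ind; case: ltnP => om; last by rewrite mulr_ge0 ?exprn_ge0.
  by rewrite exprVn mulrC ler_pdivlMr ?exprn_gt0 // mul1r ler_weXn2l ?ler1n // ltnW.
have i01 : 0 <= ind (v * lp i < Om (blk i) n)%N <= 1 by rewrite /ind; case: ltnP; rewrite ?lexx ?ler01.
move: ib i01 h; rewrite /eta; move: (ind _) => x ib /andP[x0 x1] h.
apply: le_trans (_ : (gh i n + (x + eps i) * tauprod i n) ^+ 2 <= _).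
  by rewrite lerXn2r ?nnegrE // (le_trans g0).
move: (gh i n) (tauprod i n) (eps i) (2 ^+ Om (blk i) n) (2^-1 ^+ (v * lp i)) h0 h1 T1 e0 p0 ib => g T e P z h0 h1 T1 e0 P1 ib.
have T0 : 0 <= T by lra.
have TT0 : 0 <= T ^+ 2 by exact: sqr_ge0.
have TT1 : T <= T ^+ 2 by nra.
have b1 : 2 * g * ((x + e) * T) <= 2 * (x + e) * T ^+ 2.
  have : 0 <= x + e by lra.
  move=> xe; have : g * ((x + e) * T) <= (x + e) * T ^+ 2; last by lra.
  apply: le_trans (_ : 1 * ((x + e) * T) <= _); first by rewrite ler_wpM2r // mulr_ge0.
  by rewrite mul1r ler_wpM2l.
have b2 : (x + e) ^+ 2 <= 2 * x + 2 * e ^+ 2.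
  have := sqr_ge0 (x - e); have : x ^+ 2 <= x by rewrite expr2 ler_piMl.
  by move=> ? ?; nra.
have b3 : (4 * x + 2 * e + 2 * e ^+ 2) <= (4 * z + 2 * e + 2 * e ^+ 2) * P.
  have e20 : 0 <= e ^+ 2 by exact: sqr_ge0.
  have : e <= e * P by rewrite ler_peMr.
  have : e ^+ 2 <= e ^+ 2 * P by rewrite ler_peMr.
  by move=> ? ?; lra.
have b4 := ler_wpM2r TT0 b2; have b5 := ler_wpM2r TT0 b3.
have -> : (g + (x + e) * T) ^+ 2 = g ^+ 2 + 2 * g * ((x + e) * T) + (x + e) ^+ 2 * T ^+ 2 by ring.
lra.
Qed.

Lemma invp_bounds i p : p \in blk i ->
  [/\ 3 <= p%:R :> R, p.-1%:R = p%:R - 1 :> R & 0 < p%:R :> R].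
Proof.
rewrite mem_blk => /and3P[pp b1 _].
have p3 : (3 <= p)%N by apply: leq_trans b1; exact: (bd_mono (leq0n i)).
split; first by rewrite ler_nat.
  by rewrite -subn1 natrB // (leq_trans _ p3).
by rewrite ltr0n (leq_trans _ p3).
Qed.

(** The exponent k^2 arises here: [Ealt] is 1 at exponent 0 and k at exponent 1, so the Euler factor
    is at most 1 + k^2/p plus the geometric tail 1/(p(p-1)). *)
Lemma sum_gh N i : \sum_(n < N | (pil (blk i)).-nat n) gh i n ^+ 2 / n%:R <=
  expR (kk ^+ 2 * sB i + rB i).
Proof.
have -> : \sum_(n < N | (pil (blk i)).-nat n) gh i n ^+ 2 / n%:R =
   \sum_(n < N | (pil (blk i)).-nat n) (\prod_(p <- blk i) (fun _ e => Ealt e ^+ 2) p (logn p n)) / n%:R.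
  by apply: eq_bigr => n _; rewrite /gh prodrXl.
apply: le_trans (euler_prod_le (phi := fun _ e => Ealt e ^+ 2) N (blk_prime i) (blk_uniq i) _) _ => [p e|]; first exact: sqr_ge0.
rewrite /sB /rB mulr_sumr -big_split /= expR_sum big_seq [leRHS]big_seq.
apply: ler_prod => p pI; have [p3 pp p0] := invp_bounds pI.
apply/andP; split; first by apply: sumr_ge0 => e _; rewrite divr_ge0 ?sqr_ge0 ?exprn_ge0 // ltW.
apply: le_trans (expR_ge1Dx _).
have E0 : Ealt 0 = 1 by rewrite /Ealt big_ord_recl big_ord0 expr0 fact0 divr1 addr0.
have E1 : Ealt 1 = kk by rewrite /Ealt !big_ord_recl big_ord0 /= expr0 expr1 factS fact0 !divr1 addr0; ring.
(* Two more terms, so that the first two can be split off whatever [N] is. *)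
apply: le_trans (_ : \sum_(e < N.+2) Ealt e ^+ 2 / p%:R ^+ e <= _).
  rewrite -!(big_mkord xpredT (fun e => Ealt e ^+ 2 / p%:R ^+ e)) [leRHS](big_cat_nat (n := N)) //=; last by rewrite -addn2 leq_addr.
  by rewrite lerDl; apply: sumr_ge0 => e _; rewrite divr_ge0 ?sqr_ge0 ?exprn_ge0 // ltW.
rewrite 2!big_ord_recl /= E0 E1 expr0 divr1 expr1n expr1 lerD2l lerD2l.
apply: le_trans (_ : p%:R^-1 ^+ 2 * \sum_(e < N) p%:R^-1 ^+ e <= _).
  rewrite mulr_sumr; apply: ler_sum => e _; rewrite /bump /= !add1n -exprD exprVn; apply: ler_piMl.
    by rewrite invr_ge0 exprn_ge0 // ltW.
  by have /andP[a b] := Ealt_bounds e.+2; rewrite exprn_ile1.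
have i1 : 0 <= (p%:R : R)^-1 < 1 by rewrite invr_ge0 (ltW p0) /= invf_lt1 //; lra.
apply: le_trans (_ : p%:R^-1 ^+ 2 * (1 - p%:R^-1)^-1 <= _).
  by rewrite ler_wpM2l ?sqr_ge0 // geo_le.
rewrite pp; apply: eqle; have n1 : p%:R != 0 :> R by rewrite gt_eqF.
have n2 : p%:R - 1 != 0 :> R by rewrite gt_eqF //; lra.
by field; rewrite n1 n2.
Qed.

(** The local series has ratio 2/p < 1 because the primes of the blocks are at least 3; its tail is
    32/(p-2) <= 96/p, and 384 = 96 * 4 by [sB_le4]. *)
Lemma sum_TT N i : \sum_(n < N | (pil (blk i)).-nat n) (2 ^+ Om (blk i) n * tauprod i n ^+ 2) / n%:R <=
  expR 384.
Proof.
have -> : \sum_(n < N | (pil (blk i)).-nat n) (2 ^+ Om (blk i) n * tauprod i n ^+ 2) / n%:R =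
   \sum_(n < N | (pil (blk i)).-nat n) (\prod_(p <- blk i) (fun _ e => 2 ^+ e * tau e ^+ 2) p (logn p n)) / n%:R.
  by apply: eq_bigr => n _; rewrite big_split /= prodrXl prodrXr.
have ph0 (p e : nat) : 0 <= 2 ^+ e * tau e ^+ 2.
  by apply: mulr_ge0; [exact: exprn_ge0|exact: sqr_ge0].
apply: le_trans (euler_prod_le (phi := fun _ e => 2 ^+ e * tau e ^+ 2) N (blk_prime i) (blk_uniq i) ph0) _.
apply: le_trans (_ : expR (\sum_(p <- blk i) 96 * p%:R^-1) <= _); last first.
  by rewrite -mulr_sumr ler_expR -/(sB i); have := @sB_le4 R i; lra.
rewrite expR_sum big_seq [leRHS]big_seq.
apply: ler_prod => p pI; have [p3 pp p0] := invp_bounds pI.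
apply/andP; split; first by apply: sumr_ge0 => e _; apply: divr_ge0; [exact: ph0|rewrite exprn_ge0 // ltW].
apply: le_trans (expR_ge1Dx _).
apply: le_trans (_ : \sum_(e < N.+1) 2 ^+ e * tau e ^+ 2 / p%:R ^+ e <= _).
  rewrite -!(big_mkord xpredT (fun e => 2 ^+ e * tau e ^+ 2 / p%:R ^+ e)) [leRHS](big_cat_nat (n := N)) //=.
  by rewrite lerDl; apply: sumr_ge0 => e _; apply: divr_ge0; [exact: ph0|rewrite exprn_ge0 // ltW].
rewrite big_ord_recl /= /tau eqxx expr0 divr1 expr1n mul1r lerD2l.
apply: le_trans (_ : 16 * (2 / p%:R) * \sum_(e < N) (2 / p%:R) ^+ e <= _).
  rewrite mulr_sumr; apply: ler_sum => e _; rewrite /bump /= add1n.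
  have -> : 16 * (2 / p%:R) * (2 / p%:R) ^+ e = 16 * (2 / p%:R) ^+ e.+1 :> R by rewrite exprS [RHS]mulrA.
  rewrite expr_div_n; apply: eqle; have h : (p%:R : R) ^+ e.+1 != 0.
    by apply: expf_neq0; rewrite gt_eqF.
  by move: (2 ^+ e.+1) (p%:R ^+ e.+1) h => a c h; field.
have i1 : 0 <= 2 / (p%:R : R) < 1 by rewrite divr_ge0 ?(ltW p0) //= ltr_pdivrMr // mul1r; lra.
apply: le_trans (_ : 16 * (2 / p%:R) * (1 - 2 / p%:R)^-1 <= _).
  by rewrite ler_wpM2l ?geo_le // mulr_ge0 // divr_ge0 // ltW.
have n1 : p%:R != 0 :> R by rewrite gt_eqF.
have n2 : p%:R - 2 != 0 :> R by rewrite gt_eqF //; lra.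
have -> : 16 * (2 / p%:R) * (1 - 2 / p%:R)^-1 = 32 / (p%:R - 2) :> R by field; rewrite n1 n2.
rewrite ler_pdivrMr; last by lra.
rewrite mulrAC ler_pdivlMr //; lra.
Qed.

Lemma sum_GP N i : (i < J)%N ->
  \sum_(n < N | (pil (blk i)).-nat n) GP N i n ^+ 2 / n%:R <=
  expR (kk ^+ 2 * sB i + rB i + eta i * expR 384).
Proof.
move=> iJ; have eta0 : 0 <= eta i.
  by rewrite /eta addr_ge0 ?addr_ge0 ?mulr_ge0 ?exprn_ge0 ?eps_ge0 ?sqr_ge0.
apply: le_trans (_ : \sum_(n < N | (pil (blk i)).-nat n) (gh i n ^+ 2 / n%:R + eta i * ((2 ^+ Om (blk i) n * tauprod i n ^+ 2) / n%:R)) <= _).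
  apply: ler_sum => n sn; rewrite mulrA -mulrDl ler_wpM2r ?invr_ge0 //.
  by apply: GP_sqr; rewrite ?(pnat_gt0 sn) ?ltn_ord.
rewrite big_split /= -mulr_sumr.
have a0 : 0 <= kk ^+ 2 * sB i + rB i.
  by rewrite addr_ge0 ?rB_ge0 // mulr_ge0 ?sB_ge0 ?sqr_ge0.
rewrite expRD; apply: le_trans (_ : expR (kk ^+ 2 * sB i + rB i) * (1 + eta i * expR 384) <= _); last first.
  by rewrite ler_wpM2l ?expR_ge0 // expR_ge1Dx.
rewrite mulrDr mulr1; apply: lerD; first exact: sum_gh.
apply: le_trans (_ : eta i * expR 384 <= _); first by rewrite ler_wpM2l // sum_TT.
by rewrite ler_peMl ?mulr_ge0 ?expR_ge0 // -expR0 ler_expR.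
Qed.

End LocalFactors.

Section SumOfSquares.
Context {R : realType} (u v J q : nat).
Hypothesis uv : (0 < u < v)%N.
Hypothesis q0 : (0 < q)%N.
Local Notation kk := (kk u v : R).
Local Notation eps := (eps v J : nat -> R).
Local Notation eta := (eta v J : nat -> R).
Local Notation GP := (GP u v J q : nat -> nat -> nat -> R).

Lemma sum_eps : \sum_(i < J) eps i <= 88 * v%:R.
Proof.
have -> : \sum_(i < J) eps i = 4 * v%:R * \sum_(d < J) (d + 9)%:R * (2 / 3) ^+ d.+1.
  rewrite mulr_sumr [RHS](reindex_inj rev_ord_inj) /=; apply: eq_bigr => i _.
  have iJ := ltn_ord i; rewrite /eps -mulrA; congr (_ * (_%:R * _ ^+ _)); lia.
have -> : 88 * v%:R = 4 * v%:R * 22 :> R by ring.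
rewrite ler_wpM2l ?mulr_ge0 //.
(* A closed form, checked by induction; 22 is the value of the infinite series. *)
suff -> : \sum_(d < J) (d + 9)%:R * (2 / 3) ^+ d.+1 = 22 - (2 * J%:R + 22) * (2 / 3) ^+ J :> R.
  by rewrite gerBl mulr_ge0 ?addr_ge0 ?mulr_ge0 ?exprn_ge0 ?divr_ge0.
elim: J => [|m IH]; first by rewrite big_ord0; ring.
by rewrite big_ord_recr /= IH natrD -[m.+1%:R]natr1 exprS; field.
Qed.

Lemma eps_le i : (i < J)%N -> eps i <= 88 * v%:R.
Proof.
move=> iJ; apply: le_trans sum_eps; rewrite (bigD1 (Ordinal iJ)) //= lerDl.
by apply: sumr_ge0 => j _; exact: eps_ge0.
Qed.

Definition etaC : R := 4 + 176 * v%:R + 2 * (88 * v%:R) ^+ 2.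

Lemma sum_eta : \sum_(i < J) eta i <= etaC.
Proof.
rewrite /eta !big_split /= -!mulr_sumr /etaC; apply: lerD; first apply: lerD.
- rewrite -[leRHS]mulr1 ler_wpM2l //; apply: le_trans (_ : \sum_(i < J) 2^-1 ^+ lp J i <= _).
    apply: ler_sum => i _; apply: ler_wiXn2l; rewrite ?leq_pmull ?(v_gt0 uv) //; lra.
  by apply: le_trans (sum_lp_geo J uv) _; apply: exprn_ile1; lra.
- have -> : 176 * v%:R = 2 * (88 * v%:R) :> R by ring.
  by rewrite ler_wpM2l // sum_eps.
- rewrite ler_wpM2l // expr2; apply: le_trans (_ : \sum_(i < J) (88 * v%:R) * eps i <= _).
    by apply: ler_sum => i _; rewrite expr2 ler_wpM2r ?eps_ge0 // eps_le.
  by rewrite -mulr_sumr ler_wpM2l ?mulr_ge0 // sum_eps.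
Qed.

(** The prime 2 becomes a block of its own, so that the blocks account for every integer up to
    [bd (J + c)]. *)
Definition pb (i : nat) : seq nat := if i is i'.+1 then blk i' else [:: 2%N].

Lemma pb_prime i : all prime (pb i). Proof. by case: i => // i; exact: blk_prime. Qed.
Lemma pb_uniq i : uniq (pb i). Proof. by case: i => // i; exact: blk_uniq. Qed.

Lemma blk_gt2 i p : p \in blk i -> (2 < p)%N.
Proof.
rewrite mem_blk => /and3P[_ h _]; apply: leq_ltn_trans h; exact: (bd_mono (leq0n i)).
Qed.

Lemma pb_disj i j : i != j -> disj (pb i) (pb j).
Proof.
case: i j => [|i] [|j] // ij p /=.
- by rewrite inE => /eqP ->; apply/negP => /blk_gt2.
- by move=> /blk_gt2 h; rewrite inE; apply/eqP => e; rewrite e in h.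
- by move: p; apply: blk_disj; rewrite -eqSS.
Qed.

Lemma bl_pb K : bl pb K.+1 = [:: 2%N] ++ bl blk K.
Proof. by elim: K => // K IH; rewrite /= in IH *; rewrite IH. Qed.

Lemma rB_half i : rB i <= 2^-1 :> R.
Proof.
apply: le_trans (rB_sum i.+1); rewrite big_ord_recr /= lerDr.
by apply: sumr_ge0 => j _; exact: rB_ge0.
Qed.

(** For the blocks from J on, which are absent from [P]. Each costs a bounded factor, and [c] of
    them suffice to reach [q]. *)
Lemma sum_one N i : \sum_(n < N | (pil (blk i)).-nat n) 1 / n%:R <= expR 5 :> R.
Proof.
have -> : \sum_(n < N | (pil (blk i)).-nat n) 1 / n%:R =
   \sum_(n < N | (pil (blk i)).-nat n) (\prod_(p <- blk i) (fun _ _ : nat => 1) p (logn p n)) / n%:R :> R.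
  by apply: eq_bigr => n _; rewrite big1.
apply: le_trans (euler_prod_le (phi := fun _ _ => 1) N (blk_prime i) (blk_uniq i) _) _ => //.
apply: le_trans (_ : expR (sB i + rB i) <= _); last first.
  by rewrite ler_expR; have := @sB_le4 R i; have := rB_half i; lra.
rewrite /sB /rB -big_split /= expR_sum big_seq [leRHS]big_seq.
apply: ler_prod => p pI; have [p3 pp p0] := invp_bounds (R := R) pI.
apply/andP; split; first by apply: sumr_ge0 => e _; rewrite divr_ge0 ?exprn_ge0 // ltW.
apply: le_trans (expR_ge1Dx _).
have i1 : 0 <= (p%:R : R)^-1 < 1 by rewrite invr_ge0 (ltW p0) /= invf_lt1 //; lra.
under eq_bigr => e _ do rewrite mul1r -exprVn.
apply: le_trans (geo_le N i1) _; rewrite pp.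
have n1 : p%:R != 0 :> R by rewrite gt_eqF.
have n2 : p%:R - 1 != 0 :> R by rewrite gt_eqF //; lra.
by apply: eqle; field; rewrite n1 n2.
Qed.

Variable c : nat.

(** The contributions of the prime 2, of [rB], of [eta] and of the last [c] blocks, in this order.
    It depends only on v and c. *)
Definition CS : R := 1 + (2^-1 + etaC * expR 384) + 5 * c%:R.

Lemma sum_prod_GP_sqr_le N : (N <= (bd (J + c)).+1)%N ->
  \sum_(n < N) (\prod_(i < J) GP N i n) ^+ 2 / n%:R <= expR (kk ^+ 2 * sJ J + CS).
Proof.
move=> hN.
(* The part of 0 is 1, so [maxn 1 n] is needed for [F] to depend only on the part of [n] in the
   block. *)
pose F i n : R := if i is i'.+1 then if (i' < J)%N then GP N i' (maxn 1 n) ^+ 2 else 1 else 1.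
have F0 i n : 0 <= F i n by rewrite /F; case: i => // i; case: ifP => // _; exact: sqr_ge0.
have Fp i n : F i (n`_(pil (pb i)))%N = F i n.
  case: i => //= i; case: ifP => // iJ; congr (_ ^+ 2).
  case: n => [|n]; first by rewrite partn0.
  have /maxn_idPr -> : (1 <= n.+1`_(pil (blk i)))%N by exact: part_gt0.
  by rewrite (maxn_idPr (ltn0Sn n)); exact: GG_part.
have -> : \sum_(n < N) (\prod_(i < J) GP N i n) ^+ 2 / n%:R =
   \sum_(n < N | (pil (bl pb (J + c).+1)).-nat n) (\prod_(i < (J + c).+1) F i n) / n%:R.
  rewrite [RHS]big_mkcond; apply: eq_bigr => n _.
  have [n0|] := ltnP 0 n; last by rewrite leqn0 => /eqP ->; rewrite invr0 !mulr0.
  rewrite bl_pb ifT; last by apply: bl_cover; rewrite n0 -ltnS (leq_trans (ltn_ord n)).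
  congr (_ / _); rewrite big_ord_recl mul1r -prodrXl.
  rewrite -!(big_mkord xpredT (fun i => GP N i n ^+ 2)).
  rewrite (eq_bigr (fun i : 'I_(J + c) => (fun i => if (i < J)%N then GP N i n ^+ 2 else 1) i)); last first.
    by move=> i _; rewrite lift0 /= (maxn_idPr n0).
  rewrite -(big_mkord xpredT (fun i => if (i < J)%N then GP N i n ^+ 2 else 1)).
  rewrite [RHS](big_cat_nat (n := J)) ?leq_addr //=.
  rewrite [X in _ * X]big_nat [X in _ * X]big1 ?mulr1; last by move=> i /andP[Ji _]; rewrite ltnNge Ji.
  by rewrite !big_nat; apply: eq_bigr => i /andP[_ ->].
apply: le_trans (b_part_le_prod pb_disj _ N F0 Fp) _.
rewrite big_ord_recl.
have h2 : \sum_(n < N | (pil [:: 2%N]).-nat n) 1 / n%:R <= 2 :> R.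
  have -> : \sum_(n < N | (pil [:: 2%N]).-nat n) 1 / n%:R =
   \sum_(n < N | (pil [:: 2%N]).-nat n) (\prod_(p <- [:: 2%N]) (fun _ _ : nat => 1) p (logn p n)) / n%:R :> R.
    by apply: eq_bigr => n _; rewrite big1.
  apply: le_trans (euler_prod_le (phi := fun _ _ => 1) N (pb_prime 0) (pb_uniq 0) _) _ => //.
  rewrite big_seq1; under eq_bigr => e _ do rewrite mul1r -exprVn.
  apply: le_trans (geo_le N _) _; first by apply/andP; split; lra.
  by apply: eqle; field.
have e1 : (2 : R) <= expR 1 by apply: le_trans (expR_ge1Dx _); lra.
apply: le_trans (_ : expR 1 * \prod_(i < J + c) expR (if (i < J)%N then kk ^+ 2 * sB i + rB i + eta i * expR 384 else 5) <= _).
  apply: ler_pM.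
  - by apply: sumr_ge0 => n _; apply: divr_ge0 => //; exact: (F0 0%N).
  - by apply: prodr_ge0 => i _; apply: sumr_ge0 => n _; apply: divr_ge0 => //; exact: F0.
  - exact: le_trans h2 e1.
  apply: ler_prod => i _; apply/andP; split.
    by apply: sumr_ge0 => n _; apply: divr_ge0 => //; exact: F0.
  rewrite lift0 /=; case: ifP => iJ; last exact: sum_one.
  apply: le_trans (sum_GP uv q0 N iJ); apply: eqle; apply: eq_bigr => n sn.
  by rewrite (maxn_idPr (pnat_gt0 sn)).
rewrite -expR_sum -expRD ler_expR.
rewrite -(big_mkord xpredT (fun i => if (i < J)%N then kk ^+ 2 * sB i + rB i + eta i * expR 384 else 5)).
rewrite (big_cat_nat (n := J)) ?leq_addr //=.
have -> : \sum_(J <= i < J + c) (if (i < J)%N then kk ^+ 2 * sB i + rB i + eta i * expR 384 else 5) = 5 * c%:R.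
  rewrite big_nat (eq_bigr (fun _ => 5)); last by move=> i /andP[Ji _]; rewrite ltnNge Ji.
  by rewrite -big_nat sumr_const_nat addKn [RHS]mulr_natr.
have -> : \sum_(0 <= i < J) (if (i < J)%N then kk ^+ 2 * sB i + rB i + eta i * expR 384 else 5) =
   kk ^+ 2 * sJ J + \sum_(i < J) rB i + (\sum_(i < J) eta i) * expR 384.
  rewrite big_nat (eq_bigr (fun i => kk ^+ 2 * sB i + rB i + eta i * expR 384)); last by move=> i /andP[_ ->].
  rewrite -big_nat big_mkord 2!big_split /= /sJ; congr (_ + _ + _); first by rewrite mulr_sumr.
  by rewrite mulr_suml.
have := @rB_sum R J; have := ler_wpM2r (expR_ge0 384) sum_eta; rewrite /CS; lra.
Qed.

End SumOfSquares.

(** * Dual sums *)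

Section ExpSums.
Context {R : realType}.

Lemma sin_le_id (x : R) : 0 <= x -> sin x <= x.
Proof.
rewrite le_eqVlt => /predU1P[<-|x0]; first by rewrite sin0.
have [|c _] := @MVT R sin cos 0 x x0 (fun y _ => is_derive_sin y).
  by apply: continuous_subspaceT => y; exact: continuous_sin.
by rewrite sin0 !subr0 => ->; rewrite ler_piMl ?cos_le1 // ltW.
Qed.

Lemma cos1_ge : 2^-1 <= cos 1 :> R.
Proof.
have h := cos2Dsin2 (2^-1 : R).
have -> : cos 1 = cos (2^-1 + 2^-1) :> R by congr cos; lra.
rewrite cosD.
have -> : cos (2^-1) * cos (2^-1) - sin (2^-1) * sin (2^-1) = 1 - 2 * sin (2^-1) ^+ 2 :> R.
  by rewrite -!expr2; lra.
have s1 : sin (2^-1) <= 2^-1 :> R by apply: sin_le_id; lra.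
have s0 : 0 <= sin (2^-1) :> R by apply: sin_ge0_pi; have := pi_ge2 R; lra.
by move: (sin _) s0 s1 => s s0 s1; nra.
Qed.

Lemma sin_ge_quarter (x : R) : 0 <= x <= pi / 2 -> x / 4 <= sin x.
Proof.
move=> /andP[]; rewrite le_eqVlt => /predU1P[<-|x0] x1; first by rewrite mul0r sin0.
have p2 := pi_ge2 R; have p4 := pihalf_lt2 R.
have low (y : R) : 0 < y -> y <= 1 -> y / 2 <= sin y.
  move=> y0 y1; have [|c] := @MVT R sin cos 0 y y0 (fun z _ => is_derive_sin z).
    by apply: continuous_subspaceT => z; exact: continuous_sin.
  rewrite in_itv /= => /andP[c0 cy]; rewrite sin0 !subr0 => ->.
  rewrite mulrC ler_wpM2r ?(ltW y0) //; apply: le_trans cos1_ge _; apply: ltW.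
  have i1 : c \in `[0, pi] by rewrite in_itv /=; apply/andP; split; lra.
  have i2 : (1 : R) \in `[0, pi] by rewrite in_itv /=; apply/andP; split; lra.
  by rewrite ltr_cos //; apply: lt_le_trans cy _.
have [x2|x2] := leP x 1; first by apply: le_trans (low x x0 x2); lra.
apply: le_trans (_ : 1 / 2 <= _); first by lra.
apply: le_trans (low 1 _ _) _ => //; apply: ltW.
have i1 : (1 : R) \in `[- (pi / 2), pi / 2] by rewrite in_itv /=; apply/andP; split; lra.
have i2 : x \in `[- (pi / 2), pi / 2] by rewrite in_itv /=; apply/andP; split; lra.
by rewrite ltr_sin.
Qed.

Variable q : nat.

Definition ec (k : nat) : R[i] := conjc (eN q k).

Lemma ecD a b : ec (a + b) = ec a * ec b. Proof. by rewrite /ec eND conj_M. Qed.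
Lemma nm_ec k : nm (ec k) = 1. Proof. by rewrite /ec nmJ nm_eN. Qed.
Lemma ec0 : ec 0 = 1. Proof. by rewrite /ec eN0 conjc1. Qed.

Lemma nm_1Bec r : (0 < q)%N -> nm (1 - ec r) = 2 * `|sin (pi * r%:R / q%:R)|.
Proof.
move=> q0; rewrite -nm_1Bcis.
have -> : 1 - ec r = conjc (1 - eN q r) by rewrite /ec (rmorphB (@conjc R)) (rmorph1 (@conjc R)).
rewrite nmJ /eN; congr (nm (1 - cis _)).
by rewrite -[RHS]mulr_natr -[pi *+ 2]mulr_natr; ring.
Qed.

Lemma ec_lower r : (0 < q)%N -> (2 * r <= q)%N -> r%:R / q%:R <= nm (1 - ec r).
Proof.
move=> q0 rq; rewrite nm_1Bec //.
have q1 : 0 < q%:R :> R by rewrite ltr0n.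
have t0 : 0 <= r%:R / q%:R :> R by rewrite divr_ge0.
have t1 : r%:R / q%:R <= 2^-1 :> R.
  rewrite ler_pdivrMr // mulrC ler_pdivlMr // mulrC -natrM ler_nat //.
have p2 := pi_ge2 R; rewrite -mulrA; move: (r%:R / q%:R) t0 t1 => t t0 t1.
have h : 0 <= pi * t <= pi / 2 by apply/andP; split; nra.
have := sin_ge_quarter h; have := ler_norm (sin (pi * t)); nra.
Qed.

Lemma ec_upper r : (0 < q)%N -> (2 * r <= q)%N -> nm (1 - ec r) <= 8 * (r%:R / q%:R).
Proof.
move=> q0 rq; rewrite nm_1Bec //.
have q1 : 0 < q%:R :> R by rewrite ltr0n.
have t0 : 0 <= r%:R / q%:R :> R by rewrite divr_ge0.
have t1 : r%:R / q%:R <= 2^-1 :> R.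
  rewrite ler_pdivrMr // mulrC ler_pdivlMr // mulrC -natrM ler_nat //.
have p2 := pihalf_lt2 R; have p3 := pi_ge2 R; rewrite -mulrA; move: (r%:R / q%:R) t0 t1 => t t0 t1.
have x0 : 0 <= pi * t by nra.
rewrite ger0_norm; last by apply: sin_ge0_pi; rewrite x0 /=; nra.
have := sin_le_id x0; nra.
Qed.

Lemma geom_bound r A n : (0 < q)%N -> (0 < r)%N -> (2 * r <= q)%N -> (A <= n)%N ->
  nm (\sum_(A <= N < n) ec (r * N)) <= 2 * q%:R / r%:R.
Proof.
move=> q0 r0 rq An.
have q1 : 0 < q%:R :> R by rewrite ltr0n.
have r1 : 0 < r%:R :> R by rewrite ltr0n.
have e : (1 - ec r) * \sum_(A <= N < n) ec (r * N) = ec (r * A) - ec (r * n).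
  rewrite mulr_sumr (@telescope_sumr_eq _ A n (fun N => - ec (r * N))) //; first by ring.
  by move=> N _; rewrite mulnS ecD; ring.
have l := ec_lower q0 rq.
have h : r%:R / q%:R * nm (\sum_(A <= N < n) ec (r * N)) <= 2.
  apply: le_trans (ler_wpM2r (nm_ge0 _) l) _; rewrite -nmM e.
  by apply: le_trans (nmB _ _) _; rewrite !nm_ec.
rewrite ler_pdivlMr // mulrC; move: h; rewrite mulrAC ler_pdivrMr //.
Qed.

(** The part above the cutoff of the sum of N^(-1/2) e(-rN/q), ended at [Y]. *)
Definition dual_tail (Y K r : nat) : R[i] := \sum_(K <= N < Y) (isq N)%:C * ec (r * N).

Lemma dual_tail_le_cutoff Y K r : (0 < q)%N -> (0 < r)%N -> (2 * r <= q)%N -> (0 < K)%N ->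
  nm (dual_tail Y K r) <= 2 * q%:R / r%:R * isq K.
Proof.
move=> q0 r0 rq K0; apply: abel_bound; last exact: isq_ge0.
  by move=> n Kn; rewrite isq_ge0 isq_le // (leq_trans K0).
by move=> n Kn; exact: geom_bound.
Qed.

Lemma dual_tail_split Y K K' r : (K <= K')%N -> nm (dual_tail Y K r - dual_tail Y K' r) <= \sum_(K <= N < K') isq N.
Proof.
move=> KK; rewrite /dual_tail.
have [KY|YK] := leqP K' Y.
  rewrite (big_cat_nat (n := K')) //= addrK.
  apply: le_trans (nm_sum _ _ _) _; apply: ler_sum => N _.
  by rewrite nmM nm_ec mulr1 nmC ger0_norm ?isq_ge0.
rewrite [X in _ - X]big_geq ?(ltnW YK) // subr0.
apply: le_trans (nm_sum _ _ _) _.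
apply: le_trans (_ : \sum_(K <= N < Y) isq N <= _).
  apply: ler_sum => N _; by rewrite nmM nm_ec mulr1 nmC ger0_norm ?isq_ge0.
have [KY|YK'] := leqP K Y.
  rewrite [leRHS](big_cat_nat (n := Y)) ?(ltnW YK) //= lerDl sumr_ge0 // => N _; exact: isq_ge0.
by rewrite big_geq ?(ltnW YK') // sumr_ge0 // => N _; exact: isq_ge0.
Qed.

(** Terms up to about q/r are bounded trivially, the rest by Abel summation. The bound is sqrt q
    times r^(-1/2), whatever the cutoff: as a function of r the dual sum has the shape of the
    original one. *)
Lemma dual_tail_le_sqrt Y K r : (0 < q)%N -> (0 < r)%N -> (2 * r <= q)%N -> (0 < K)%N ->
  nm (dual_tail Y K r) <= 6 * Num.sqrt (q%:R / r%:R).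
Proof.
move=> q0 r0 rq K0.
have q1 : 0 < q%:R :> R by rewrite ltr0n.
have r1 : 0 < r%:R :> R by rewrite ltr0n.
pose K0' := (q %/ r).+1.
set s := Num.sqrt (q%:R / r%:R).
have s2 : s ^+ 2 = q%:R / r%:R by rewrite sqr_sqrtr // divr_ge0 // ltW.
have s0 : 0 < s by rewrite sqrtr_gt0 divr_gt0.
have far L : (K0' <= L)%N -> nm (dual_tail Y L r) <= 2 * s.
  move=> KL; have L0 : (0 < L)%N by apply: leq_trans KL.
  apply: le_trans (dual_tail_le_cutoff Y q0 r0 rq L0) _.
  rewrite -mulrA -/(q%:R / r%:R) mulrA -[2 * q%:R / r%:R]mulrA -s2.
  have : isq L * s <= 1.
    rewrite /isq mulrC ler_pdivrMr ?sqrtr_gt0 ?ltr0n // mul1r ler_wsqrtr //.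
    rewrite ler_pdivrMr // -natrM ler_nat; apply: leq_trans (ltnW (ltn_ceil q r0)) _.
    by rewrite leq_mul2r KL orbT.
  by have := isq_ge0 (R := R) L; move: (isq L) => i i0 h; nra.
have [KL|LK] := leqP K0' K; first by apply: le_trans (far K KL) _; nra.
have -> : dual_tail Y K r = (dual_tail Y K r - dual_tail Y K0' r) + dual_tail Y K0' r by ring.
apply: le_trans (nmD _ _) _.
have -> : 6 * s = 4 * s + 2 * s by ring.
apply: lerD; last exact: far.
apply: le_trans (dual_tail_split _ _ (ltnW LK)) _.
apply: le_trans (_ : \sum_(0 <= N < K0') isq N <= _).
  rewrite [leRHS](big_cat_nat (n := K)) ?(ltnW LK) //= lerDr sumr_ge0 // => N _; exact: isq_ge0.
rewrite big_mkord; apply: le_trans (sum_isq_le _) _.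
have -> : 4 * s = 2 * (2 * s) by ring.
rewrite ler_wpM2l // -(ler_pXn2r (n := 2)) ?nnegrE ?sqrtr_ge0 ?mulr_ge0 ?(ltW s0) //.
rewrite sqr_sqrtr // exprMn s2 /K0' -natr1.
have d1 : (q %/ r)%:R <= q%:R / r%:R :> R.
  by rewrite ler_pdivlMr // -natrM ler_nat leq_divM.
have d2 : 1 <= q%:R / r%:R :> R.
  by rewrite ler_pdivlMr // mul1r ler_nat; lia.
lra.
Qed.

Lemma dual_tail_conj Y K r : (0 < q)%N -> (r <= q)%N -> dual_tail Y K (q - r) = conjc (dual_tail Y K r).
Proof.
move=> q0 rq; rewrite /dual_tail conj_sum; apply: eq_bigr => N _.
rewrite conj_M conjc_real; congr (_ * _).
have h : eN q (r * N) * eN q ((q - r) * N) = 1 :> R[i].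
  by rewrite -eND -mulnDl subnKC // eNX eNN // expr1n.
have h2 := eN_conjM (R := R) q (r * N).
have nz : eN q (r * N) != 0 :> R[i].
  apply/eqP => e; move: h; rewrite e mul0r => /eqP; rewrite eq_sym oner_eq0 //.
have e1 : eN q ((q - r) * N) = conjc (eN q (r * N)) :> R[i] by apply: (mulfI nz); rewrite h h2.
by rewrite /ec e1.
Qed.

End ExpSums.

(** * Rescaling the dual sum by an integer *)

Section Scaling.
Context {R : realType} (q : nat).
Hypothesis q0 : (0 < q)%N.
Local Notation ec := (@ec R q).
Local Notation dual_tail := (@dual_tail R q).

Lemma sum_blocks_from (V : nmodType) (f : nat -> V) m K Y : (K <= Y)%N ->
  \sum_(m * K <= N < m * Y) f N = \sum_(K <= k < Y) \sum_(i < m) f (m * k + i)%N.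
Proof.
move=> KY; rewrite -(subnKC KY); elim: (Y - K)%N => [|d IH].
  by rewrite addn0 !big_geq.
rewrite addnS big_nat_recr ?leq_addr //= -IH (big_cat_nat (n := (m * (K + d))%N)) /=; last 2 first.
- by rewrite leq_mul2l leq_addr orbT.
- by rewrite leq_mul2l leqnSn orbT.
congr (_ + _); rewrite mulnS; move: (m * (K + d))%N => z.
rewrite -{1}[z]add0n big_addn addnK big_mkord.
by apply: eq_bigr => i _; rewrite addnC.
Qed.

Lemma nm_1Bec_mul r i : nm (1 - ec (r * i)) <= i%:R * nm (1 - ec r).
Proof.
elim: i => [|i IH]; first by rewrite muln0 ec0 subrr nm0 mul0r.
have -> : 1 - ec (r * i.+1) = (1 - ec r) + ec r * (1 - ec (r * i)) by rewrite mulnS ecD; ring.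
by apply: le_trans (nmD _ _) _; rewrite nmM nm_ec mul1r -natr1 mulrDl mul1r addrC lerD.
Qed.

Lemma isqK m K : (0 < m)%N -> isq K = isq m * (m%:R * isq (m * K)) :> R.
Proof.
move=> m0; rewrite isqM; have := sqr_isq (R := R) m; rewrite expr2 => h.
have nz : m%:R != 0 :> R by rewrite pnatr_eq0 -lt0n.
have -> : isq m * (m%:R * (isq m * isq K)) = (isq m * isq m) * m%:R * isq K :> R by ring.
by rewrite h mulVf // mul1r.
Qed.

Lemma dual_tail_block m r K1 Y : (0 < m)%N -> (0 < r)%N -> (2 * (r * m) <= q)%N -> (0 < K1)%N -> (K1 <= Y)%N ->
  nm ((isq m)%:C * dual_tail (m * Y) (m * K1) r - dual_tail Y K1 (r * m)) <= 17 * isq K1.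
Proof.
move=> m0 r0 rmq K0 KY.
have mR : 0 < m%:R :> R by rewrite ltr0n.
have qR : 0 < q%:R :> R by rewrite ltr0n.
have rR : 0 < r%:R :> R by rewrite ltr0n.
(* [T1] is the error of freezing the weight within a block of [m] terms and telescopes to [isq K1];
   [T2] is that of freezing the phase and costs [16 * isq K1]. *)
pose T1 := \sum_(K1 <= k < Y) ec (r * m * k) *
   ((isq m)%:C * \sum_(i < m) (isq (m * k + i) - isq (m * k))%:C * ec (r * i)).
pose T2 := (m%:R^-1)%:C * (\sum_(i < m) (ec (r * i) - 1)) * dual_tail Y K1 (r * m).
have -> : (isq m)%:C * dual_tail (m * Y) (m * K1) r - dual_tail Y K1 (r * m) = T1 + T2.
  rewrite /dual_tail sum_blocks_from // /T1 /T2 /dual_tail mulr_sumr mulr_sumr -sumrB -big_split /=.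
  apply: eq_bigr => k _.
  have e1 : \sum_(i < m) (isq (m * k + i))%:C * ec (r * (m * k + i)) =
     ec (r * m * k) * \sum_(i < m) (isq (m * k + i))%:C * ec (r * i).
    rewrite mulr_sumr; apply: eq_bigr => i _.
    by rewrite mulnDr ecD mulnA; ring.
  have e2 : \sum_(i < m) (isq (m * k + i) - isq (m * k))%:C * ec (r * i) =
     \sum_(i < m) (isq (m * k + i))%:C * ec (r * i) - (isq (m * k))%:C * \sum_(i < m) ec (r * i).
    by rewrite mulr_sumr -sumrB; apply: eq_bigr => i _; rewrite rmorphB /= mulrBl.
  have e3 : \sum_(i < m) (ec (r * i) - 1) = \sum_(i < m) ec (r * i) - m%:R.
    by rewrite sumrB sumr_const card_ord.
  rewrite e1 e2 e3; have ik := isqK k m0.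
  have e4 : (isq k)%:C = (isq m)%:C * (m%:R * (isq (m * k))%:C) :> R[i].
    by rewrite {1}ik !C_M rmorph_nat.
  have e5 : (m%:R^-1)%:C * (m%:R : R[i]) = 1.
    by rewrite -(rmorph_nat (real_complex R)) -C_M mulVf ?gt_eqF.
  have e6 : (m%:R^-1)%:C * (isq k)%:C = (isq m)%:C * (isq (m * k))%:C :> R[i].
    rewrite e4; transitivity (((m%:R^-1)%:C * m%:R) * ((isq m)%:C * (isq (m * k))%:C) : R[i]); first by ring.
    by rewrite e5 mul1r.
  have e7 : (isq k)%:C = (m%:R^-1)%:C * m%:R * (isq k)%:C :> R[i] by rewrite e5 mul1r.
  set S := \sum_(i < m) ec (r * i); set S2 := \sum_(i < m) _ * _.
  have -> : (m%:R^-1)%:C * (S - m%:R) * ((isq k)%:C * ec (r * m * k)) =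
     ((m%:R^-1)%:C * (isq k)%:C) * S * ec (r * m * k) - ((m%:R^-1)%:C * m%:R * (isq k)%:C) * ec (r * m * k).
    by ring.
  by rewrite -e7 e6; ring.
apply: le_trans (nmD _ _) _; have -> : 17 * isq K1 = isq K1 + 16 * isq K1 :> R by ring.
apply: lerD.
  apply: le_trans (nm_sum _ _ _) _.
  apply: le_trans (_ : \sum_(K1 <= k < Y) isq m * (m%:R * (isq (m * k) - isq (m * k.+1))) <= _).
    rewrite !big_nat; apply: ler_sum => k /andP[Kk _].
    have mk : (0 < m * k)%N by rewrite muln_gt0 m0 (leq_trans K0).
    rewrite !nmM nm_ec mul1r nmC ger0_norm ?isq_ge0 // ler_wpM2l ?isq_ge0 //.
    apply: le_trans (nm_sum _ _ _) _.
    apply: le_trans (_ : \sum_(i < m) (isq (m * k) - isq (m * k.+1)) <= _); last first.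
      by rewrite sumr_const card_ord mulr_natl.
    apply: ler_sum => i _; rewrite nmM nm_ec mulr1 nmC distrC ger0_norm; last first.
      by rewrite subr_ge0 isq_le // leq_addr.
    rewrite lerD2l lerN2 isq_le //; first by rewrite ltn_addr.
    by rewrite mulnS addnC leq_add2r ltnW.
  rewrite -mulr_sumr -mulr_sumr (@telescope_sumr_eq _ K1 Y (fun k => - isq (m * k))) //; last first.
    by move=> k _; ring.
  rewrite [leRHS](isqK K1 m0) ler_wpM2l ?isq_ge0 // ler_wpM2l //.
  by have := isq_ge0 (R := R) (m * Y); lra.
have rq2 : (2 * r <= q)%N.
  by apply: leq_trans rmq; rewrite leq_mul2l /= leq_pmulr.
rewrite /T2 !nmM nmC ger0_norm ?invr_ge0 //.
have b1 : nm (\sum_(i < m) (ec (r * i) - 1)) <= m%:R * (m%:R * (8 * (r%:R / q%:R))).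
  apply: le_trans (nm_sum _ _ _) _.
  apply: le_trans (_ : \sum_(i < m) (m%:R * (8 * (r%:R / q%:R))) <= _); last by rewrite sumr_const card_ord [leRHS]mulr_natl.
  apply: ler_sum => i _; rewrite nm_subC; apply: le_trans (nm_1Bec_mul _ _) _.
  apply: ler_pM => //; rewrite ?nm_ge0 //; first by rewrite ler_nat ltnW.
  exact: ec_upper.
have rm0 : (0 < r * m)%N by rewrite muln_gt0 r0 m0.
have b2 := dual_tail_le_cutoff (R := R) Y q0 rm0 rmq K0.
apply: le_trans (_ : m%:R^-1 * (m%:R * (m%:R * (8 * (r%:R / q%:R)))) * (2 * q%:R / (r * m)%:R * isq K1) <= _).
  apply: ler_pM => //; rewrite ?mulr_ge0 ?invr_ge0 ?nm_ge0 //.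
  by rewrite ler_wpM2l ?invr_ge0.
apply: eqle; rewrite natrM; field.
by rewrite !gt_eqF.
Qed.

(* Blocks of [m] consecutive terms on the left correspond to single terms on the
   right: within such a block the phase and the weight hardly change. *)
Lemma dual_tail_scale m r K K1 Y : (0 < m)%N -> (0 < r)%N -> (2 * (r * m) <= q)%N ->
  (0 < K)%N -> (0 < K1)%N -> (K <= m * K1 <= K + m)%N -> (m * K1 <= Y)%N ->
  nm ((isq m)%:C * dual_tail Y K r - dual_tail Y K1 (r * m)) <=
  m%:R * isq K + 2 * q%:R * isq Y + 17 * isq K1.
Proof.
move=> m0 r0 rmq K0 K10 /andP[KmK mKK] mKY.
have KY : (K1 <= Y)%N by apply: leq_trans mKY; rewrite leq_pmull.
have Y0 : (0 < Y)%N by apply: leq_trans KY.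
have rq2 : (2 * r <= q)%N.
  by apply: leq_trans rmq; rewrite leq_mul2l /= leq_pmulr.
have -> : (isq m)%:C * dual_tail Y K r - dual_tail Y K1 (r * m) =
  (isq m)%:C * (dual_tail Y K r - dual_tail Y (m * K1) r) - (isq m)%:C * dual_tail (m * Y) Y r +
  ((isq m)%:C * dual_tail (m * Y) (m * K1) r - dual_tail Y K1 (r * m)).
  have -> : dual_tail (m * Y) (m * K1) r = dual_tail Y (m * K1) r + dual_tail (m * Y) Y r.
    by rewrite /dual_tail (big_cat_nat (n := Y)) // leq_pmull.
  by ring.
apply: le_trans (nmD _ _) _; apply: lerD; last exact: dual_tail_block.
have im : nm ((isq m)%:C : R[i]) <= 1 by rewrite nmC ger0_norm ?isq_ge0 ?isq_le1.
apply: le_trans (nmB _ _) _; rewrite !nmM; apply: lerD.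
  rewrite -[leRHS]mul1r ler_pM ?nm_ge0 //.
  apply: le_trans (dual_tail_split _ _ _ KmK) _.
  apply: le_trans (_ : \sum_(K <= N < m * K1) isq K <= _).
    by rewrite !big_nat; apply: ler_sum => N /andP[KN _]; apply: isq_le.
  by rewrite sumr_const_nat -[isq K *+ _]mulr_natr mulrC ler_wpM2r ?isq_ge0 // ler_nat leq_subLR.
rewrite -[leRHS]mul1r ler_pM ?nm_ge0 //.
apply: le_trans (dual_tail_le_cutoff _ q0 r0 rq2 Y0) _.
rewrite ler_wpM2r ?isq_ge0 // ler_pdivrMr ?ltr0n //.
by rewrite ler_peMr ?mulr_ge0 // ler1n.
Qed.

End Scaling.

(** * The moment of L P *)

Section Cutoffs.
Context {R : realType} (q J v : nat).
Hypothesis q0 : (0 < q)%N.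
Hypothesis v0 : (0 < v)%N.
Local Notation QQ := (QQ J q).
Local Notation lam := (lam J q).
Local Notation Ms := (Ms J q).
Local Notation y := (ylen v J).

(* [Xi z = sqrt q * 2 ^ (z / QQ)]; [Itot] is the largest possible [z]. *)
Definition rho : R := ln 2 / QQ%:R.
Definition Xi (z : int) : R := Num.sqrt q%:R * expR (rho * z%:~R).
Definition Lmb m : nat := Lam lam (bl blk J) m.
Definition om m : nat := Om (bl blk J) m.
Definition Itot : nat := (\sum_(i < J) Ms i)%N.

Lemma QQ_gt0 : (0 < QQ)%N. Proof. by rewrite /QQ muln_gt0 q0 expn_gt0. Qed.

Lemma ln2_gt0 : 0 < ln 2 :> R. Proof. by rewrite ln_gt0 // ltr1n. Qed.

Lemma rho_gt0 : 0 < rho. Proof. by rewrite divr_gt0 ?ln2_gt0 // ltr0n QQ_gt0. Qed.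

Lemma expR_ln2 (n : nat) : expR (ln 2 * n%:R) = 2 ^+ n :> R.
Proof. by rewrite expRM_natr lnK // posrE. Qed.

Lemma rho_pow (n : nat) : expR (rho * n%:R) ^+ QQ = 2 ^+ n.
Proof.
rewrite -expRM_natr -expR_ln2; congr expR; rewrite /rho.
have h : QQ%:R != 0 :> R by rewrite pnatr_eq0 -lt0n QQ_gt0.
by field.
Qed.

Lemma lam_low p : (0 < p)%N -> expR (rho * (lam p)%:R) <= p%:R.
Proof.
move=> p0; rewrite -(ler_pXn2r QQ_gt0) ?nnegrE ?expR_ge0 // rho_pow -!natrX ler_nat.
by apply: trunc_logP => //; rewrite expn_gt0 p0.
Qed.

Lemma lam_high p : (0 < p)%N -> p%:R <= expR (rho * (lam p + 1)%:R).
Proof.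
move=> p0; rewrite -(ler_pXn2r QQ_gt0) ?nnegrE ?expR_ge0 // rho_pow -!natrX ler_nat ltnW //.
by rewrite addn1; apply: trunc_log_ltn.
Qed.

Lemma prime_bl_gt0 p : p \in bl blk J -> (0 < p)%N.
Proof. by move=> /bl_gt2; apply: leq_trans. Qed.

Lemma Lmb_low m : (pil (bl blk J)).-nat m -> expR (rho * (Lmb m)%:R) <= m%:R.
Proof.
move=> sm; rewrite [in leRHS](pnatE (bl_uniq J) (bl_prime J) sm) /Lmb /Lam natr_sum mulr_sumr expR_sum natr_prod.
rewrite big_seq [leRHS]big_seq; apply: ler_prod => p pI; rewrite expR_ge0 /= natrX natrM.
have -> : rho * ((logn p m)%:R * (lam p)%:R) = (rho * (lam p)%:R) * (logn p m)%:R by ring.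
by rewrite expRM_natr lerXn2r ?nnegrE ?expR_ge0 // lam_low // prime_bl_gt0.
Qed.

(** Rounding logarithms down loses at most one unit per prime factor, hence [om m] units in all. *)
Lemma Lmb_high m : (pil (bl blk J)).-nat m -> m%:R <= expR (rho * (Lmb m + om m)%:R).
Proof.
move=> sm; rewrite [in leLHS](pnatE (bl_uniq J) (bl_prime J) sm) /Lmb /om /Lam /Om -big_split /=.
rewrite natr_sum mulr_sumr expR_sum natr_prod.
rewrite big_seq [leRHS]big_seq; apply: ler_prod => p pI; rewrite ler0n /= natrX.
have -> : rho * (logn p m * lam p + logn p m)%:R = (rho * (lam p + 1)%:R) * (logn p m)%:R.
  by rewrite !natrD natrM; ring.
by rewrite expRM_natr lerXn2r ?nnegrE ?expR_ge0 // lam_high // prime_bl_gt0.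
Qed.

Lemma om_le m : (0 < m)%N -> (om m <= m)%N.
Proof.
move=> m0; apply: leq_trans (_ : 2 ^ om m <= _)%N; first exact/ltnW/ltn_expl.
apply: Om_expn_le => //; [exact: bl_uniq|exact: bl_prime|].
by move=> p /bl_gt2 /ltnW.
Qed.

Lemma XiD z (h : nat) : Xi (z + h%:Z) = Xi z * expR (rho * h%:R).
Proof. by rewrite /Xi rmorphD /= mulrDr expRD mulrA. Qed.

Lemma Xi_gt0 z : 0 < Xi z.
Proof. by rewrite mulr_gt0 ?expR_gt0 // sqrtr_gt0 ltr0n. Qed.

Lemma Xi_ge z : 0 <= z -> Num.sqrt q%:R <= Xi z.
Proof.
move=> z0; rewrite /Xi ler_peMr ?sqrtr_ge0 // -[leLHS]expR0 ler_expR.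
by apply: mulr_ge0; [exact: ltW rho_gt0|rewrite ler0z].
Qed.

Lemma Itot_le : (Itot <= 3 * (q * 4 ^ J))%N.
Proof.
rewrite /Itot /Ms.
suff : (\sum_(i < J) 4 ^ i * 3 ^ (J - i) <= 3 * 4 ^ J)%N.
  move=> h; rewrite (eq_bigr (fun i : 'I_J => q * (4 ^ i * 3 ^ (J - i)))%N); last by move=> i _; rewrite mulnA.
  by rewrite -big_distrr /= mulnCA leq_mul2l h orbT.
suff : (\sum_(i < J) 4 ^ i * 3 ^ (J - i) + 3 * 3 ^ J = 3 * 4 ^ J)%N by move=> <-; exact: leq_addr.
elim: J => [|m IH]; first by rewrite big_ord0.
rewrite big_ord_recr /= subSnn expn1.
have -> : (\sum_(i < m) 4 ^ i * 3 ^ (m.+1 - i) = 3 * \sum_(i < m) 4 ^ i * 3 ^ (m - i))%N.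
  rewrite big_distrr /=; apply: eq_bigr => i _.
  by rewrite subSn ?(ltnW (ltn_ord i)) // expnS mulnCA.
by rewrite !expnS; move: IH; set a := (\sum_(i < m) _)%N; lia.
Qed.

(** In units of 1/[QQ] the windows add up to at most 3 q 4^J, that is 3 * 2^J powers of 2, fewer
    than the exponent of [ylen]. *)
Lemma Xi_le z : z <= Itot%:Z -> Xi z <= Num.sqrt q%:R * y%:R.
Proof.
move=> zI; rewrite /Xi ler_wpM2l ?sqrtr_ge0 //.
apply: le_trans (_ : expR (rho * (3 * (q * 4 ^ J))%:R) <= _).
  rewrite ler_expR ler_wpM2l ?(ltW rho_gt0) //.
  apply: le_trans (_ : (Itot%:Z)%:~R <= _); first by rewrite ler_int.
  by rewrite -pmulrn ler_nat Itot_le.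
have -> : rho * (3 * (q * 4 ^ J))%:R = ln 2 * (3 * 2 ^ J)%:R.
  rewrite /rho /QQ !natrM !natrX.
  have -> : (4 : R) ^+ J = 2 ^+ J * 2 ^+ J by rewrite -exprMn; congr (_ ^+ _); ring.
  have h1 : q%:R != 0 :> R by rewrite pnatr_eq0 -lt0n.
  have h2 : (2 : R) ^+ J != 0 by rewrite expf_neq0.
  by field; rewrite h1 h2.
rewrite expR_ln2 -natrX ler_nat /ylen leq_exp2l // leq_mul2r; apply/orP; right.
by apply: leq_trans (_ : 40 * 1 <= _)%N => //; rewrite leq_mul2l.
Qed.

End Cutoffs.

Section AvRange.
Context {R : realType}.
Implicit Types (F : int -> R[i]).

Lemma AvL_range (Ms : nat -> nat) J F (C : R) x : (forall i, 0 < Ms i)%N ->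
  (forall z, x <= z <= x + (\sum_(i < J) Ms i)%N%:Z -> nm (F z) <= C) ->
  nm (AvL Ms J F x) <= C.
Proof.
move=> M0; elim: J F => [|J IH] F hF /=.
  by apply: hF; rewrite big_ord0 addr0 lexx.
apply: IH => z /andP[xz zx]; have := M0 J; case M : (Ms J) => [|m] // _.
rewrite /Av nmM nmC ger0_norm ?invr_ge0 // mulrC ler_pdivrMr ?ltr0n //.
apply: le_trans (nm_sum _ _ _) _; apply: le_trans (_ : \sum_(i < m.+1) C <= _).
  apply: ler_sum => i _; apply: hF; rewrite (le_trans xz) ?lerDl //=.
  rewrite big_ord_recr /= PoszD addrA lerD // M lez_nat; exact: ltnW.
by rewrite sumr_const card_ord mulr_natr.
Qed.

Lemma AvL_sub Ms J F (G : int -> R[i]) x :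
  AvL Ms J F x - AvL Ms J G x = AvL Ms J (fun z => F z - G z) x.
Proof.
have h := AvL_lin (index_enum bool) xpredT (fun b : bool => if b then 1 else -1)
  (fun b : bool => if b then F else G) Ms J x.
rewrite !big_bool /= mul1r mulN1r in h; rewrite -h; congr (AvL _ _ _ x).
by apply/funext => z; rewrite big_bool /= mul1r mulN1r.
Qed.

Lemma AvL_const Ms J (k : R[i]) x : (forall i, 0 < Ms i)%N -> AvL Ms J (fun=> k) x = k.
Proof.
move=> M0; elim: J => // J IH /=; rewrite -[RHS]IH; congr (AvL _ _ _ x).
apply/funext => z; rewrite /Av sumr_const card_ord -[k *+ _]mulr_natl mulrA.
rewrite -(rmorph_nat (real_complex R)) -C_M mulVf ?mul1r //.
by rewrite pnatr_eq0 -lt0n.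
Qed.

Lemma AvL_conj Ms J F x : AvL Ms J (fun z => conjc (F z)) x = conjc (AvL Ms J F x).
Proof.
elim: J F => // J IH F /=; rewrite -IH; congr (AvL _ _ _ x).
by apply/funext => z; rewrite /Av conj_M conjc_real conj_sum.
Qed.

(** A shift by [w] is made of [w] unit steps, and each of them telescopes over the window to a
    difference of two values of [g]. *)
Lemma Av_window (g : int -> R) (D : int -> R[i]) M (w : nat) x : (0 < M)%N ->
  (forall z, 0 <= g z <= 1) -> (forall z, nm (D z) <= g (z + w%:Z) - g z) ->
  nm (Av M D x) <= w%:R / M%:R.
Proof.
move=> M0 g01 hD; rewrite /Av nmM nmC ger0_norm ?invr_ge0 // mulrC ler_wpM2r ?invr_ge0 //.
apply: le_trans (nm_sum _ _ _) _.
apply: le_trans (_ : \sum_(i < M) (g (x + i%:Z + w%:Z) - g (x + i%:Z)) <= _).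
  by apply: ler_sum => i _.
elim: w {hD} => [|w IH].
  by rewrite big1 // => i _; rewrite addr0 subrr.
have -> : \sum_(i < M) (g (x + i%:Z + w.+1%:Z) - g (x + i%:Z)) =
   \sum_(i < M) (g (x + i%:Z + w%:Z) - g (x + i%:Z)) +
   \sum_(i < M) (g (x + i%:Z + w.+1%:Z) - g (x + i%:Z + w%:Z)).
  by rewrite -big_split /=; apply: eq_bigr => i _; ring.
rewrite -[w.+1%:R]natr1; apply: lerD => //.
rewrite -(big_mkord xpredT (fun i => g (x + i%:Z + w.+1%:Z) - g (x + i%:Z + w%:Z))).
rewrite (@telescope_sumr_eq _ 0 M (fun i : nat => g (x + i%:Z + w%:Z))) //.
  by have /andP[a _] := g01 (x + 0%:Z + w%:Z); have /andP[_ b] := g01 (x + M%:Z + w%:Z); lra.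
move=> i _; congr (g _ - _); rewrite -[w.+1]add1n -[i.+1]add1n !PoszD; ring.
Qed.

Lemma mult_reindex (V : nmodType) N m (G : nat -> nat -> V) : (0 < m)%N ->
  \sum_(n < N | (m %| n)%N) G (n %/ m)%N n = \sum_(a < N | (a * m < N)%N) G a (a * m)%N.
Proof.
case: N => [|N] m0; first by rewrite !big_ord0.
pose h (n : 'I_N.+1) : 'I_N.+1 := inord (n %/ m)%N.
pose h' (a : 'I_N.+1) : 'I_N.+1 := inord (a * m)%N.
have ld (n : 'I_N.+1) : (n %/ m < N.+1)%N by apply: leq_ltn_trans (leq_div _ _) _.
have key (n : 'I_N.+1) : (h n * m < N.+1)%N && (h' (h n) == n) = (m %| n)%N.
  rewrite /h inordK //; apply/andP/idP => [[lt /eqP e]|mn].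
    by move/(congr1 val): e; rewrite /h' /= [X in (X * m)%N]inordK // inordK // => <-; rewrite dvdn_mull.
  rewrite divnK // ltn_ord; split => //; apply/eqP/val_inj.
  by rewrite /h' /= [X in (X * m)%N]inordK // inordK divnK.
rewrite [RHS](reindex_onto h h') => [|a am].
  apply: eq_big => [n|n mn]; first by rewrite key.
  by rewrite /h inordK // divnK.
by apply/val_inj; rewrite /h /h' /= [X in (X %/ m)%N]inordK // mulnK // inordK.
Qed.

Lemma conv_sum (al be psi : nat -> R[i]) N : cmul psi -> be 0%N = 0 ->
  (forall a b, al a != 0 -> be b != 0 -> (a * b < N)%N) ->
  (\sum_(a < N) al a * psi a) * (\sum_(b < N) be b * psi b) =
  \sum_(n < N) (\sum_(m < N | (m %| n)%N) be m * al (n %/ m)%N) * psi n.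
Proof.
move=> [_ pM] b0 sup.
transitivity (\sum_(m < N) \sum_(n < N | (m %| n)%N) be m * al (n %/ m)%N * psi n); last first.
  rewrite (exchange_big_dep xpredT) //=; apply: eq_bigr => n _.
  by rewrite mulr_suml.
rewrite mulrC mulr_suml; apply: eq_bigr => m _.
have [bm|bm] := eqVneq (be m) 0.
  by rewrite bm !mul0r big1 // => n _; rewrite !mul0r.
have m0 : (0 < m)%N by rewrite lt0n; apply: contraNneq bm => ->; rewrite b0.
rewrite (mult_reindex N (fun a n => be m * al a * psi n) m0) mulr_sumr [RHS]big_mkcond.
apply: eq_bigr => a _; rewrite pM; case: ltnP => [_|aN]; first by ring.
have [->|aa] := eqVneq (al a) 0; first by rewrite !(mul0r, mulr0).
by have := sup a m aa bm; rewrite ltnNge aN.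
Qed.

End AvRange.

(** * The sum below the cutoff *)

Section DirectPart.
Context {R : realType} (q : nat) (q_pr : prime q) (u v J c : nat).
Hypothesis uv : (0 < u < v)%N.
Hypothesis J0 : (0 < J)%N.
Hypothesis hqb : (q <= bd (J + c))%N.
Local Notation y := (ylen v J).
Hypothesis hy : (y ^ 100 <= q)%N.
Local Notation PP := (PP u v J : nat -> {poly R}).
Local Notation kk := (kk u v : R).
Local Notation cf := (cf J).
Local Notation DP := (DP J).
Local Notation X := (@X R q q_pr).
Local Notation psi := (@psi R q q_pr).
Local Notation rho := (rho q J : R).
Local Notation Xi := (Xi q J : int -> R).
Local Notation Lmb := (Lmb q J).
Local Notation om := (om J).
Local Notation GP := (GP u v J q : nat -> nat -> nat -> R).
Local Notation s := (Num.sqrt q%:R : R).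
Local Notation GG := (expR (kk ^+ 2 * sJ J + CS v c) : R).

Let q0 : (0 < q)%N. Proof. exact: prime_gt0. Qed.
Let v0 : (0 < v)%N. Proof. exact: v_gt0 uv. Qed.

Lemma y_ge : (2 ^ 40 <= y)%N.
Proof.
by rewrite /ylen leq_exp2l // -mulnA -{1}[40%N]muln1 leq_mul2l muln_gt0 v0 expn_gt0.
Qed.

Lemma yq : (y < q)%N.
Proof.
apply: leq_trans hy; rewrite -{1}[y]expn1 ltn_exp2l //.
by apply: leq_trans y_ge; rewrite -{1}(expn0 2) ltn_exp2l.
Qed.

Lemma sq_q : s ^+ 2 = q%:R. Proof. by rewrite sqr_sqrtr. Qed.

Lemma s_ge k : (2 * k <= 100)%N -> y%:R ^+ k <= s.
Proof.
move=> k2; rewrite -(ler_pXn2r (n := 2)) ?nnegrE ?sqrtr_ge0 ?exprn_ge0 //.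
rewrite sq_q -exprM -natrX ler_nat; apply: leq_trans hy; rewrite leq_exp2l; last first.
  by apply: leq_trans y_ge; rewrite -{1}(expn0 2) ltn_exp2l.
by rewrite mulnC.
Qed.

Definition Fd (n : nat) (z : int) : R[i] := if n%:R <= Xi z then 1 else 0.
(* The probability that [n] is at most the random cutoff. *)
Definition wt (n : nat) : R[i] := AvL (Ms J q) J (Fd n) 0.

Lemma Ms0 i : (0 < Ms J q i)%N. Proof. exact: Ms_gt0. Qed.

Lemma Fd_bound n z : nm (Fd n z) <= 1.
Proof. by rewrite /Fd; case: ifP; rewrite ?nm1 ?nm0. Qed.

Lemma wt_large n : s * y%:R < n%:R -> wt n = 0.
Proof.
move=> h; apply: nm_eq0; apply/eqP; rewrite eq_le nm_ge0 andbT.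
apply: AvL_range => [i|z /andP[_ zI]]; first exact: Ms0.
rewrite /Fd ifN ?nm0 // -ltNge; apply: le_lt_trans h; exact: Xi_le.
Qed.

Lemma cf_abs_sum N : \sum_(m < N) `|cf PP m| <= y%:R.
Proof.
apply: le_trans (_ : \sum_(m < N + y.+1) `|cf PP m| <= _).
  by rewrite big_split_ord /= lerDl sumr_ge0.
rewrite (sum_ord_trunc (T := fun m => `|cf PP m|) (leq_addl N y.+1)); last first.
  move=> e ye; have [->|h] := eqVneq (cf PP e) 0; first by rewrite normr0.
  by have := cf_supp uv (PP_small u v J) h; rewrite leqNgt ye.
rewrite big_ord_recl cf0 normr0 add0r.
apply: le_trans (_ : \sum_(i < y) 1 <= _); last by rewrite sumr_const card_ord.
by apply: ler_sum => i _; exact: cf_PP_le1.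
Qed.

(** Multiplying the cutoff by m and shifting its logarithm by the rounded [Lmb m] differ by at most
    [om m] units, which the last window, of length at least q, dilutes. *)
Lemma shift_close n m : (m %| n)%N -> (pil (bl blk J)).-nat m ->
  nm (AvL (Ms J q) J (Fd (n %/ m)) 0 - AvL (Ms J q) J (Fd n) (0 + sg true (Lmb m))) <= (om m)%:R / q%:R.
Proof.
move=> mn sm; rewrite -AvL_shift AvL_sub /sg.
have m0 : (0 < m)%N := pnat_gt0 sm.
have mR : 0 < m%:R :> R by rewrite ltr0n.
have lo := Lmb_low (R := R) q0 sm; have hi := Lmb_high (R := R) q0 sm.
have [J' JE] : exists J', J = J'.+1 by exists J.-1; rewrite prednK.
have MJ : (q <= Ms J q J')%N.
  by rewrite /Ms -mulnA leq_pmulr // muln_gt0 !expn_gt0.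
apply: le_trans (_ : (om m)%:R / (Ms J q J')%:R <= _); last first.
  by rewrite ler_wpM2l // lef_pV2 ?posrE ?ltr0n ?ler_nat // Ms0.
rewrite {2}JE /=; apply: AvL_bound => z; first exact: Ms0.
pose g (x : int) : R := if n%:R <= Xi (x + (Lmb m)%:Z) then 1 else 0.
apply: (Av_window (g := g)) => [|x|x]; first exact: Ms0.
  by rewrite /g; case: ifP; rewrite ?lexx ?ler01.
rewrite /Fd /g.
have e1 : ((n %/ m)%:R <= Xi x) = (n%:R <= Xi x * m%:R).
  by rewrite -[in RHS](divnK mn) natrM ler_pM2r.
rewrite e1 XiD.
have -> : Xi (x + (om m)%:Z + (Lmb m)%:Z) = Xi x * expR (rho * (Lmb m + om m)%:R).
  by rewrite -addrA -PoszD addnC XiD.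
have X0 := ltW (Xi_gt0 (R := R) J q0 x).
have [h1|h1] := boolP (n%:R <= Xi x * expR (rho * (Lmb m)%:R)).
  have -> : n%:R <= Xi x * m%:R by apply: le_trans h1 _; rewrite ler_wpM2l.
  have -> : n%:R <= Xi x * expR (rho * (Lmb m + om m)%:R).
    by apply: le_trans h1 _; rewrite ler_wpM2l // ler_expR ler_wpM2l ?(ltW (rho_gt0 _ q0)) // ler_nat leq_addr.
  by rewrite !subrr nm0.
have [h2|h2] := boolP (n%:R <= Xi x * m%:R).
  have -> : n%:R <= Xi x * expR (rho * (Lmb m + om m)%:R).
    by apply: le_trans h2 _; rewrite ler_wpM2l.
  by rewrite !subr0 nm1.
by rewrite subrr nm0; case: ifP => _; rewrite subr0 ?ler01.
Qed.

Lemma coef_split (K : int -> R[i]) N n (b : bool) :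
  \sum_(m < N | (m %| n)%N) (cf PP m)%:C * K (sg b (Lmb m)) =
  \sum_(m < N | (pil (bl blk J)).-nat m && (m %| n)%N)
     (\prod_(i < J) fP u v J i m)%:C * K (sg b (Lmb m)).
Proof.
rewrite big_mkcond [RHS]big_mkcond; apply: eq_bigr => m _; rewrite /cf.
by case: (pnat _ _) => //=; case: ifP; rewrite ?mul0r.
Qed.

Definition conv_wt (n : nat) : R[i] := \sum_(m < q | (m %| n)%N) (cf PP m)%:C * wt (n %/ m).

Lemma conv_wt_bound n : (0 < n < q)%N ->
  nm (conv_wt n) <= \prod_(i < J) GP q i n + y%:R ^+ 2 / q%:R.
Proof.
move=> n0q.
pose S := \sum_(m < q | (m %| n)%N) (cf PP m)%:C * AvL (Ms J q) J (Fd n) (0 + sg true (Lmb m)).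
have -> : conv_wt n = S + (conv_wt n - S) by ring.
apply: le_trans (nmD _ _) _; apply: lerD.
  rewrite /S (coef_split (fun z => AvL (Ms J q) J (Fd n) (0 + z))).
  apply: le_trans (averaged_convolution_le blk_disj (f := fP u v J) (lam J q) (Ms := Ms J q) (C := 1) _ _ J 0 true n0q _) _.
  - by move=> i m; exact: fP_loc.
  - exact: Ms0.
  - by move=> z; exact: Fd_bound.
  by rewrite mul1r.
rewrite /conv_wt /S -sumrB; apply: le_trans (nm_sum _ _ _) _.
apply: le_trans (_ : \sum_(m < q) `|cf PP m| * (y%:R / q%:R) <= _); last first.
  rewrite -mulr_suml expr2 -mulrA ler_wpM2r ?divr_ge0 //; exact: cf_abs_sum.
rewrite big_mkcond; apply: ler_sum => m _; case: ifP => mn; last by rewrite mulr_ge0 ?divr_ge0.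
rewrite -mulrBr nmM nmC.
have [->|c0] := eqVneq (cf PP m) 0.
  by rewrite normr0 !mul0r.
have my := cf_supp uv (PP_small u v J) c0.
have sm : (pil (bl blk J)).-nat m by move: c0; rewrite /cf; case: ifP; rewrite ?eqxx.
rewrite ler_wpM2l //; apply: le_trans (shift_close mn sm) _.
by rewrite ler_wpM2r ?invr_ge0 // ler_nat; apply: leq_trans my; apply: om_le; exact: pnat_gt0 sm.
Qed.

Definition DD (j : nat) : R[i] := \sum_(n < q) (wt n * (isq n)%:C) * X j n%:R.

Lemma DD_conv j : DD j * DP PP (psi j) = \sum_(n < q) (conv_wt n * (isq n)%:C) * X j n%:R.
Proof.
rewrite (DP_sum uv (cmul_psi q_pr j) (PP_small u v J) yq).
have -> : \sum_(n < q) (cf PP n)%:C * psi j n = \sum_(n < q) ((cf PP n)%:C * (isq n)%:C) * X j n%:R.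
  by apply: eq_bigr => n _; rewrite /psi mulrA.
rewrite /DD (conv_sum (al := fun n => wt n * (isq n)%:C) (be := fun n => (cf PP n)%:C * (isq n)%:C)
   (psi := fun n => X j n%:R)).
- apply: eq_bigr => n _; congr (_ * _); rewrite /conv_wt mulr_suml; apply: eq_bigr => m mn.
  by rewrite -[in (isq n)%:C](divnK mn) isqM C_M; ring.
- by split=> [|m n]; rewrite ?X1 // natrM XM.
- by rewrite isq0 mulr0.
(* The weight [wt] lives on a <= sqrt q * y and [P] on b <= y; as y^3 <= sqrt q, the products remain
   below q, where [mean_value] is exact. *)
move=> a b h1 h2.
have wa : wt a != 0 by apply: contraNneq h1 => ->; rewrite mul0r.
have cb : cf PP b != 0 by apply: contraNneq h2 => ->; rewrite mul0r.
have bq := cf_supp uv (PP_small u v J) cb.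
have ay : a%:R <= s * y%:R.
  by rewrite leNgt; apply/negP => /wt_large e; rewrite e eqxx in wa.
have y1 : 2 <= y%:R :> R by rewrite (ler_nat _ 2); apply: leq_trans y_ge.
have s0 : 0 < s by rewrite sqrtr_gt0 ltr0n.
rewrite -(ltr_nat R) natrM; apply: le_lt_trans (_ : s * y%:R * y%:R < _).
  by apply: ler_pM => //; rewrite ler_nat.
have h3 := s_ge (k := 3) isT.
rewrite -[ltRHS]sq_q [ltRHS]expr2 -mulrA ltr_pM2l //; apply: lt_le_trans h3.
by rewrite [X in _ < X]exprS expr2 ltr_pMl ?mulr_gt0; lra.
Qed.

Lemma direct_part :
  \sum_(j < q.-1) nm (DD j * DP PP (psi j)) ^+ 2 <= q.-1%:R * (2 * GG + 2 * y%:R ^+ 4 / q%:R).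
Proof.
under eq_bigr do rewrite DD_conv.
rewrite (mean_value q_pr (b := fun n => conv_wt n * (isq n)%:C)) ?isq0 ?mulr0 //.
rewrite ler_wpM2l //.
apply: le_trans (_ : \sum_(n < q) (2 * ((\prod_(i < J) GP q i n) ^+ 2 / n%:R) + 2 * y%:R ^+ 4 / q%:R ^+ 2) <= _).
  apply: ler_sum => n _; rewrite nmM nmC exprMn real_normK ?num_real // sqr_isq.
  have [->|n0] := posnP n; first by rewrite invr0 !mulr0 add0r divr_ge0 ?mulr_ge0 ?exprn_ge0.
  have nn : (0 < n < q)%N by rewrite n0 ltn_ord.
  have nR : 1 <= n%:R :> R by rewrite (ler_nat _ 1).
  have h := conv_wt_bound nn.
  set P := \prod_(i < J) _ in h *; set e := _ / _ in h.
  apply: le_trans (_ : (2 * P ^+ 2 + 2 * e ^+ 2) / n%:R <= _).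
    rewrite ler_wpM2r ?invr_ge0 //; apply: le_trans (_ : (P + e) ^+ 2 <= _).
      by rewrite lerXn2r ?nnegrE ?nm_ge0 // (le_trans (nm_ge0 _) h).
    by rewrite -subr_ge0; have -> : 2 * P ^+ 2 + 2 * e ^+ 2 - (P + e) ^+ 2 = (P - e) ^+ 2 by [ring]; exact: sqr_ge0.
  rewrite mulrDl mulrA lerD2l ler_pdivrMr ?ltr0n // /e exprMn exprVn -exprM mulrA.
  by rewrite ler_peMr // divr_ge0 ?mulr_ge0 ?exprn_ge0.
rewrite big_split /= -mulr_sumr sumr_const card_ord; apply: lerD.
  rewrite ler_wpM2l //; apply: sum_prod_GP_sqr_le => //.
  by apply: leq_trans hqb _.
rewrite -[_ *+ q]mulr_natl; apply: eqle.
have qR : q%:R != 0 :> R by rewrite pnatr_eq0 -lt0n.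
by field.
Qed.

End DirectPart.

(** * Passing to additive characters *)

Section AdditiveTransform.
Context {R : realType} (q : nat) (q_pr : prime q).
Local Notation F := 'F_q.
Local Notation X := (@X R q q_pr).
Implicit Types (e g : nat -> R[i]) (p : nat -> R).

Let q0 : (0 < q)%N. Proof. exact: prime_gt0. Qed.

Lemma perm_mul (V : nmodType) (h : nat -> V) m : (0 < m < q)%N ->
  (forall a, h (a %% q)%N = h a) -> \sum_(a < q) h (a * m)%N = \sum_(a < q) h a.
Proof.
move=> /andP[m0 mq] hq.
have hE a : h a = h (a%:R : F) by rewrite val_Fp_nat // hq.
have mF : m%:R != 0 :> F by rewrite natF_eq0 // gtnNdvd.
under eq_bigr do rewrite hE natrM; under [RHS]eq_bigr do rewrite hE.
rewrite (sumFq q_pr (fun x : F => h (x * m%:R))) (sumFq q_pr (fun x : F => h x)).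
rewrite [RHS](reindex_inj (mulIf mF)); exact: eq_bigr.
Qed.

Lemma char_mul_conj g j m : (0 < m < q)%N -> (forall a, g (a %% q)%N = g a) ->
  (\sum_(a < q) g a * X j a%:R) * conjc (X j m%:R) = \sum_(a < q) g (a * m)%N * X j a%:R.
Proof.
move=> mq gq; have mF : m%:R != 0 :> F.
  by case/andP: mq => m0 mq; rewrite natF_eq0 // gtnNdvd.
rewrite mulr_suml -(perm_mul (h := fun a => g a * X j a%:R * conjc (X j m%:R)) mq).
  apply: eq_bigr => a _; rewrite natrM XM -!mulrA; congr (_ * _).
  by rewrite sqr_nmC nmX // expr1n mulr1.
by move=> a; rewrite gq -(val_Fp_nat q_pr) natr_Zp.
Qed.

Definition hat e M r : R[i] := \sum_(0 <= N < q * M) e N * ec q (r * N).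
(** Fourier inversion on residues without the frequency 0, whose constant contribution is
    annihilated by non-principal characters. *)
Definition tv e M a : R[i] := (q%:R^-1)%:C * \sum_(1 <= r < q) hat e M r * eN q (r * a).

Lemma tv_mod e M a : tv e M (a %% q) = tv e M a.
Proof.
rewrite /tv; congr (_ * _); apply: eq_bigr => r _; congr (_ * _).
by rewrite -(eN_mod _ q0) modnMmr eN_mod.
Qed.

Lemma char_fourier e M j : (0 < j < q.-1)%N ->
  \sum_(0 <= N < q * M) e N * X j N%:R = \sum_(a < q) tv e M a * X j a%:R.
Proof.
move=> jq; pose t2 a := \sum_(b < M) e (q * b + a)%N.
have -> : \sum_(0 <= N < q * M) e N * X j N%:R = \sum_(a < q) t2 a * X j a%:R.
  rewrite sum_blocks exchange_big /=; apply: eq_bigr => a _; rewrite mulr_suml.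
  apply: eq_bigr => b _; congr (_ * X _ _).
  by apply/val_inj; rewrite /= !val_Fp_nat // mulnC modnMDl.
have hatE r : hat e M r = \sum_(a < q) t2 a * conjc (eN q (r * a)).
  rewrite /hat sum_blocks exchange_big; apply: eq_bigr => a _; rewrite mulr_suml.
  apply: eq_bigr => b _; congr (_ * _); rewrite /ec; congr (conjc _).
  by rewrite -(eN_mod _ q0) -modnMmr [(q * _)%N]mulnC modnMDl modnMmr eN_mod.
have t2E (a : 'I_q) : t2 a = (q%:R^-1)%:C * hat e M 0 + tv e M a.
  rewrite /tv -mulrDr.
  have -> : hat e M 0 + \sum_(1 <= r < q) hat e M r * eN q (r * a) = \sum_(r < q) hat e M r * eN q (r * a).
    by rewrite -(big_mkord xpredT (fun r => hat e M r * eN q (r * a))) big_ltn // mul0n eN0 mulr1.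
  under eq_bigr do rewrite hatE mulr_suml.
  rewrite exchange_big /= (bigD1 a) //= [X in _ + X]big1 ?addr0 => [|b ba].
    have -> : \sum_(i < q) t2 a * conjc (eN q (i * a)) * eN q (i * a) = t2 a * \sum_(i < q) eN q (i * a) * conjc (eN q (i * a)).
      by rewrite mulr_sumr; apply: eq_bigr => i _; rewrite -mulrA [conjc _ * _]mulrC.
    rewrite eN_orth // eqxx mulrCA -(rmorph_nat (real_complex R)) -C_M mulVf ?mulr1 //.
    by rewrite pnatr_eq0 -lt0n.
  have -> : \sum_(i < q) t2 b * conjc (eN q (i * b)) * eN q (i * a) = t2 b * \sum_(i < q) eN q (i * a) * conjc (eN q (i * b)).
    by rewrite mulr_sumr; apply: eq_bigr => i _; rewrite -mulrA [conjc _ * _]mulrC.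
  by rewrite eN_orth // ifN ?mulr0 // eq_sym.
under eq_bigr do rewrite t2E mulrDl.
rewrite big_split /= -mulr_sumr [X in _ * X + _](_ : _ = 0) ?mulr0 ?add0r //.
rewrite (sumFq q_pr (X j)) -[RHS](X_sum0 (R := R) q_pr jq) [RHS]big_mkcond.
by apply: eq_bigr => x _; case: eqVneq => // ->; rewrite X0.
Qed.

(** Replacing [P] by its conjugate keeps the modulus and turns the character value at m into the
    dilation of [tv] by m; orthogonality over characters then gives a sum over residues b. *)
Lemma dual_mean_square e M p : p 0%N = 0 ->
  \sum_(j < q.-1 | (0 < j)%N)
     nm ((\sum_(0 <= N < q * M) e N * X j N%:R) * (\sum_(m < q) (p m)%:C * X j m%:R)) ^+ 2
  <= q.-1%:R * \sum_(b < q) nm (\sum_(m < q) (p m)%:C * tv e M (b * m)) ^+ 2.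
Proof.
move=> p0; pose fb b := \sum_(m < q) (p m)%:C * tv e M (b * m).
pose fb' b := if b is 0%N then 0 else fb b.
apply: le_trans (_ : q.-1%:R * \sum_(b < q) nm (fb' b) ^+ 2 <= _); last first.
  rewrite ler_wpM2l //; apply: ler_sum => b _; rewrite -/(fb b) /fb'.
  by case: (b : nat) => //=; rewrite nm0 expr0n sqr_ge0.
rewrite -(mean_value q_pr (leqnn q)) //.
apply: le_trans (_ : \sum_(j < q.-1 | (0 < j)%N) nm (\sum_(n < q) fb' n * X j n%:R) ^+ 2 <= _); last first.
  by rewrite [leLHS]big_mkcond; apply: ler_sum => j _; case: ifP => // _; exact: sqr_ge0.
apply: ler_sum => j j0; rewrite nmM -[X in _ * X]nmJ -nmM conj_sum mulr_sumr; apply: eqle.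
congr (nm _ ^+ 2); rewrite char_fourier ?j0 ?ltn_ord //.
transitivity (\sum_(n < q) fb n * X j n%:R); last first.
  by apply: eq_bigr => -[[|n] nq] _ //=; rewrite X0 !mulr0.
transitivity (\sum_(m < q) (p m)%:C * \sum_(a < q) tv e M (a * m) * X j a%:R).
  apply: eq_bigr => m _; rewrite conj_M conjc_real mulrCA.
  have [->|m0] := posnP m; first by rewrite p0 !mul0r.
  by rewrite (char_mul_conj _ _ (tv_mod e M)) // m0 ltn_ord.
under eq_bigr do rewrite mulr_sumr; rewrite exchange_big; apply: eq_bigr => a _.
by rewrite mulr_suml; apply: eq_bigr => m _; rewrite mulrA.
Qed.

End AdditiveTransform.

(** * The sum above the cutoff *)

Section DualPart.
Context {R : realType} (q : nat) (q_pr : prime q) (u v J c : nat).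
Hypothesis uv : (0 < u < v)%N.
Hypothesis J0 : (0 < J)%N.
Hypothesis hqb : (q <= bd (J + c))%N.
Local Notation y := (ylen v J).
Hypothesis hy : (y ^ 100 <= q)%N.
Local Notation PP := (PP u v J : nat -> {poly R}).
Local Notation kk := (kk u v : R).
Local Notation cf := (cf J).
Local Notation DP := (DP J).
Local Notation X := (@X R q q_pr).
Local Notation psi := (@psi R q q_pr).
Local Notation rho := (rho q J : R).
Local Notation Xi := (Xi q J : int -> R).
Local Notation Lmb := (Lmb q J).
Local Notation om := (om J).
Local Notation GP := (GP u v J q : nat -> nat -> nat -> R).
Local Notation s := (Num.sqrt q%:R : R).
Local Notation GG := (expR (kk ^+ 2 * sJ J + CS v c) : R).
Local Notation wt := (wt q J : nat -> R[i]).
Local Notation Y := (q * q ^ 2)%N.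
Local Notation H := q./2.
Local Notation dual_tail := (@dual_tail R q).
Local Notation Ms := (Ms J q).

Let q0 : (0 < q)%N. Proof. exact: prime_gt0. Qed.
Let v0 : (0 < v)%N. Proof. exact: v_gt0 uv. Qed.
Let Ms0 i : (0 < Ms i)%N. Proof. exact: Ms_gt0. Qed.
Let y2 : (2 <= y)%N. Proof. by apply: leq_trans (y_ge J uv). Qed.
Let sge k : (2 * k <= 100)%N -> y%:R ^+ k <= s.
Proof. exact: (s_ge (R := R) uv hy). Qed.

Lemma q_odd : q = (H.*2).+1.
Proof.
have : odd q.
  have [q2|//] := even_prime q_pr.
  have : (y <= q)%N by exact: ltnW (yq uv hy).
  by have := y_ge J uv; rewrite q2 => a b; have := leq_trans a b.
by move=> o; rewrite -{1}(odd_double_half q) o.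
Qed.

Definition ewt (N : nat) : R[i] := (1 - wt N) * (isq N)%:C.
Definition kap (z : int) : nat := (Num.truncn (Xi z)).+1.
Definition Vh (r : nat) : R[i] := AvL Ms J (fun z => dual_tail Y (kap z) r) 0.

Lemma kap_le z N : (kap z <= N)%N = (Xi z < N%:R).
Proof. by rewrite /kap truncn_lt_nat // ltW // Xi_gt0. Qed.

Lemma hat_Vh r : hat q ewt (q ^ 2) r = Vh r.
Proof.
rewrite /hat /Vh.
have -> : (fun z => dual_tail Y (kap z) r) =
   (fun z => \sum_(0 <= N < Y) ((isq N)%:C * ec q (r * N)) * (1 - Fd q J N z)).
  apply/funext => z; rewrite /dual_tail big_geq_mkord [RHS]big_mkord big_mkcond.
  apply: eq_bigr => N _; rewrite kap_le /Fd leNgt.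
  by case: (Xi z < N%:R); rewrite ?subr0 ?mulr1 ?subrr ?mulr0.
rewrite AvL_lin; apply: eq_bigr => N _; rewrite -AvL_sub AvL_const //.
by rewrite /ewt /wt; ring.
Qed.

Lemma SL_split j : SL q_pr j Y = DD q_pr J j + \sum_(0 <= N < Y) ewt N * X j N%:R.
Proof.
have -> : DD q_pr J j = \sum_(0 <= N < Y) (wt N * (isq N)%:C) * X j N%:R.
  rewrite big_mkord -(big_mkord xpredT (fun N => wt N * (isq N)%:C * X j N%:R)).
  rewrite (big_cat_nat (n := q)) //=; last by rewrite leq_pmulr // expn_gt0 q0.
  rewrite [X in _ + X]big_nat [X in _ + X]big1 ?addr0; first by rewrite big_mkord.
  move=> N /andP[qN _]; rewrite (wt_large q_pr uv) ?mul0r //.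
  apply: lt_le_trans (_ : q%:R <= _); last by rewrite ler_nat.
  rewrite -[ltRHS](sq_q (R := R)) expr2 ltr_pM2l ?sqrtr_gt0 ?ltr0n //.
  apply: lt_le_trans (sge (k := 2) isT).
  by rewrite expr2 ltr_pMl ?ltr0n ?(ltr_nat _ 1) // ltnW.
rewrite -big_split /= /SL.
have -> : \sum_(1 <= n < Y) (isq n)%:C * X j n%:R = \sum_(0 <= n < Y) (isq n)%:C * X j n%:R.
  by rewrite [RHS]big_ltn ?muln_gt0 ?expn_gt0 ?q0 // isq0 mul0r add0r.
by apply: eq_bigr => N _; rewrite /ewt; ring.
Qed.

Definition pc (m : nat) : R := cf PP m * isq m.

Lemma pc0 : pc 0 = 0. Proof. by rewrite /pc isq0 mulr0. Qed.

Lemma pc_sum j : DP PP (psi j) = \sum_(m < q) (pc m)%:C * X j m%:R.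
Proof.
rewrite (DP_sum uv (cmul_psi q_pr j) (PP_small u v J) (yq uv hy)).
by apply: eq_bigr => m _; rewrite /psi mulrA /pc C_M.
Qed.

Lemma Vh_conj r : (r <= q)%N -> Vh (q - r) = conjc (Vh r).
Proof.
move=> rq; rewrite /Vh -AvL_conj; congr (AvL _ _ _ _); apply/funext => z.
exact: dual_tail_conj.
Qed.

Definition Afull b : R[i] := \sum_(m < q) (pc m)%:C * \sum_(1 <= r < H.+1) Vh r * eN q (r * (b * m)).

Lemma eN_sub r a : (r <= q)%N -> eN q ((q - r) * a) = conjc (eN q (r * a)) :> R[i].
Proof.
move=> rq; have h : eN q (r * a) * eN q ((q - r) * a) = 1 :> R[i].
  by rewrite -eND -mulnDl subnKC // eNX eNN // expr1n.
have nz : eN q (r * a) != 0 :> R[i].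
  by apply: contra_eq_neq h => ->; rewrite mul0r eq_sym oner_neq0.
by apply: (mulfI nz); rewrite h eN_conjM.
Qed.

Lemma tv_half a : tv q ewt (q ^ 2) a =
  (q%:R^-1)%:C * (\sum_(1 <= r < H.+1) Vh r * eN q (r * a) +
                  conjc (\sum_(1 <= r < H.+1) Vh r * eN q (r * a))).
Proof.
rewrite /tv; congr (_ * _); under eq_bigr do rewrite hat_Vh.
have Hq : (H.+1 <= q)%N by rewrite {2}q_odd -addnn ltnS leq_addl.
rewrite (big_cat_nat (n := H.+1)) //=; congr (_ + _).
rewrite conj_sum big_nat_rev /= -{1}[H.+1]add1n big_addn.
have -> : (q - H = H.+1)%N by rewrite {1}q_odd -addnn -addSn addnK.
rewrite !big_nat; apply: eq_bigr => r /andP[r1 rH].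
have rq : (r <= q)%N by apply: ltnW; apply: leq_trans Hq.
have -> : (H.+1 + q - (r + H).+1 = q - r)%N by rewrite subSS [(r + H)%N]addnC subnDl.
by rewrite conj_M Vh_conj // eN_sub.
Qed.

(* [q] is odd, and the frequencies [r] and [q - r] are conjugate. *)
Lemma fb_half b : nm (\sum_(m < q) (pc m)%:C * tv q ewt (q ^ 2) (b * m)) <= 2 / q%:R * nm (Afull b).
Proof.
have -> : \sum_(m < q) (pc m)%:C * tv q ewt (q ^ 2) (b * m) = (q%:R^-1)%:C * (Afull b + conjc (Afull b)).
  rewrite /Afull conj_sum -big_split mulr_sumr; apply: eq_bigr => m _.
  rewrite tv_half; set S := \sum_(1 <= r < _) _.
  by rewrite conj_M conjc_real mulrCA mulrDr.
rewrite nmM nmC ger0_norm ?invr_ge0 // [2 / _]mulrC -mulrA ler_wpM2l ?invr_ge0 //.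
by apply: le_trans (nmD _ _) _; rewrite nmJ; lra.
Qed.

Local Notation h := (Num.sqrt s).
Local Notation Itot := (Itot q J).

Let s_gt0 : 0 < s. Proof. by rewrite sqrtr_gt0 ltr0n. Qed.
Let h_gt0 : 0 < h. Proof. by rewrite sqrtr_gt0. Qed.
Let y2R : 2 <= y%:R :> R. Proof. by rewrite (ler_nat _ 2). Qed.
Let sq_h : h ^+ 2 = s. Proof. by rewrite sqr_sqrtr // ltW. Qed.

Let qE : q%:R = s * s. Proof. by rewrite -expr2 sq_q. Qed.

Let y1R : 1 <= y%:R :> R. Proof. by apply: le_trans y2R; rewrite (ler_nat _ 1). Qed.

Let s_ge1 : 1 <= s. Proof. exact: (sge (k := 0) isT). Qed.

Let hs : h <= s.
Proof. by rewrite -(ler_pXn2r (n := 2)) ?nnegrE ?sqrtr_ge0 // sq_h expr2 ler_peMr // ltW. Qed.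

Lemma isq_le_inv (n : nat) (x : R) : 0 < x -> x <= n%:R -> isq n <= (Num.sqrt x)^-1.
Proof.
move=> x0 xn; rewrite /isq lef_pV2 ?posrE ?sqrtr_gt0 // ?ler_sqrt //; exact: lt_le_trans xn.
Qed.

Lemma Xi_lt_kap z : Xi z < (kap z)%:R.
Proof. exact: truncnS_gt. Qed.

Lemma isq_kap z : 0 <= z -> isq (kap z) <= h^-1.
Proof.
move=> z0; apply: isq_le_inv => //; apply: le_trans (ltW (Xi_lt_kap z)).
exact: Xi_ge.
Qed.

Lemma Vh_bound r : (0 < r)%N -> (2 * r <= q)%N -> nm (Vh r) <= 2 * q%:R / r%:R / h.
Proof.
move=> r0 rq; apply: AvL_range => // z /andP[z0 _].
apply: le_trans (dual_tail_le_cutoff _ q0 r0 rq _) _ => //.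
by rewrite ler_wpM2l ?divr_ge0 ?mulr_ge0 // isq_kap.
Qed.

Lemma rho_le : rho <= q%:R^-1.
Proof.
rewrite /rho ler_pdivrMr ?ltr0n ?QQ_gt0 //.
apply: le_trans (_ : 1 <= _).
  have := @ln_sublinear R 2 ltac:(by []); have := @le_ln1Dx R 1 ltac:(by []).
  by have -> : 1 + 1 = 2 :> R by []; lra.
rewrite mulrC ler_pdivlMr ?ltr0n // mul1r ler_nat /QQ leq_pmulr // expn_gt0 //.
Qed.

Section Shift.
Variables (m r : nat) (z : int).
Hypothesis m0 : (0 < m)%N.
Hypothesis r0 : (0 < r)%N.
Hypothesis rmq : (2 * (r * m) <= q)%N.
Hypothesis sm : (pil (bl blk J)).-nat m.
Hypothesis my : (m <= y)%N.
Hypothesis z_bd : 0 <= z <= Itot%:Z.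
Let T := Num.truncn (Xi z).
Let K1 := (T %/ m).+1.
Let x0 : R := Xi (z - (Lmb m)%:Z).
Let mR : 0 < m%:R :> R. Proof. by rewrite ltr0n. Qed.

Let XzE : Xi z = x0 * expR (rho * (Lmb m)%:R).
Proof. by rewrite /x0 -XiD subrK. Qed.

Let x0_gt0 : 0 < x0. Proof. exact: Xi_gt0. Qed.

Lemma Xz_lt : Xi z < m%:R * K1%:R.
Proof.
apply: lt_le_trans (Xi_lt_kap z) _; rewrite -natrM ler_nat /kap -/T mulnC.
exact: ltn_ceil.
Qed.

Lemma K1_le : (K1 <= kap (z - (Lmb m)%:Z))%N.
Proof.
rewrite /kap ltnS truncn_ge_nat -/x0; last exact: ltW.
rewrite -(ler_pM2r mR) -natrM; apply: le_trans (_ : T%:R <= _).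
  by rewrite ler_nat leq_trunc_div.
apply: le_trans (_ : Xi z <= _); first by rewrite truncn_le ltW // Xi_gt0.
by rewrite XzE ler_pM2l // Lmb_low.
Qed.

(** Rounding changes the cutoff by a factor e^x with x <= y/q, hence by at most 1, since the cutoff
    is at most sqrt q * y and 2 y^2 <= sqrt q. *)
Lemma le_K1 : (kap (z - (Lmb m)%:Z) <= K1.+1)%N.
Proof.
rewrite /kap ltnS truncn_le_nat -/x0.
have omy : (om m)%:R <= y%:R :> R.
  by rewrite ler_nat; apply: leq_trans my; apply: om_le.
set x := rho * (om m)%:R.
have s3 := sge (k := 3) isT.
have yq : y%:R / q%:R <= 2^-1 :> R.
  rewrite ler_pdivrMr ?ltr0n // ler_pdivlMl // [leRHS]qE.
  apply: le_trans (_ : s <= _); last by rewrite ler_peMr // ltW.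
  apply: le_trans s3; rewrite exprSr ler_wpM2r //.
  by apply: le_trans y2R _; rewrite expr2 ler_peMr.
have x_ge0 : 0 <= x by rewrite mulr_ge0 // ltW // rho_gt0.
have xy : x <= y%:R / q%:R by rewrite /x [leRHS]mulrC ler_pM ?rho_le // ltW // rho_gt0.
have ex : expR x <= 1 + 2 * x.
  have := expR_ge1Dx (- x); rewrite expRN => e1.
  have ep := expR_gt0 x.
  have : (1 - x) * expR x <= 1 by rewrite -ler_pdivlMr // mul1r.
  have : 0 <= x * (1 - 2 * x) by apply: mulr_ge0; lra.
  nra.
have hx : x0 * m%:R <= Xi z * expR x.
  have -> : Xi z * expR x = x0 * expR (rho * (Lmb m + om m)%:R).
    by rewrite XzE natrD mulrDr expRD mulrA.
  by rewrite ler_pM2l // Lmb_high.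
have XzI : Xi z <= s * y%:R by have /andP[_ zI] := z_bd; exact: (Xi_le (R := R) q0 v0 zI).
have small : Xi z * (2 * x) <= 1.
  apply: le_trans (_ : s * y%:R * (2 * (y%:R / q%:R)) <= _).
    by apply: ler_pM => //; [exact/ltW/Xi_gt0|exact: mulr_ge0|rewrite ler_pM2l].
  have -> : y%:R / q%:R = y%:R / (s * s) by rewrite -qE.
  have -> : s * y%:R * (2 * (y%:R / (s * s))) = 2 * y%:R ^+ 2 / s by field; rewrite gt_eqF.
  rewrite ler_pdivrMr // mul1r; apply: le_trans s3.
  by rewrite [leRHS]exprS ler_wpM2r ?sqr_ge0.
rewrite -(ltr_pM2r mR); apply: le_lt_trans hx _.
apply: le_lt_trans (_ : Xi z + 1 < _).
  apply: le_trans (_ : Xi z * (1 + 2 * x) <= _); first by rewrite ler_pM2l // Xi_gt0.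
  by rewrite mulrDr mulr1 lerD2l.
have := Xz_lt; have : 1 <= m%:R :> R by rewrite (ler_nat _ 1).
rewrite -[K1.+1%:R]natr1 mulrDl mul1r [K1%:R * _]mulrC; lra.
Qed.

Lemma scale_close :
  nm ((isq m)%:C * dual_tail Y (kap z) r - dual_tail Y (kap (z - (Lmb m)%:Z)) (r * m)) <= 21 * y%:R / h.
Proof.
have z0 : 0 <= z by case/andP: z_bd.
have Xs : s <= Xi z by exact: Xi_ge.
have XzI : Xi z <= s * y%:R by have /andP[_ zI] := z_bd; exact: (Xi_le (R := R) q0 v0 zI).
have myR : m%:R <= y%:R :> R by rewrite ler_nat.
have K1b : isq K1 <= y%:R / h :> R.
  rewrite (isqK K1 m0); apply: le_trans (_ : 1 * (y%:R * h^-1) <= _); last by rewrite mul1r.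
  apply: ler_pM; rewrite ?isq_ge0 ?isq_le1 ?mulr_ge0 ?isq_ge0 //.
  apply: ler_pM; rewrite ?isq_ge0 //; apply: isq_le_inv => //.
  by rewrite natrM; apply: le_trans Xs (ltW Xz_lt).
have mK1 : (kap z <= m * K1 <= kap z + m)%N.
  rewrite /kap -/T /K1; apply/andP; split; first by rewrite mulnC ltn_ceil.
  by rewrite mulnS mulnC addnC leq_add2r (leq_trans (leq_trunc_div _ _)).
have KY : (m * K1 <= Y)%N.
  apply: leq_trans (_ : q ^ 2 <= _)%N; last by rewrite leq_pmull.
  case/andP: mK1 => _ /leq_trans; apply.
  have Tq : (T + y < q)%N.
    rewrite -(ltr_nat R) natrD; apply: le_lt_trans (_ : s * y%:R + y%:R < _).
      by rewrite lerD2r; apply: le_trans XzI; rewrite truncn_le ltW // Xi_gt0.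
    rewrite [ltRHS]qE.
    have := sge (k := 2) isT => s2.
    have : y%:R * 2 <= s by apply: le_trans s2; rewrite expr2 ler_pM2l // (lt_le_trans _ y1R).
    have : y%:R <= s * y%:R by rewrite ler_peMl.
    have : y%:R * 2 + 1 <= s.
      apply: le_trans s2; rewrite expr2; have : (2 : R) ^+ 40 <= y%:R by rewrite -natrX ler_nat; exact: (y_ge J uv).
      have : 3 <= (2 : R) ^+ 40 by rewrite -natrX (ler_nat _ 3) (leq_trans (_ : 3 <= 2 ^ 2)%N) // leq_exp2l.
      nra.
    nra.
  rewrite /kap -/T; apply: leq_trans (_ : q <= _)%N; last by rewrite -mulnn leq_pmulr.
  by apply: leq_trans Tq; rewrite addSn ltnS leq_add2l.
have qY : 2 * q%:R * isq Y <= 2 / h.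
  rewrite -mulrA ler_wpM2l // !isqM mulrA.
  have -> : q%:R * isq q = s :> R.
    by rewrite /isq [X in X / _]qE mulfK // gt_eqF.
  have -> : s * (isq q * isq q) = s^-1 :> R.
    by rewrite -expr2 sqr_isq [X in _ / X]qE; field; rewrite gt_eqF.
  by rewrite lef_pV2 ?posrE.
have jump : nm (dual_tail Y K1 (r * m) - dual_tail Y (kap (z - (Lmb m)%:Z)) (r * m)) <= y%:R / h.
  apply: le_trans K1b; apply: le_trans (dual_tail_split _ _ _ K1_le) _.
  have := le_K1; rewrite leq_eqVlt => /orP[/eqP->|].
    by rewrite big_nat1.
  by rewrite ltnS => e; rewrite big_geq // isq_ge0.
have sc := dual_tail_scale (R := R) q0 m0 r0 rmq (isT : 0 < kap z)%N (isT : 0 < K1)%N mK1 KY.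
set A := _%:C * _ in sc *; set B := dual_tail Y K1 _ in sc jump *; set C := dual_tail _ _ _ in jump *.
have -> : A - C = (A - B) + (B - C) by ring.
(* 21 = 1 + 2 + 17 from the three errors of [dual_tail_scale], plus 1 from [jump]. *)
apply: le_trans (nmD _ _) _; apply: le_trans (lerD sc jump) _.
have k1 : m%:R * isq (kap z) <= y%:R / h by rewrite ler_pM ?isq_ge0 // isq_kap.
have k2 : 2 / h <= 2 * (y%:R / h).
  by rewrite ler_wpM2l // -[leLHS]mul1r ler_wpM2r ?invr_ge0 ?sqrtr_ge0.
by rewrite -mulrA; lra.
Qed.

End Shift.

Local Notation GPp n := (\prod_(i < J) GP q i n).

Let Hq : (H.+1 <= q)%N.
Proof. by rewrite [leqRHS]q_odd -addnn ltnS leq_addl. Qed.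

Lemma AvL_scale (a : R[i]) M n (F : int -> R[i]) x :
  a * AvL M n F x = AvL M n (fun z => a * F z) x.
Proof.
elim: n F => // n IH F /=; rewrite IH; congr (AvL _ _ _ _); apply/funext => z.
by rewrite /Av mulrCA mulr_sumr.
Qed.

Definition conv_Vh (n : nat) : R[i] := \sum_(m < q | (m %| n)%N) (pc m)%:C * Vh (n %/ m).

(** The mirror image of [conv_wt_bound]: [scale_close] trades the weight [isq m] at frequency n/m
    for frequency n with the cutoff divided by m, a downward shift of its logarithm. *)
Lemma conv_Vh_bound n : (0 < n)%N -> (2 * n <= q)%N ->
  nm (conv_Vh n) <= 6 * Num.sqrt (q%:R / n%:R) * GPp n + 21 * y%:R ^+ 2 / h.
Proof.
move=> n0 n2q.
have nq : (n < q)%N by apply: leq_trans n2q; rewrite mul2n -addnn -{1}[n]addn0 ltn_add2l.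
pose Fn z := dual_tail Y (kap z) n.
pose S := \sum_(m < q | (m %| n)%N) (cf PP m)%:C * AvL Ms J Fn (0 + sg false (Lmb m)).
have -> : conv_Vh n = S + (conv_Vh n - S) by ring.
apply: le_trans (nmD _ _) _; apply: lerD.
  rewrite /S (coef_split q u v J (fun z => AvL Ms J Fn (0 + z))).
  apply: (averaged_convolution_le blk_disj (f := fP u v J) (lam J q) (Ms := Ms) _ _ J 0 false).
  - by move=> i m; exact: fP_loc.
  - exact: Ms0.
  - by rewrite n0.
  by move=> z; exact: dual_tail_le_sqrt.
rewrite /conv_Vh /S -sumrB; apply: le_trans (nm_sum _ _ _) _.
apply: le_trans (_ : \sum_(m < q) `|cf PP m| * (21 * y%:R / h) <= _); last first.
  rewrite -mulr_suml; apply: le_trans (_ : y%:R * (21 * y%:R / h) <= _).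
    by rewrite ler_wpM2r ?cf_abs_sum // divr_ge0 ?sqrtr_ge0 // mulr_ge0.
  by apply: eqle; rewrite expr2; ring.
rewrite big_mkcond; apply: ler_sum => m _; case: ifP => mn; last first.
  by rewrite mulr_ge0 // divr_ge0 ?sqrtr_ge0 // mulr_ge0.
rewrite /pc C_M -mulrA -mulrBr nmM nmC.
have [->|c0] := eqVneq (cf PP m) 0; first by rewrite normr0 !mul0r.
have my := cf_supp uv (PP_small u v J) c0.
have sm : (pil (bl blk J)).-nat m by move: c0; rewrite /cf; case: ifP; rewrite ?eqxx.
have m0 := pnat_gt0 sm.
rewrite ler_wpM2l // /Vh AvL_scale /sg /= -AvL_shift AvL_sub.
apply: AvL_range => [i|z]; first exact: Ms0.
rewrite add0r => zI.
have -> : Fn (z - (Lmb m)%:Z) = dual_tail Y (kap (z - (Lmb m)%:Z)) (n %/ m * m) by rewrite divnK.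
apply: scale_close => //; last by rewrite divnK.
by rewrite divn_gt0 // dvdn_leq.
Qed.

Lemma parseval_trunc (f : nat -> R[i]) N : (N <= q)%N ->
  \sum_(b < q) nm (\sum_(n < N) f n * eN q (b * n)) ^+ 2 = q%:R * \sum_(n < N) nm (f n) ^+ 2.
Proof.
move=> Nq; pose f' n := if (n < N)%N then f n else 0.
have f'0 n : (N <= n)%N -> f' n = 0 by rewrite /f' leqNgt => /negPf ->.
have f'E (n : 'I_N) : f' n = f n by rewrite /f' ltn_ord.
have := eN_parseval q f'.
rewrite (sum_ord_trunc (T := fun a => nm (f' a) ^+ 2) Nq) => [|n /f'0 ->]; last by rewrite nm0 expr0n.
under [in RHS]eq_bigr do rewrite f'E.
move=> <-; apply: eq_bigr => b _.
rewrite (sum_ord_trunc (T := fun a => f' a * eN q (b * a)) Nq) => [|n /f'0 ->]; last by rewrite mul0r.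
by under [in RHS]eq_bigr do rewrite f'E.
Qed.

Lemma sqr_sum_le (a : nat -> R) n : (forall i, 0 <= a i) ->
  (\sum_(i < n) a i) ^+ 2 <= n%:R * \sum_(i < n) a i ^+ 2.
Proof.
move=> a0; elim: n => [|n IH]; first by rewrite !big_ord0 expr0n mul0r.
rewrite !big_ord_recr /= -natr1; case: n IH => [|n] IH.
  by rewrite !big_ord0 !add0r mul1r.
set S := \sum_(i < n.+1) _ in IH *; set T := \sum_(i < n.+1) _ in IH *.
have := sqr_ge0 (S - n.+1%:R * a n.+1).
have n0 : 0 < n.+1%:R :> R by rewrite ltr0n.
move: (n.+1%:R : R) n0 IH => N N0 IH.
have -> : (S - N * a n.+1) ^+ 2 = S ^+ 2 - N * (2 * S * a n.+1 - N * a n.+1 ^+ 2) by ring.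
move=> h1; have h2 : N * (2 * S * a n.+1) <= N * (T + N * a n.+1 ^+ 2) by lra.
rewrite ler_pM2l // in h2; lra.
Qed.

Let qR : 0 < q%:R :> R. Proof. by rewrite ltr0n. Qed.

Definition conv_Vh0 n : R[i] := if (0 < n)%N then conv_Vh n else 0.
(* The frequency [r * m] runs over [r * m < H.+1] in [Anear], where the shift by
   [m] is harmless, and over [r * m > H] in [Zv], where [Vh r] is small. *)
Definition Anear b : R[i] := \sum_(n < H.+1) conv_Vh0 n * eN q (b * n).
Definition gv (m r : nat) : R[i] := if (0 < r)%N && (H < r * m)%N then Vh r else 0.
Definition Zv m b : R[i] := \sum_(r < H.+1) gv m r * eN q (b * m * r).

Lemma Afull_split b : Afull b = Anear b + \sum_(m < q) (pc m)%:C * Zv m b.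
Proof.
pose Vr r := if (0 < r)%N then Vh r else 0.
transitivity (\sum_(m < q) (\sum_(r < H.+1 | (r * m < H.+1)%N) (pc m)%:C * Vr r * eN q (b * (r * m)) +
   (pc m)%:C * Zv m b)).
  rewrite /Afull; apply: eq_bigr => m _.
  have -> : \sum_(1 <= r < H.+1) Vh r * eN q (r * (b * m)) = \sum_(r < H.+1) Vr r * eN q (r * (b * m)).
    rewrite -(big_mkord xpredT (fun r => Vr r * eN q (r * (b * m)))) [RHS]big_ltn //.
    rewrite /Vr mul0r add0r !big_nat; apply: eq_bigr => r /andP[r0 _].
    by rewrite r0.
  rewrite /Zv !mulr_sumr [X in _ = X + _]big_mkcond -big_split /=.
  apply: eq_bigr => r _; rewrite /Vr /gv ltnS [(r * m <= H)%N]leqNgt.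
  have -> : (b * (r * m) = r * (b * m))%N by ring.
  have -> : (b * m * r = r * (b * m))%N by ring.
  by case: (0 < r)%N; case: (H < r * m)%N => /=; rewrite ?(mul0r, mulr0, addr0, add0r) // mulrA.
rewrite big_split /=; congr (_ + _).
transitivity (\sum_(m < q) \sum_(n < H.+1 | (m %| n)%N) (pc m)%:C * Vr (n %/ m)%N * eN q (b * n)).
  apply: eq_bigr => m _; have [->|m0] := posnP m.
    by rewrite !big1 // => i _; rewrite pc0 !mul0r.
  by rewrite (mult_reindex _ (fun a n => (pc m)%:C * Vr a * eN q (b * n)) m0).
rewrite (exchange_big_dep xpredT) //=; apply: eq_bigr => n _.
rewrite -mulr_suml; congr (_ * _); rewrite /conv_Vh0 /Vr /conv_Vh; case: posnP => [->|n0].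
  by rewrite big1 // => m _; rewrite div0n mulr0.
by apply: eq_bigr => m mn; rewrite divn_gt0 ?(dvdn_gt0 n0 mn) // dvdn_leq.
Qed.

Lemma sum_GP_sqr_le N : (N <= q)%N ->
  \sum_(n < N) GPp n ^+ 2 / n%:R <= GG.
Proof.
move=> Nq; have := sum_prod_GP_sqr_le (R := R) uv q0 (leq_trans hqb (leqnSn _)).
apply: le_trans; rewrite -(subnKC Nq) big_split_ord /= lerDl sumr_ge0 // => i _.
by rewrite divr_ge0 ?sqr_ge0.
Qed.

(** After Parseval in b, the factor q/n of [conv_Vh_bound] leaves the same sum of squared block
    products over n as in the direct part. *)
Lemma Anear_bound : \sum_(b < q) nm (Anear b) ^+ 2 <= q%:R ^+ 2 * (72 * GG + 882 * y%:R ^+ 4 / s).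
Proof.
rewrite parseval_trunc // [q%:R ^+ 2]expr2 -mulrA ler_pM2l //.
have nn : 0 <= 882 * y%:R ^+ 4 / s.
  by apply: divr_ge0; [apply: mulr_ge0; [exact: ler0n|exact/exprn_ge0/ler0n]|exact: sqrtr_ge0].
apply: le_trans (_ : \sum_(n < H.+1) (72 * q%:R * (GPp n ^+ 2 / n%:R) + 882 * y%:R ^+ 4 / s) <= _).
  apply: ler_sum => n _; rewrite /conv_Vh0; case: posnP => [->|n0].
    by rewrite nm0 expr0n invr0 !mulr0 add0r.
  have n2 : (2 * n <= q)%N.
    by rewrite mul2n [leqRHS]q_odd ltnW // ltnS leq_double -ltnS ltn_ord.
  pose a : R := 6 * Num.sqrt (q%:R / n%:R) * GPp n; pose e : R := 21 * y%:R ^+ 2 / h.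
  have b1 : nm (conv_Vh n) <= a + e by exact: (conv_Vh_bound n0 n2).
  apply: le_trans (_ : 2 * a ^+ 2 + 2 * e ^+ 2 <= _).
    apply: le_trans (_ : (a + e) ^+ 2 <= _).
      by rewrite lerXn2r ?nnegrE ?nm_ge0 // (le_trans (nm_ge0 _) b1).
    by rewrite -subr_ge0; have -> : 2 * a ^+ 2 + 2 * e ^+ 2 - (a + e) ^+ 2 = (a - e) ^+ 2 by [ring]; exact: sqr_ge0.
  apply: eqle; congr (_ + _).
    by rewrite /a !exprMn sqr_sqrtr ?divr_ge0 //; ring.
  by rewrite /e !exprMn exprVn sq_h; ring.
rewrite big_split /= -mulr_sumr sumr_const card_ord mulrDr; apply: lerD.
  rewrite [q%:R * _]mulrA [q%:R * 72]mulrC ler_wpM2l ?mulr_ge0 //; exact: sum_GP_sqr_le.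
rewrite -[_ *+ H.+1]mulr_natl ler_wpM2r ?ler_nat //.
Qed.

(** Here r m > q/2 - 1 and q is odd, so q <= 2 r y; [Vh_bound] then gives 4y q^(-1/4). *)
Lemma gv_bound m r : (0 < m <= y)%N -> (r < H.+1)%N -> nm (gv m r) ^+ 2 <= 16 * y%:R ^+ 2 / s.
Proof.
move=> /andP[m0 my] rH; rewrite /gv; case: ifP => [/andP[r0 rm]|_]; last first.
  by rewrite nm0 expr0n divr_ge0 ?sqrtr_ge0 // mulr_ge0 ?exprn_ge0.
have r2 : (2 * r <= q)%N.
  by rewrite mul2n [leqRHS]q_odd ltnW // ltnS leq_double -ltnS.
apply: le_trans (_ : (4 * y%:R / h) ^+ 2 <= _); last first.
  by apply: eqle; rewrite !exprMn exprVn sq_h; ring.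
rewrite lerXn2r ?nnegrE ?nm_ge0 ?divr_ge0 ?sqrtr_ge0 ?mulr_ge0 //.
apply: le_trans (Vh_bound r0 r2) _; rewrite ler_wpM2r ?invr_ge0 ?sqrtr_ge0 //.
rewrite ler_pdivrMr ?ltr0n //.
have : q%:R <= 2 * (r%:R * m%:R) :> R.
  rewrite -natrM -(natrM _ 2) ler_nat [leqLHS]q_odd -mul2n.
  by rewrite -(leq_pmul2l (m := 2)) // in rm; lia.
have : r%:R * m%:R <= r%:R * y%:R :> R by rewrite ler_wpM2l // ler_nat.
by move=> a b; rewrite -mulrA [y%:R * _]mulrC; lra.
Qed.

(** Multiplication by m permutes the residues b, after which Parseval applies. *)
Lemma Zv_bound m : (0 < m <= y)%N ->
  \sum_(b < q) nm (Zv m b) ^+ 2 <= q%:R ^+ 2 * (16 * y%:R ^+ 2 / s).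
Proof.
move=> my; have mq : (0 < m < q)%N.
  by case/andP: my => -> my; exact: leq_ltn_trans (yq uv hy).
pose g b : R := nm (\sum_(r < H.+1) gv m r * eN q (b * r)) ^+ 2.
have gq a : g (a %% q)%N = g a.
  rewrite /g; congr (nm _ ^+ 2); apply: eq_bigr => r _; congr (_ * _).
  by rewrite -(eN_mod _ q0) modnMml eN_mod.
rewrite (perm_mul q_pr mq gq) /g parseval_trunc // expr2 -mulrA ler_pM2l //.
apply: le_trans (_ : \sum_(r < H.+1) 16 * y%:R ^+ 2 / s <= _).
  by apply: ler_sum => r _; exact: gv_bound.
rewrite sumr_const card_ord -[_ *+ H.+1]mulr_natl ler_wpM2r ?ler_nat // divr_ge0 ?sqrtr_ge0 //.
Qed.

Lemma Afar_bound : \sum_(b < q) nm (\sum_(m < q) (pc m)%:C * Zv m b) ^+ 2 <= q%:R ^+ 2 * (16 * y%:R ^+ 4 / s).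
Proof.
apply: le_trans (_ : \sum_(b < q) y%:R * \sum_(i < y) nm (Zv i.+1 b) ^+ 2 <= _).
  apply: ler_sum => b _; apply: le_trans (sqr_sum_le _ (a := fun i => nm (Zv i.+1 b)) _); last by move=> i; exact: nm_ge0.
  rewrite lerXn2r ?nnegrE ?nm_ge0 //; first by apply: sumr_ge0 => i _; exact: nm_ge0.
  have z0 e : (y.+1 <= e)%N -> (pc e)%:C * Zv e b = 0.
    move=> ye; have [c0|c0] := eqVneq (cf PP e) 0; first by rewrite /pc c0 !mul0r.
    by have := cf_supp uv (PP_small u v J) c0; rewrite leqNgt ye.
  rewrite (sum_ord_trunc (T := fun m => (pc m)%:C * Zv m b) (yq uv hy) z0).
  rewrite big_ord_recl pc0 mul0r add0r; apply: le_trans (nm_sum _ _ _) _.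
  apply: ler_sum => i _; rewrite nmM nmC ler_piMl ?nm_ge0 // normrM.
  by apply: mulr_ile1 => //; rewrite ?cf_PP_le1 // ger0_norm ?isq_ge0 ?isq_le1.
rewrite -mulr_sumr exchange_big /=.
apply: le_trans (_ : y%:R * \sum_(i < y) q%:R ^+ 2 * (16 * y%:R ^+ 2 / s) <= _).
  by rewrite ler_wpM2l //; apply: ler_sum => i _; apply: Zv_bound => /=.
by rewrite sumr_const card_ord -[_ *+ y]mulr_natl; apply: eqle; ring.
Qed.

Lemma dual_part : \sum_(b < q) nm (\sum_(m < q) (pc m)%:C * tv q ewt (q ^ 2) (b * m)) ^+ 2
  <= 576 * GG + 7184 * (y%:R ^+ 4 / s).
Proof.
apply: le_trans (_ : \sum_(b < q) (4 / q%:R ^+ 2) * (2 * nm (Anear b) ^+ 2 + 2 * nm (\sum_(m < q) (pc m)%:C * Zv m b) ^+ 2) <= _).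
  apply: ler_sum => b _; apply: le_trans (_ : (2 / q%:R * nm (Afull b)) ^+ 2 <= _).
    by rewrite lerXn2r ?nnegrE ?nm_ge0 ?mulr_ge0 ?invr_ge0 ?nm_ge0 // fb_half.
  rewrite exprMn; have -> : (2 / q%:R) ^+ 2 = 4 / q%:R ^+ 2 :> R by rewrite exprMn exprVn; congr (_ * _); ring.
  by rewrite Afull_split ler_wpM2l ?divr_ge0 ?exprn_ge0 // nm2D.
rewrite -mulr_sumr big_split /= -!mulr_sumr.
rewrite [4 / _]mulrC -mulrA ler_pdivrMl ?exprn_gt0 //.
have := Anear_bound; have := Afar_bound.
set S1 := \sum_(b < q) _; set S2 := \sum_(b < q) _ => a b.
have -> : q%:R ^+ 2 * (576 * GG + 7184 * (y%:R ^+ 4 / s)) = 8 * (q%:R ^+ 2 * (72 * GG + 882 * y%:R ^+ 4 / s)) + 8 * (q%:R ^+ 2 * (16 * y%:R ^+ 4 / s)) by ring.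
lra.
Qed.

Lemma second_moment :
  \sum_(j < q.-1 | (0 < j)%N) nm (SL q_pr j Y * DP PP (psi j)) ^+ 2 <= q.-1%:R * (1156 * GG + 3).
Proof.
pose E j := \sum_(0 <= N < Y) ewt N * X j N%:R.
apply: le_trans (_ : \sum_(j < q.-1 | (0 < j)%N) (2 * nm (DD q_pr J j * DP PP (psi j)) ^+ 2 +
    2 * nm (E j * \sum_(m < q) (pc m)%:C * X j m%:R) ^+ 2) <= _).
  by apply: ler_sum => j _; rewrite SL_split mulrDl -pc_sum // nm2D.
rewrite big_split /= -!mulr_sumr.
have d1 := direct_part (R := R) q_pr uv J0 hqb hy.
have d2 := dual_mean_square q_pr ewt (q ^ 2) pc0.
have d3 := dual_part.
have : \sum_(j < q.-1 | (0 < j)%N) nm (DD q_pr J j * DP PP (psi j)) ^+ 2 <= \sum_(j < q.-1) nm (DD q_pr J j * DP PP (psi j)) ^+ 2.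
  by rewrite [leLHS]big_mkcond; apply: ler_sum => j _; case: ifP => // _; exact: sqr_ge0.
have sm : 7184 * (y%:R ^+ 4 / s) <= 1.
  rewrite mulrA ler_pdivrMr // mul1r; apply: le_trans (sge (k := 5) isT).
  rewrite [leRHS]exprS ler_wpM2r ?exprn_ge0 //.
  apply: le_trans (_ : 2 ^+ 13 <= _); first by rewrite -natrX ler_nat.
  by rewrite -natrX ler_nat; apply: leq_trans (y_ge J uv); rewrite leq_exp2l.
have sm2 : y%:R ^+ 4 / q%:R <= y%:R ^+ 4 / s.
  rewrite ler_wpM2l ?exprn_ge0 // lef_pV2 ?posrE // [leRHS]qE.
  by rewrite ler_peMr // ltW.
set D1 := \sum_(j < q.-1) _ in d1 *; set D2 := \sum_(j < q.-1 | _) _.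
set E2 := \sum_(b < q) _ in d2 d3.
set E1 := \sum_(j < q.-1 | _) _ in d2 * => D12.
have Q0 : 0 <= q.-1%:R :> R by [].
have e1 : E1 <= q.-1%:R * (576 * GG + 7184 * (y%:R ^+ 4 / s)).
  by apply: le_trans d2 _; rewrite ler_wpM2l.
have z0 : 0 <= y%:R ^+ 4 / q%:R :> R by rewrite divr_ge0 ?exprn_ge0.
apply: le_trans (_ : q.-1%:R * (2 * (2 * GG + 2 * y%:R ^+ 4 / q%:R) + 2 * (576 * GG + 7184 * (y%:R ^+ 4 / s))) <= _).
  by rewrite mulrDr [q.-1%:R * (2 * _)]mulrCA [q.-1%:R * (2 * _)]mulrCA; lra.
by rewrite ler_wpM2l // -[2 * _ / q%:R]mulrA; lra.
Qed.

End DualPart.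

(** * The theorem *)

Section MomentBasics.
Context {R : realType}.

Lemma sum_sub_le (T : eqType) (r s : seq T) (G : T -> R) :
  uniq r -> uniq s -> {subset r <= s} -> (forall x, 0 <= G x) ->
  \sum_(x <- r) G x <= \sum_(x <- s) G x.
Proof.
move=> ur us rs G0; rewrite [leRHS](bigID (mem r)) /= -[X in _ <= X + _]big_filter.
have -> : \sum_(x <- r) G x = \sum_(x <- [seq x <- s | x \in r]) G x.
  apply/perm_big/uniq_perm; rewrite ?filter_uniq // => x.
  by rewrite mem_filter; apply/idP/andP => [xr|[]//]; rewrite xr rs.
by rewrite lerDl sumr_ge0.
Qed.

(** The characters [chi j] are distinct and non-principal, and all terms of the moment are
    nonnegative. *)
Lemma L_moment_ge (q : nat) (q_pr : prime q) (k : R) :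
  \sum_(j < q.-1 | (0 < j)%N) nm (dirichlet_L (2^-1)%:C (chi q_pr j)) `^ (2 * k) <= L_moment k q.
Proof.
have fin := finite_nonprincipal_characters R (prime_gt0 q_pr).
rewrite /L_moment fsbig_finite //=.
pose r : seq (int -> R[i]) := [seq chi q_pr (val j) | j <- [seq j <- enum 'I_q.-1 | (0 < val j)%N]].
have -> : \sum_(j < q.-1 | (0 < j)%N) nm (dirichlet_L (2^-1)%:C (chi q_pr j)) `^ (2 * k) =
    \sum_(f <- r) (nm (dirichlet_L (2^-1)%:C f)) `^ (2 * k).
  by rewrite /r big_map big_filter big_enum_cond.
apply: sum_sub_le.
- rewrite map_inj_in_uniq => [|i j _ _ e]; first exact/filter_uniq/enum_uniq.
  exact/val_inj/(chi_inj (ltn_ord i) (ltn_ord j) e).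
- exact: finmap.fset_uniq.
- move=> f /mapP[j]; rewrite mem_filter => /andP[j0 _] ->.
  by rewrite in_fset_set // inE; apply: chi_nonprincipal; rewrite j0 ltn_ord.
- by move=> f; exact: powR_ge0.
Qed.

Lemma isq_2 : isq 2 <= 3 / 4 :> R.
Proof.
by rewrite -(ler_pXn2r (n := 2)) ?nnegrE ?isq_ge0 // sqr_isq; lra.
Qed.

Lemma class_sum_le q M a b : (0 < a <= b)%N -> class_sum q M b <= class_sum q M a :> R.
Proof.
move=> /andP[a0 ab]; apply: ler_sum => i _; apply: isq_le; last by rewrite leq_add2l.
by rewrite addn_gt0 a0 orbT.
Qed.

Lemma class_sum_gap q M : (0 < M)%N -> 1 / 4 <= class_sum q M 1 - class_sum q M 2 :> R.
Proof.
case: M => // M _; rewrite /class_sum !big_ord_recl muln0 !add0n isq1.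
have : \sum_(i < M) isq (q * bump 0 i + 2) <= \sum_(i < M) isq (q * bump 0 i + 1) :> R.
  by apply: ler_sum => i _; apply: isq_le; rewrite ?addn1 // addn2.
by have := isq_2; lra.
Qed.

(** Summing over non-principal characters gives q - 2 at a = 1 and -1 at the other units, so the sum
    compares each class with that of 1. All these differences are nonnegative, and a = 2 alone
    supplies 1/4. *)
Lemma sum_SL q (q_pr : prime q) M : (0 < M)%N -> (2 < q)%N ->
  (1 / 4)%:C <= \sum_(j < q.-1 | (0 < j)%N) SL q_pr j (q * M) :> R[i].
Proof.
move=> M0 q2; have q1 := ltnW q2.
have XE (a : nat) : (0 < a < q)%N -> \sum_(j < q.-1 | (0 < j)%N) X q_pr j a%:R = (if a == 1%N then q.-1%:R else 0) - 1 :> R[i].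
  move=> /andP[a0 aq].
  have aF : a%:R != 0 :> 'F_q by rewrite natF_eq0 // gtnNdvd.
  have := X_orth (R := R) q_pr aF (oner_neq0 _).
  have -> : (a%:R == 1 :> 'F_q) = (a == 1%N).
    by rewrite -val_eqE /= val_Fp_nat // modn_small // (Fp_cast q_pr) modn_small.
  under eq_bigr do rewrite X1 (rmorph1 (@conjc R)) mulr1.
  move=> <-; rewrite [in RHS](bigD1 (Ordinal (q1_gt0 q_pr))) //= X01 // [1 + _]addrC addrK.
  by apply: eq_bigl => j; rewrite -val_eqE lt0n.
pose S := \sum_(a < q | (0 < a)%N) (class_sum q M 1 - class_sum q M a) : R.
have -> : \sum_(j < q.-1 | (0 < j)%N) SL q_pr j (q * M) = S%:C :> R[i].
  under eq_bigr do rewrite SL_class_sum //.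
  rewrite exchange_big /=.
  transitivity (\sum_(a < q | (0 < a)%N) (class_sum q M a)%:C * ((if a == 1%N :> nat then q.-1%:R else 0) - 1) : R[i]).
    rewrite [RHS]big_mkcond; apply: eq_bigr => a _; rewrite -mulr_sumr.
    case: posnP => [->|a0]; last by rewrite XE // a0 ltn_ord.
    by rewrite big1 ?mulr0 // => j _; rewrite X0.
  have cnt : \sum_(a < q | (0 < a)%N) (class_sum q M 1)%:C = (class_sum q M 1)%:C *+ q.-1 :> R[i].
    rewrite -(prednK (prime_gt0 q_pr)) big_mkcond big_ord_recl /= add0r sumr_const card_ord.
    by rewrite (prednK (prime_gt0 q_pr)).
  rewrite /S C_sum; under [RHS]eq_bigr do rewrite (rmorphB (real_complex R)).
  rewrite sumrB cnt; under eq_bigr do rewrite mulrBr mulr1.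
  rewrite sumrB; congr (_ - _).
  rewrite (bigD1 (Ordinal q1)) //= big1 ?addr0 => [|a /andP[_ a1]].
    by rewrite mulr_natr.
  by move: a1; rewrite -val_eqE /= => /negPf ->; rewrite mulr0.
rewrite lecR /S (bigD1 (Ordinal q2)) //=; apply: le_trans (class_sum_gap q M0) _.
rewrite lerDl sumr_ge0 // => a /andP[a0 _].
by rewrite subr_ge0 class_sum_le.
Qed.

Lemma L_moment_gt0 (q : nat) (k : R) : prime q -> (2 < q)%N -> 0 < L_moment k q.
Proof.
move=> q_pr q2; have q0 := prime_gt0 q_pr.
pose L j := nm (dirichlet_L (2^-1)%:C (chi q_pr j)) : R.
have [j j0 Lj] : exists2 j : 'I_q.-1, (0 < j)%N & L j != 0.
  have [/existsP[j /andP[j0 Lj]]|/existsPn h] := boolP [exists j : 'I_q.-1, (0 < j)%N && (L j != 0)].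
    by exists j.
  (* Chosen so that the error in [dirichlet_L_approx] is 1/(4q): if every L-value vanished, q - 1
     such errors could not reach 1/4. *)
  pose M := (q * (4 * q) ^ 2)%N.
  have M0 : (0 < M)%N by rewrite muln_gt0 q0 expn_gt0 muln_gt0 q0.
  have b (j : 'I_q.-1) : (0 < j)%N -> nm (SL q_pr j (q * M)) <= 1 / (4 * q%:R) :> R.
    move=> j0; have := dirichlet_L_approx (R := R) q_pr (j := j) _ M0; rewrite j0 ltn_ord => /(_ isT).
    have := h j; rewrite j0 /= => /negPn/eqP L0; rewrite (nm_eq0 L0) sub0r nmN.
    move/le_trans; apply; apply: eqle; rewrite /M -mulnn !isqM.
    have qR : q%:R != 0 :> R by rewrite pnatr_eq0 -lt0n.
    have -> : q%:R * (isq q * (isq q * ((isq 4 * isq q) * (isq 4 * isq q)))) = q%:R * (isq q ^+ 2) * (isq 4 ^+ 2 * isq q ^+ 2) :> R by ring.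
    by rewrite !sqr_isq mulfV // !mul1r invfM.
  have lo := sum_SL q_pr M0 q2.
  have : nm (\sum_(j < q.-1 | (0 < j)%N) SL q_pr j (q * M)) <= q.-1%:R * (1 / (4 * q%:R)) :> R.
    apply: le_trans (nm_sum _ _ _) _.
    apply: le_trans (_ : \sum_(j < q.-1) 1 / (4 * q%:R) <= _).
      rewrite [leLHS]big_mkcond; apply: ler_sum => j _; case: ifP => [/b //|_].
      by rewrite divr_ge0 ?mulr_ge0.
    by rewrite sumr_const card_ord -[_ *+ _]mulr_natl.
  have : 1 / 4 <= nm (\sum_(j < q.-1 | (0 < j)%N) SL q_pr j (q * M)) :> R.
    apply: le_trans (Re_le_nm _); apply: le_trans (ler_norm _).
    by move: lo; rewrite lecE => /andP[].
  move=> h1 h2; have := le_trans h1 h2.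
  have qR : 0 < q%:R :> R by rewrite ltr0n.
  rewrite mulrCA ler_pM2l // ler_pdivlMr ?mulr_gt0 //.
  have : q%:R = q.-1%:R + 1 :> R by rewrite natr1 prednK.
  lra.
apply: lt_le_trans (L_moment_ge q_pr k).
rewrite (bigD1 j) //= ltr_wpDr ?sumr_ge0 // => [i _|]; first exact: powR_ge0.
by rewrite powR_gt0 // lt_neqAle eq_sym Lj nm_ge0.
Qed.
End MomentBasics.

Section LargeModulus.
Context {R : realType}.

(** Split x as x^k x^(1-k). The arithmetic-geometric mean isolates x^(2k), and x^(1-k) a^u is a
    weighted geometric mean of x and a^v, hence at most their maximum. *)
Lemma young (u v : nat) (x p a T : R) : (0 < u < v)%N -> 0 <= x -> 0 <= p -> 0 <= a -> 0 < T ->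
  x * p * a ^+ u <= T / 2 * x `^ (2 * kk u v) + ((x * p) ^+ 2 + (p * a ^+ v) ^+ 2) / (2 * T).
Proof.
move=> uv x0 p0 a0 T0; have /andP[k0 k1] := @kk_bounds R _ _ uv; set k := kk u v in k0 k1 *.
have [->|x1] := eqVneq x 0.
  rewrite !mul0r; apply: addr_ge0; first by apply: mulr_ge0; rewrite ?powR_ge0 // divr_ge0 // ltW.
  by apply: divr_ge0; [apply: addr_ge0; exact: sqr_ge0|rewrite mulr_ge0 // ltW].
have xp : 0 < x by rewrite lt_neqAle eq_sym x1.
pose W := x `^ k; pose V := x `^ (1 - k).
have WV : x = W * V.
  by rewrite -powRD ?x1 ?implybT // addrC subrK powRr1.
have WW : x `^ (2 * k) = W ^+ 2.
  by rewrite mulrC powRrM -(powR_mulrn 2) ?powR_ge0.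
have v0 : v%:R != 0 :> R by rewrite pnatr_eq0 -lt0n (v_gt0 uv).
pose z := a ^+ v.
have auE : a ^+ u = z `^ k.
  rewrite /z -!powR_mulrn // -powRrM; congr (_ `^ _).
  by rewrite /k /kk mulrC divfK.
pose m : R := Num.max x z.
have xm : x <= m by rewrite le_max lexx.
have zm : z <= m by rewrite le_max lexx orbT.
have m0 : 0 < m by exact: lt_le_trans xm.
have mn : m != 0 by rewrite gt_eqF.
have z0 : 0 <= z by exact: exprn_ge0.
have key : (V * a ^+ u) ^+ 2 <= x ^+ 2 + z ^+ 2.
  have le_m : V * a ^+ u <= m.
    rewrite -[leRHS](powRr1 (ltW m0)) -[X in _ <= _ `^ X](subrK k) powRD ?mn ?implybT //.
    by rewrite auE; apply: ler_pM; rewrite ?powR_ge0 // ge0_ler_powR ?nnegrE // ltW // subr_gt0.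
  apply: (@le_trans _ _ (m ^+ 2)).
    by rewrite lerXn2r ?nnegrE ?mulr_ge0 ?powR_ge0 ?exprn_ge0 // ltW.
  by rewrite /m /Num.max; case: ifP => _; rewrite ?lerDr ?lerDl sqr_ge0.
rewrite WW; set B := p * (V * a ^+ u).
have -> : x * p * a ^+ u = W * B by rewrite /B {1}WV; ring.
apply: le_trans (_ : T / 2 * W ^+ 2 + B ^+ 2 / (2 * T) <= _).
  rewrite -subr_ge0.
  have -> : T / 2 * W ^+ 2 + B ^+ 2 / (2 * T) - W * B = (T * W - B) ^+ 2 / (2 * T).
    by field; rewrite gt_eqF.
  by rewrite divr_ge0 ?sqr_ge0 // mulr_ge0 // ltW.
rewrite lerD2l; apply: ler_wpM2r; first by rewrite invr_ge0 mulr_ge0 // ltW.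
have -> : (x * p) ^+ 2 + (p * a ^+ v) ^+ 2 = p ^+ 2 * (x ^+ 2 + z ^+ 2).
  by rewrite -/z !exprMn mulrDr [p ^+ 2 * x ^+ 2]mulrC.
by rewrite /B [leLHS]exprMn ler_wpM2l ?sqr_ge0.
Qed.

Lemma expR2_le : expR 2 <= 16 :> R.
Proof.
have -> : 2 = 2^-1 * 4%:R :> R by lra.
rewrite expRM_natr; have -> : 16 = 2 ^+ 4 :> R by ring.
by rewrite lerXn2r ?nnegrE ?expR_ge0 // expR_half_le2.
Qed.

Section Fixed.
Variables (q u v J c : nat).
Hypothesis q_pr : prime q.
Hypothesis uv : (0 < u < v)%N.
Hypothesis J0 : (0 < J)%N.
Hypothesis hqb : (q <= bd (J + c))%N.
Local Notation y := (ylen v J).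
Hypothesis hy : (y ^ 100 <= q)%N.
Local Notation PP := (PP u v J : nat -> {poly R}).
Local Notation AA := (AA v J : nat -> {poly R}).
Local Notation kk := (kk u v : R).
Local Notation psi := (@psi R q q_pr).
Local Notation s := (Num.sqrt q%:R : R).
Local Notation E := (expR (kk ^+ 2 * sJ J) : R).
Local Notation Q := (q.-1%:R : R).
Local Notation P j := (DP J PP (psi j)).
Local Notation A j := (DP J AA (psi j)).
Local Notation L j := (dirichlet_L (2^-1)%:C (chi q_pr j) : R[i]).
Local Notation S j := (SL q_pr j (q * q ^ 2) : R[i]).

Let q0 : (0 < q)%N. Proof. exact: prime_gt0. Qed.
Let qR : 0 < q%:R :> R. Proof. by rewrite ltr0n. Qed.
Let s0 : 0 < s. Proof. by rewrite sqrtr_gt0. Qed.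

Lemma E_ge1 : 1 <= E.
Proof.
rewrite -[leLHS]expR0 ler_expR; apply: mulr_ge0; first exact: sqr_ge0.
by apply: sumr_ge0 => i _; exact: sB_ge0.
Qed.

Lemma approx_Y j : (0 < j < q.-1)%N -> nm (L j - S j) <= isq q.
Proof.
move=> jq; have M0 : (0 < q ^ 2)%N by rewrite expn_gt0 q0.
apply: le_trans (dirichlet_L_approx q_pr jq M0) _; apply: eqle; rewrite -mulnn !isqM.
have -> : q%:R * (isq q * (isq q * isq q)) = (q%:R * isq q ^+ 2) * isq q :> R by ring.
by rewrite sqr_isq mulfV ?mul1r // gt_eqF.
Qed.

Lemma P_le j : nm (P j) <= y%:R.
Proof. by apply: (DP_le_len _ uv _ (PP_small u v J)) => n; exact: cf_PP_le1. Qed.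

Lemma A_le j : nm (A j) ^+ u <= y%:R.
Proof.
rewrite -nm_exp -DP_exp; apply: (DP_le_len _ uv _ (RR_small J uv)) => n.
exact: cf_RR_le1.
Qed.

Lemma delta_small : y%:R ^+ 2 * isq q <= 1 / 1000 :> R.
Proof.
rewrite /isq ler_pdivrMr //; have := s_ge (R := R) uv hy (k := 3) isT.
have yb : 1000 <= y%:R :> R.
  by rewrite ler_nat; apply: leq_trans (y_ge J uv); apply: leq_trans (_ : 2 ^ 10 <= _)%N => //; rewrite leq_exp2l.
rewrite exprS => h; have := sqr_ge0 (y%:R : R); nra.
Qed.

Lemma isq_q_s : isq q * s = 1.
Proof. by rewrite /isq mulVf // gt_eqF. Qed.

(** exp(-2) >= 1/16 leaves E/16, from which errors of at most 9/1000 are subtracted; E >= 1 makes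
    the rest at least E/32. *)
Lemma first_L : Q * E / 32 <= \sum_(j < q.-1 | (0 < j)%N) nm (L j) * nm (P j) * nm (A j) ^+ u.
Proof.
have q20 : (0 < q ^ 2)%N by rewrite expn_gt0 q0.
have fm := first_moment (R := R) q_pr uv (yq uv hy) q20.
have pw : \sum_(j < q.-1 | (0 < j)%N) nm (S j) * nm (P j) * nm (A j) ^+ u <=
  \sum_(j < q.-1 | (0 < j)%N) nm (L j) * nm (P j) * nm (A j) ^+ u + Q * (y%:R ^+ 2 * isq q).
  apply: le_trans (_ : \sum_(j < q.-1 | (0 < j)%N) (nm (L j) * nm (P j) * nm (A j) ^+ u + y%:R ^+ 2 * isq q) <= _).
    apply: ler_sum => j j0; have ap : nm (L j - S j) <= isq q by apply: approx_Y; rewrite j0 ltn_ord.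
    have tr : nm (S j) <= nm (L j) + isq q.
      have -> : S j = L j - (L j - S j) by ring.
      by apply: le_trans (nmB _ _) _; rewrite lerD2l.
    have p0 := nm_ge0 (P j); have a0 : 0 <= nm (A j) ^+ u by rewrite exprn_ge0 ?nm_ge0.
    apply: le_trans (_ : (nm (L j) + isq q) * nm (P j) * nm (A j) ^+ u <= _).
      by rewrite ler_wpM2r // ler_wpM2r.
    rewrite -mulrA -[nm (L j) * _ * _]mulrA mulrDl lerD2l [leRHS]mulrC; apply: ler_wpM2l; first exact: isq_ge0.
    by rewrite expr2; apply: ler_pM => //; [exact: P_le|exact: A_le].
  rewrite big_split /= lerD2l; apply: le_trans (_ : \sum_(j < q.-1) y%:R ^+ 2 * isq q <= _).
    rewrite [leLHS]big_mkcond; apply: ler_sum => j _; case: ifP => // _.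
    by rewrite mulr_ge0 ?isq_ge0 ?sqr_ge0.
  by rewrite sumr_const card_ord -[_ *+ _]mulr_natl.
have sQ : s <= 2 * Q * isq q.
  rewrite -(ler_pM2r s0) -[_ * isq q * s]mulrA isq_q_s mulr1 -expr2 sqr_sqrtr ?ler0n //.
  have : q%:R = Q + 1 :> R by rewrite natr1 prednK.
  have : 1 <= Q by rewrite (ler_nat _ 1); exact: q1_gt0.
  lra.
have d0 : 0 <= y%:R ^+ 2 * isq q :> R by rewrite mulr_ge0 ?isq_ge0 ?sqr_ge0.
have ds := delta_small.
have e2 : E / 16 <= expR (kk ^+ 2 * sJ J - 2).
  by rewrite expRD expRN ler_pM2l ?expR_gt0 // lef_pV2 ?posrE ?expR_gt0 // expR2_le.
have e1 := E_ge1.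
have Q0 : 0 <= Q by [].
have t3 : 3 * y%:R ^+ 2 * s <= Q * (6 * (y%:R ^+ 2 * isq q)).
  have -> : Q * (6 * (y%:R ^+ 2 * isq q)) = 3 * y%:R ^+ 2 * (2 * Q * isq q) by ring.
  by rewrite ler_wpM2l // mulr_ge0 // sqr_ge0.
have := le_trans fm pw.
set X := \sum_(j < _ | _) _.
move=> h.
apply: le_trans (_ : Q * (expR (kk ^+ 2 * sJ J - 2) - 2 * (y%:R ^+ 2 * isq q) - 6 * (y%:R ^+ 2 * isq q) - y%:R ^+ 2 * isq q) <= _).
  rewrite -mulrA ler_wpM2l //; lra.
rewrite !mulrBr; rewrite mulrBr -[2 * _ * isq q]mulrA in h; lra.
Qed.

Lemma second_L : \sum_(j < q.-1 | (0 < j)%N) nm (L j * P j) ^+ 2 <= Q * E * (2312 * expR (CS v c) + 8).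
Proof.
apply: le_trans (_ : \sum_(j < q.-1 | (0 < j)%N) (2 * nm (S j * P j) ^+ 2 + 2) <= _).
  apply: ler_sum => j j0; have ap : nm (L j - S j) <= isq q by apply: approx_Y; rewrite j0 ltn_ord.
  have -> : L j * P j = S j * P j + (L j - S j) * P j by ring.
  apply: le_trans (nm2D _ _) _; rewrite lerD2l -[leRHS]mulr1 ler_wpM2l //.
  rewrite nmM; apply: exprn_ile1; first by rewrite mulr_ge0 ?nm_ge0.
  apply: le_trans (_ : isq q * y%:R <= _); first by rewrite ler_pM ?nm_ge0 ?P_le.
  rewrite mulrC /isq ler_pdivrMr // mul1r.
  by have := s_ge (R := R) uv hy (k := 1) isT; rewrite expr1.
rewrite big_split /= -mulr_sumr.
have sm := second_moment (R := R) q_pr uv J0 hqb hy.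
have c2 : \sum_(j < q.-1 | (0 < j)%N) 2 <= Q * 2 :> R.
  apply: le_trans (_ : \sum_(j < q.-1) 2 <= _).
    by rewrite [leLHS]big_mkcond; apply: ler_sum => j _; case: ifP.
  by rewrite sumr_const card_ord -[_ *+ _]mulr_natl.
rewrite expRD in sm.
have Q0 : 0 <= Q by []; have e1 := E_ge1.
apply: le_trans (lerD (ler_wpM2l _ sm) c2) _ => //.
rewrite [2 * (Q * _)]mulrCA -mulrDr -mulrA ler_wpM2l //.
have := expR_ge0 (CS v c : R); nra.
Qed.

(** The value of T in [young] for which the second and third moments cost [Q * E / 64], half of the
    lower bound of [first_L]. *)
Definition lossC : R := 32 * (2312 * expR (CS v c) + 8 + expR (expR 32)).

Lemma lossC_gt0 : 0 < lossC.
Proof.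
apply: mulr_gt0; first by rewrite ltr0n.
apply: addr_gt0; last exact: expR_gt0.
apply: addr_gt0; last by rewrite ltr0n.
by apply: mulr_gt0; [rewrite ltr0n|exact: expR_gt0].
Qed.

Lemma lossC_split (x : R) :
  (x * (2312 * expR (CS v c) + 8) + x * expR (expR 32)) / (2 * lossC) = x / 64.
Proof.
have := lossC_gt0; rewrite /lossC; set a := _ + 8; set b := expR (expR 32) => h.
rewrite -mulrDr; move: (a + b) h => D; rewrite pmulr_rgt0; last by rewrite ltr0n.
by move=> /gt_eqF D0; field; rewrite D0.
Qed.

Lemma moment_lower : Q * E / (32 * lossC) <= L_moment kk q.
Proof.
have := lossC_split (Q * E); have := lossC_gt0; move: lossC => T T0 TE.
have T2 : 0 < 2 * T by apply: mulr_gt0.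
have T32 : 0 < 32 * T by apply: mulr_gt0.
apply: le_trans (L_moment_ge q_pr _).
set X := \sum_(j < _ | _) _.
have h : Q * E / 32 <= T / 2 * X + Q * E / 64.
  apply: le_trans first_L _.
  apply: le_trans (_ : \sum_(j < q.-1 | (0 < j)%N) (T / 2 * nm (L j) `^ (2 * kk) +
     (nm (L j * P j) ^+ 2 + nm (P j * A j ^+ v) ^+ 2) / (2 * T)) <= _).
    apply: ler_sum => j _; rewrite !nmM nm_exp.
    by apply: young => //; exact: nm_ge0.
  rewrite big_split /= -mulr_sumr lerD2l -mulr_suml -TE; apply: ler_wpM2r.
    by rewrite invr_ge0 ltW.
  rewrite big_split /=; apply: lerD; first exact: second_L.
  apply: le_trans (_ : \sum_(j < q.-1) nm (P j * A j ^+ v) ^+ 2 <= _).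
    by rewrite [leLHS]big_mkcond; apply: ler_sum => j _; case: ifP => // _; exact: sqr_ge0.
  by apply: le_trans (third_moment q_pr uv (yq uv hy)) _; rewrite expRD mulrA.
rewrite ler_pdivrMr //.
have -> : X * (32 * T) = 64 * (T / 2 * X) by field.
by move: (T / 2 * X) (Q * E) h => a b; lra.
Qed.

End Fixed.
End LargeModulus.

(* [ylen v J ^ 100 = 2 ^ (4000 * v * 2 ^ J)]. *)
Lemma exists_scale (v q : nat) : (0 < v)%N -> (2 ^ (8000 * v) <= q)%N ->
  exists J, [/\ (0 < J)%N, (q <= bd (J + (4000 * v).+1))%N & (ylen v J ^ 100 <= q)%N].
Proof.
move=> v0 hq; have q0 : (0 < q)%N by apply: leq_trans hq; rewrite expn_gt0.
have /andP[qlo qhi] := trunc_log_bounds (isT : 1 < 2)%N q0.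
set N := trunc_log 2 q in qlo qhi.
have hN : (8000 * v <= N)%N by apply: trunc_log_max.
(* J is determined by 2^J d <= log2 q < 2^(J+1) d up to integer parts, and d <= 2^d turns the upper
   bound into [J + d.+1] blocks. The bound 2^(8000 v) on q makes J positive. *)
pose d := (4000 * v)%N; have d0 : (0 < d)%N by rewrite muln_gt0.
have Nd : (2 <= N %/ d)%N.
  rewrite leq_divRL // /d mulnA.
  by apply: leq_trans hN; rewrite leq_mul2r; apply/orP; right; apply/eqP; rewrite -[8000%N]/(2 * 4000)%N subnn.
have n0 : (0 < N %/ d)%N by apply: leq_trans Nd.
have /andP[jlo jhi] := trunc_log_bounds (isT : 1 < 2)%N n0.
set J := trunc_log 2 (N %/ d) in jlo jhi.
exists J; split; first exact: trunc_log_max.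
- apply/ltnW/(leq_trans qhi); rewrite /bd leq_exp2l //.
  have h : (N < 2 ^ J.+1 * d)%N by rewrite -ltn_divLR.
  apply: leq_trans h _; rewrite addnS !expnS expnD -mulnA leq_mul2l /= leq_mul2l.
  by apply/orP; right; exact/ltnW/ltn_expl.
apply: leq_trans qlo; rewrite /ylen -expnM leq_exp2l //.
have h : (2 ^ J * d <= N)%N by rewrite -leq_divRL.
apply: leq_trans h; rewrite mulnAC mulnC leq_mul2l /d; apply/orP; right.
by rewrite [(40 * v)%N]mulnC -mulnA mulnC leq_mul2r; apply/orP; right.
Qed.

Section Final.
Context {R : realType}.

Lemma large_bound (u v : nat) : (0 < u < v)%N -> exists2 c : R, 0 < c &
  forall q, prime q -> (2 ^ (8000 * v) <= q)%N ->
    c * ((totient q)%:R * (ln (q%:R : R)) `^ (kk u v ^+ 2)) <= L_moment (kk u v : R) q.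
Proof.
move=> uv; have v0 := v_gt0 uv; set c := (4000 * v).+1.
pose T := lossC v c : R; have T0 : 0 < T by exact: lossC_gt0.
(* ln q <= 2^(J+c), and [exp_sJ_ge] bounds 2^J by 16 exp(sJ), so [w] times ln q is at most
   exp(sJ). *)
pose w : R := (16 * 2 ^+ c)^-1.
have w0 : 0 < w by rewrite invr_gt0 mulr_gt0 // exprn_gt0.
have T32 : 0 < 32 * T by rewrite mulr_gt0 // ltr0n.
exists ((32 * T)^-1 * w `^ (kk u v ^+ 2)); first by rewrite mulr_gt0 ?invr_gt0 // powR_gt0.
move=> q q_pr hq; have [J [J0 hqb hy]] := exists_scale v0 hq.
apply: le_trans (moment_lower (R := R) q_pr uv J0 hqb hy); rewrite -/c -/T.
rewrite totient_prime //; set k2 := kk u v ^+ 2.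
have q0 := prime_gt0 q_pr.
have ln0 : 0 <= ln (q%:R : R) by rewrite ln_ge0 // (ler_nat _ 1).
have -> : (32 * T)^-1 * w `^ k2 * (q.-1%:R * ln q%:R `^ k2) = q.-1%:R * (w `^ k2 * ln q%:R `^ k2) / (32 * T) by ring.
rewrite ler_wpM2r ?invr_ge0 ?(ltW T32) // ler_wpM2l //.
rewrite -powRM // ?(ltW w0) // mulrC [k2 * _]mulrC expRM ge0_ler_powR ?nnegrE ?sqr_ge0 ?expR_ge0 //.
  by rewrite mulr_ge0 // ltW.
apply: le_trans (exp_sJ_ge J).
rewrite /w invfM mulrA mulrAC ler_wpM2r ?invr_ge0 // ler_pdivrMr ?exprn_gt0 //.
rewrite natrX -exprD.
apply: le_trans (_ : ln ((2 : R) ^+ (2 ^ (J + c))) <= _).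
  by rewrite ler_ln ?posrE ?ltr0n ?exprn_gt0 // -natrX ler_nat.
rewrite lnXn // -[_ *+ _]mulr_natl natrX ler_piMr ?exprn_ge0 //.
by have := @le_ln1Dx R 1 ltac:(by []); have -> : 1 + 1 = 2 :> R by [].
Qed.

Lemma uniform_constant (P : pred nat) (f g : nat -> R) n :
  (forall q, P q -> 0 < g q) -> (forall q, 0 <= f q) ->
  exists2 c : R, 0 < c & forall q, (q < n)%N -> P q -> c * f q <= g q.
Proof.
move=> g0 f0; elim: n => [|n [c c0 IH]]; first by exists 1.
have [Pn|Pn] := boolP (P n); last first.
  exists c => // q; rewrite ltnS leq_eqVlt => /predU1P[->|/IH//].
  by rewrite (negPf Pn).
pose d := g n / (1 + f n); have f1 : 0 < 1 + f n by rewrite ltr_pwDl.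
have d0 : 0 < d by rewrite divr_gt0 ?g0.
exists (Num.min c d); first by rewrite lt_min c0 d0.
move=> q; rewrite ltnS leq_eqVlt => /predU1P[->|qn] Pq.
  apply: le_trans (_ : d * f n <= _); first by rewrite ler_wpM2r // ge_min lexx orbT.
  rewrite /d mulrAC ler_pdivrMr // ler_wpM2l ?(ltW (g0 _ Pn)) // lerDr.
  exact: ler01.
by apply: le_trans (IH _ qn Pq); rewrite ler_wpM2r // ge_min lexx.
Qed.

End Final.

(* For q = 2 there is no non-principal character and the bound fails. *)
Theorem theorem1 (R : realType) (k : rat) (hk0 : 0 < k) (hk1 : k < 1) :
  exists c : R, 0 < c /\
    forall q : nat, prime q -> (2 < q)%N ->
      c * ((totient q)%:R * (ln (q%:R : R)) `^ (ratr k ^+ 2))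
        <= L_moment (ratr k : R) q.
Proof.
pose u := `|numq k|%N; pose v := `|denq k|%N.
have kE : ratr k = kk u v :> R.
  have uE : u%:Z = numq k by rewrite gez0_abs // ltW // numq_gt0.
  have vE : v%:Z = denq k by rewrite gez0_abs // ltW // denq_gt0.
  by rewrite /ratr /kk -uE -vE.
have v0 : (0 < v)%N by rewrite absz_gt0 denq_neq0.
have uv : (0 < u < v)%N.
  rewrite absz_gt0 numq_eq0 gt_eqF //=.
  have : ratr k < 1 :> R by rewrite -(rmorph1 (@ratr R)) ltr_rat.
  by rewrite kE /kk ltr_pdivrMr ?ltr0n // mul1r ltr_nat.
rewrite kE.
have [c1 c10 large] := large_bound (R := R) uv.
pose f q : R := (totient q)%:R * (ln (q%:R : R)) `^ (kk u v ^+ 2).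
have f0 q : 0 <= f q by rewrite mulr_ge0 ?powR_ge0.
have pos q : prime q && (2 < q)%N -> 0 < L_moment (kk u v : R) q.
  by move=> /andP[]; exact: L_moment_gt0.
have [c2 c20 small] := uniform_constant (2 ^ (8000 * v)) pos f0.
exists (Num.min c1 c2); split=> [|q q_pr q2]; first by rewrite lt_min c10 c20.
have [m1 m2] : Num.min c1 c2 <= c1 /\ Num.min c1 c2 <= c2 by rewrite !ge_min !lexx orbT.
have [qs|ql] := ltnP q (2 ^ (8000 * v)).
  by apply: le_trans (ler_wpM2r (f0 q) m2) (small q qs _); rewrite q_pr.
exact: le_trans (ler_wpM2r (f0 q) m1) (large q q_pr ql).
Qed.
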